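(* Let $n\ge1$. Two diagonal rectangulations $R$ and $R'$ of size $n$ satisfy $R\lessdot R'$ (i.e. $R'$ covers $R$) in the lattice $\mathrm{dRec}_n$ if and only if they are related by a pivot such that the pivoted edge in $R$ is vertical (i.e. $R'$ is obtained from $R$ by pivoting a vertical edge of $R$).
   Context: Diagonal rectangulations. Let $S$ be a square with sides parallel to the coordinate axes; its diagonal is the interior of the segment from its top-left corner to its bottom-right corner. For a subdivision of $S$ into finitely many (axis-parallel) rectangles, the walls are the maximal line segments contained in the union of the boundaries of the rectangles, excluding the four edges of $S$. For a set $X$ of $n-1$ distinct points on the diagonal, a diagonal rectangulation of $(S,X)$ is a subdivision of $S$ into rectangles such that no two walls intersect in their interiors, every wall contains a point of $X$, and every point of $X$ lies on exactly one wall. Diagonal rectangulations are considered up to dilation or translation of $S$ and order-preserving motion of the points of $X$ along the diagonal (carrying the walls along); an equivalence class is a diagonal rectangulation of size $n$, and it has a unique integral representative, with $S=[0,n]\times[0,n]$ and $X=\{(i,n-i):1\le i\le n-1\}$. $\mathrm{dRec}_n$ is the set of diagonal rectangulations of size $n$, identified with their integral representatives. The map $\rho:S_n\to\mathrm{dRec}_n$ (permutations in one-line notation). Let $S=[0,n]\times[0,n]$, $p_i=(i,n-i)$ for $0\le i\le n$, and give the space between $p_{k-1}$ and $p_k$ the label $k$. Read $x_1\cdots x_n$ from left to right, drawing one rectangle for each entry. Let $T_{i-1}$ be the union of the left and bottom edges of $S$ and the rectangles drawn in the first $i-1$ steps. In step $i$, put $k=x_i$, $p=p_{k-1}$, $p'=p_k$,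 and draw the rectangle with the following top-left and bottom-right corners. If $p\notin T_{i-1}$, the top-left corner is the rightmost point of $T_{i-1}$ directly left of $p$; if $p\in T_{i-1}$, it is the highest point of $T_{i-1}$ directly above (or equal to) $p$. If $p'\notin T_{i-1}$, the bottom-right corner is the highest point of $T_{i-1}$ directly below $p'$; if $p'\in T_{i-1}$, it is the rightmost point of $T_{i-1}$ directly right of (or equal to) $p'$. The $n$ rectangles drawn form $\rho(x)$. The lattice $\mathrm{dRec}_n$. The weak order on $S_n$ is the partial order in which one moves up by a cover by swapping adjacent entries $x_i<x_{i+1}$. A twisted Baxter permutation is one containing neither 3-41-2 (a subsequence $c\,d\,a\,b$, $a<b<c<d$, with $d$ immediately before $a$) nor 2-41-3 (a subsequence $b\,d\,a\,c$, $a<b<c<d$, with $d$ immediately before $a$). The map $\rho$ restricts to a bijection from twisted Baxter permutations in $S_n$ to $\mathrm{dRec}_n$, and its fibers are the classes of a lattice congruence $\Theta_{\mathrm{tB}}$ of the weak order whose minimal class representatives are the twisted Baxter permutations. The partial order (in fact lattice) on $\mathrm{dRec}_n$ is that of the quotient of the weak order by $\Theta_{\mathrm{tB}}$; equivalently, $R\le R'$ if and only if $x\le x'$ in the weak order, where $x,x'$ are the twisted Baxter permutations with $\rho(x)=R$, $\rho(x')=R'$. Pivots. A vertex of $R$ is a vertex of some rectangle of $R$. An edge of $R$ is a line segment contained in an edge of some rectangle of $R$, with both endpoints vertices of $R$ and no vertex of $R$ in its interior. Every vertex $v$ other than the corners of $S$ is incident to exactly three edges; the unmatched edge at $v$ is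 the one not opposite another edge at $v$, the other two are matched, and $v$ is an up, down, right or left vertex according to the direction in which its unmatched edge leaves $v$. Left and down vertices lie above the diagonal; right and up vertices lie below it. For such $v$, exactly two edges leave $v$ in the direction of the diagonal (left and down if $v$ is above the diagonal, right and up if below): the unmatched edge and one other, and that other edge is said to be locked by $v$. Any edge incident to a corner of $S$ is also locked. An edge $E$ can be pivoted if and only if it is not locked by any vertex; then it lies in the boundary of exactly two rectangles $U_1,U_2$ of $R$. (i) Diagonal pivot: if $E$ is the unmatched edge of both its endpoints, then $E$ meets the diagonal at a point $p\in X$ and $U_1\cup U_2$ is a rectangle; remove $E$ and insert the unique other segment $E'$ through $p$ cutting $U_1\cup U_2$ into two rectangles. (ii) Vertex pivot: if $E$ is a matched edge of one endpoint $v$, then $E$ is the unmatched edge of its other endpoint and $U_1\cup U_2$ is an L-shaped hexagon; remove $E$ and insert the unique other segment $E'$ cutting $U_1\cup U_2$ into two rectangles. In both cases the result is a diagonal rectangulation of size $n$; a vertical edge is replaced by a horizontal one or vice versa, and pivoting $E'$ reverses the operation. *)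

(* Defs.v *)
From HB Require Import structures.
From mathcomp Require Import all_boot all_order all_algebra all_fingroup finmap.

Set Implicit Arguments.
Unset Strict Implicit.
Unset Printing Implicit Defensive.

Import Order.TTheory GRing.Theory Num.Theory.
Local Open Scope ring_scope.

(* The plane is F * F for an arbitrary ordered field F (e.g. the reals).      *)
(* A box is given by its bottom-left and top-right corners. Rectangles and    *)
(* axis-parallel segments are both boxes: a rectangle has two positive side   *)
(* lengths, a segment exactly one.                                            *)
Notation point F := (F * F)%type.
Notation box F := (point F * point F)%type.

Definition in_box {F : realFieldType} (b : box F) (p : point F) : bool :=
  (b.1.1 <= p.1 <= b.2.1) && (b.1.2 <= p.2 <= b.2.2).

Definition box_sub {F : realFieldType} (b c : box F) : Prop :=
  forall p, in_box b p -> in_box c p.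

Definition is_rect {F : realFieldType} (b : box F) : bool :=
  (b.1.1 < b.2.1) && (b.1.2 < b.2.2).

Definition rect_interior {F : realFieldType} (b : box F) (p : point F) : bool :=
  (b.1.1 < p.1 < b.2.1) && (b.1.2 < p.2 < b.2.2).

Definition rect_boundary {F : realFieldType} (b : box F) (p : point F) : bool :=
  in_box b p && ~~ rect_interior b p.

Definition bottom_left {F : realFieldType} (b : box F) : point F := b.1.
Definition top_right {F : realFieldType} (b : box F) : point F := b.2.
Definition top_left {F : realFieldType} (b : box F) : point F := (b.1.1, b.2.2).
Definition bottom_right {F : realFieldType} (b : box F) : point F :=
  (b.2.1, b.1.2).

Definition corners {F : realFieldType} (b : box F) : seq (point F) :=
  [:: bottom_left b; bottom_right b; top_left b; top_right b].

Definition left_side {F : realFieldType} (b : box F) : box F :=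
  (bottom_left b, top_left b).
Definition right_side {F : realFieldType} (b : box F) : box F :=
  (bottom_right b, top_right b).
Definition bottom_side {F : realFieldType} (b : box F) : box F :=
  (bottom_left b, bottom_right b).
Definition top_side {F : realFieldType} (b : box F) : box F :=
  (top_left b, top_right b).

Definition sides {F : realFieldType} (b : box F) : seq (box F) :=
  [:: left_side b; right_side b; bottom_side b; top_side b].

Definition vertical {F : realFieldType} (e : box F) : bool :=
  (e.1.1 == e.2.1) && (e.1.2 < e.2.2).
Definition horizontal {F : realFieldType} (e : box F) : bool :=
  (e.1.1 < e.2.1) && (e.1.2 == e.2.2).
Definition is_seg {F : realFieldType} (e : box F) : bool :=
  vertical e || horizontal e.

Definition seg_interior {F : realFieldType} (e : box F) (p : point F) : bool :=
  [&& in_box e p, p != e.1 & p != e.2].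

(* Diagonal rectangulations of size n, through their integral representatives:*)
(* only the square S and the set X = {p_1, ..., p_(n-1)} are prescribed.       *)

Definition square (F : realFieldType) (n : nat) : box F :=
  ((0, 0), (n%:R, n%:R)).

Definition diag_pt (F : realFieldType) (n i : nat) : point F :=
  (i%:R, n%:R - i%:R).

Definition in_X {F : realFieldType} (n : nat) (p : point F) : Prop :=
  exists i : nat, (0 < i < n)%N /\ p = diag_pt F n i.

Definition subdivision {F : realFieldType} (S : box F) (R : {fset box F}) :
    Prop :=
  [/\ forall r, r \in R -> is_rect r,
      forall p, in_box S p <-> (exists2 r, r \in R & in_box r p)
    & forall r r' p, r \in R -> r' \in R ->
        rect_interior r p -> rect_interior r' p -> r = r'].

Definition skeleton {F : realFieldType} (R : {fset box F}) (p : point F) :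
    Prop :=
  exists2 r, r \in R & rect_boundary r p.

Definition seg_in_skeleton {F : realFieldType} (R : {fset box F}) (w : box F) :
    Prop :=
  is_seg w /\ (forall p, in_box w p -> skeleton R p).

Definition wall {F : realFieldType} (S : box F) (R : {fset box F}) (w : box F) :
    Prop :=
  [/\ seg_in_skeleton R w,
      forall s, seg_in_skeleton R s -> box_sub w s -> s = w
    & w \notin sides S].

Definition is_drec {F : realFieldType} (n : nat) (R : {fset box F}) : Prop :=
  let S := square F n in
  [/\ subdivision S R,
      forall w w' p, wall S R w -> wall S R w' ->
        seg_interior w p -> seg_interior w' p -> w = w',
      forall w, wall S R w -> exists2 p, in_X n p & in_box w p
    & forall p, in_X n p -> exists! w, wall S R w /\ in_box w p].

(* Permutations. x : 'S_n stands for the one-line notation whose entry in     *)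
(* position i + 1 is x i + 1, so the entry k with k = x i + 1 has             *)
(* p_(k-1) = diag_pt F n (x i) and p_k = diag_pt F n (x i).+1.                *)

(* (tperm i j * x) is x with the entries in positions i and j exchanged. *)
Definition weak_cover {n : nat} : rel 'S_n := fun x y =>
  [exists i : 'I_n, exists j : 'I_n,
    [&& (j == i.+1 :> nat), (x i < x j)%N & y == (tperm i j * x)%g]].

Definition weak_le {n : nat} : rel 'S_n := connect weak_cover.

Definition contains_3_41_2 {n : nat} (x : 'S_n) : Prop :=
  exists i j j' l : 'I_n,
    [/\ (i < j)%N, (j' = j.+1 :> nat), (j' < l)%N
      & [&& (x j' < x l)%N, (x l < x i)%N & (x i < x j)%N]].

Definition contains_2_41_3 {n : nat} (x : 'S_n) : Prop :=
  exists i j j' l : 'I_n,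
    [/\ (i < j)%N, (j' = j.+1 :> nat), (j' < l)%N
      & [&& (x j' < x i)%N, (x i < x l)%N & (x l < x j)%N]].

Definition twisted_baxter {n : nat} (x : 'S_n) : Prop :=
  ~ contains_3_41_2 x /\ ~ contains_2_41_3 x.

Definition rightmost {F : realFieldType} (P : point F -> Prop) (q : point F) :
    Prop :=
  P q /\ (forall q', P q' -> q'.1 <= q.1).

Definition highest {F : realFieldType} (P : point F -> Prop) (q : point F) :
    Prop :=
  P q /\ (forall q', P q' -> q'.2 <= q.2).

(* One step of rho: r is the rectangle drawn for the label k + 1 when T is    *)
(* the region already drawn.                                                  *)
Definition rho_step {F : realFieldType} (n : nat) (T : pred (point F))
    (k : nat) (r : box F) : Prop :=
  let p := diag_pt F n k in
  let p' := diag_pt F n k.+1 in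
  (if T p
   then highest (fun q => [/\ T q, q.1 = p.1 & p.2 <= q.2]) (top_left r)
   else rightmost (fun q => [/\ T q, q.2 = p.2 & q.1 < p.1]) (top_left r))
  /\
  (if T p'
   then rightmost (fun q => [/\ T q, q.2 = p'.2 & p'.1 <= q.1]) (bottom_right r)
   else highest (fun q => [/\ T q, q.1 = p'.1 & q.2 < p'.2]) (bottom_right r)).

(* The region drawn before step i (steps are numbered from 0), when r j is    *)
(* the rectangle drawn in step j.                                             *)
Definition drawn {F : realFieldType} {n : nat} (r : 'I_n -> box F) (i : 'I_n) :
    pred (point F) := fun p =>
  [|| in_box (left_side (square F n)) p,
      in_box (bottom_side (square F n)) p
    | [exists j : 'I_n, (j < i)%N && in_box (r j) p]].

(* The graph of the map rho: rho x = R. *)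
Definition rho {F : realFieldType} {n : nat} (x : 'S_n) (R : {fset box F}) :
    Prop :=
  exists r : 'I_n -> box F,
    (forall i, rho_step n (drawn r i) (x i) (r i)) /\
    (forall b, b \in R <-> (exists i, b = r i)).

Definition drec_le {F : realFieldType} (n : nat) (R R' : {fset box F}) : Prop :=
  exists x x' : 'S_n,
    [/\ twisted_baxter x, twisted_baxter x', rho x R, rho x' R' & weak_le x x'].

Definition drec_lt {F : realFieldType} (n : nat) (R R' : {fset box F}) : Prop :=
  drec_le n R R' /\ R <> R'.

Definition drec_covers {F : realFieldType} (n : nat) (R R' : {fset box F}) :
    Prop :=
  drec_lt n R R' /\
  ~ (exists Q, [/\ is_drec n Q, drec_lt n R Q & drec_lt n Q R']).

Definition vertex {F : realFieldType} (R : {fset box F}) (v : point F) : Prop :=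
  exists2 r, r \in R & v \in corners r.

Definition edge {F : realFieldType} (R : {fset box F}) (e : box F) : Prop :=
  [/\ is_seg e,
      exists r s, [/\ r \in R, s \in sides r & box_sub e s],
      vertex R e.1, vertex R e.2
    & forall v, vertex R v -> ~~ seg_interior e v].

Inductive direction := Up | Down | Left | Right.

Definition opposite (d : direction) : direction :=
  match d with Up => Down | Down => Up | Left => Right | Right => Left end.

(* e has v as an endpoint and leaves v in the direction d. *)
Definition leaves {F : realFieldType} (e : box F) (v : point F)
    (d : direction) : Prop :=
  match d with
  | Up => vertical e /\ v = e.1
  | Down => vertical e /\ v = e.2
  | Right => horizontal e /\ v = e.1
  | Left => horizontal e /\ v = e.2
  end.

Definition matched {F : realFieldType} (R : {fset box F}) (v : point F)
    (e : box F) : Prop :=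
  edge R e /\
  exists d, leaves e v d /\ (exists e', edge R e' /\ leaves e' v (opposite d)).

Definition unmatched {F : realFieldType} (R : {fset box F}) (v : point F)
    (e : box F) : Prop :=
  edge R e /\
  exists d, leaves e v d /\ ~ (exists e', edge R e' /\ leaves e' v (opposite d)).

(* The direction d at v points toward the diagonal x + y = n of the square. *)
Definition toward_diagonal {F : realFieldType} (n : nat) (v : point F)
    (d : direction) : Prop :=
  match d with
  | Left | Down => n%:R < v.1 + v.2
  | Right | Up => v.1 + v.2 < n%:R
  end.

(* Among the two edges leaving v toward the diagonal, v locks the one that is *)
(* not the unmatched edge at v.                                               *)
Definition locked_by {F : realFieldType} (n : nat) (R : {fset box F})
    (e : box F) (v : point F) : Prop :=
  [/\ vertex R v, v \notin corners (square F n), edge R e,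
      exists2 d, leaves e v d & toward_diagonal n v d
    & ~ unmatched R v e].

Definition locked {F : realFieldType} (n : nat) (R : {fset box F})
    (e : box F) : Prop :=
  e.1 \in corners (square F n) \/ e.2 \in corners (square F n) \/
  (exists v, locked_by n R e v).

(* The segment e cuts the region A into the two rectangles V1 and V2. *)
Definition cuts_into {F : realFieldType} (e : box F) (A : point F -> Prop)
    (V1 V2 : box F) : Prop :=
  [/\ is_seg e, is_rect V1, is_rect V2,
      forall p, A p <-> (in_box V1 p \/ in_box V2 p)
    & forall p, in_box e p <-> (in_box V1 p /\ in_box V2 p)].

Definition diagonal_pivot_at {F : realFieldType} (n : nat) (R : {fset box F})
    (E E' : box F) : Prop :=
  [/\ unmatched R E.1 E, unmatched R E.2 E
    & exists p, [/\ in_X n p, in_box E p & in_box E' p]].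

Definition vertex_pivot_at {F : realFieldType} (R : {fset box F})
    (E : box F) : Prop :=
  (matched R E.1 E /\ unmatched R E.2 E) \/
  (matched R E.2 E /\ unmatched R E.1 E).

(* R' is obtained from R by pivoting its edge E (to the segment E'). *)
Definition pivots_to {F : realFieldType} (n : nat) (R : {fset box F})
    (E : box F) (R' : {fset box F}) : Prop :=
  [/\ edge R E, ~ locked n R E
    & exists U1 U2 E' V1 V2 : box F,
      [/\ [/\ U1 \in R, U2 \in R & U1 <> U2],
          forall p, in_box E p -> rect_boundary U1 p /\ rect_boundary U2 p,
          E' <> E /\
            cuts_into E' (fun p => in_box U1 p \/ in_box U2 p) V1 V2,
          diagonal_pivot_at n R E E' \/ vertex_pivot_at R E
        & R' = ((R `\` [fset U1; U2]) `|` [fset V1; V2])%fset]].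

(* Main.v *)
(* Label k stands for the rectangle of rho(x) that meets the diagonal between
   p_k and p_(k+1), and a permutation is encoded by any injective function f
   giving the positions of the labels. Each side of rectangle k is found by
   scanning the labels below or above k for the first one that comes before, or
   after, k in x; a unit cell off the diagonal belongs to the label between its
   coordinates that comes first (below the diagonal) or last (above it) in x.
   Conversely, in a diagonal rectangulation every side lies on a wall through a
   point of X, so all coordinates are integers, every rectangle crosses the
   diagonal exactly once, and an order of the labels is recovered by inserting
   them one at a time.
   In a twisted Baxter permutation every inversion is a composite of inversions
   that can be read off the rectangles. Hence it is the smallest permutation of
   its fiber, the passage to the smallest element of a fiber is monotone, and
   the covers of dRec_n are the swaps x < y of two adjacent entries a < b with
   rho(x) <> rho(y). The rectangles of such x and y differ only in the labels a
   and b: no label between a and b separates them, and according to whether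
   b = a + 1, or all of these labels come after b, or all come before a, the
   swap is a diagonal pivot or a vertex pivot below or above the diagonal. An
   unlocked vertical edge always separates two labels of this kind, and the
   order can be rearranged without changing the rectangulation so that the two
   labels become adjacent. *)
From mathcomp Require Import all_boot all_order all_algebra all_fingroup finmap.
From mathcomp Require Import zify ring lra.
Require Import Defs.

Set Implicit Arguments.
Unset Strict Implicit.
Unset Printing Implicit Defensive.

Import Order.TTheory GRing.Theory Num.Theory.
Local Open Scope ring_scope.

(* Facts about the coordinate field only slow down integer arithmetic. *)
Ltac nlia := repeat match goal with
  | F : realFieldType, H : ?T |- _ =>
    match type of T with Prop => match T with context [F] => clear H end end
  end; lia.

(** Adjacency is the obstacle: the two entries exchanged by a cover of dRec_n need not be adjacent
    in the twisted Baxter permutation of the smaller rectangulation. For instance 2143 and 2413 form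
    a fiber, and both swaps leading upwards out of it are swaps in 2413. Hence swaps are taken in
    arbitrary members of the fibers; [tB_below] descends from them to the minimal ones, and
    [make_adjacent] rearranges the labels on the way from pivots to swaps. Every proof that a change
    of order leaves the rectangulation alone goes through [boxes_invariant]. Keys are arbitrary
    injective functions into the integers because negating the values reflects the picture in the
    diagonal, exchanging vertical with horizontal, and because inserting or moving labels is then
    arithmetic. A pivot also has to be recognized from its geometric definition: an L-shaped hexagon
    has only two cuts into two rectangles, while for a rectangle the point of X on the new segment
    selects one cut among infinitely many. *)

Fixpoint last_index (P : pred nat) (k : nat) : nat :=
  if k is k'.+1 then if P k' then k else last_index P k' else 0%N.

(** The values returned are coordinates: [last_index] gives the successor of the label found, which
    is the right end of its diagonal interval, and the defaults 0 and [k + m] (which is n in [rgt])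
    stand for sides of the square. *)
Fixpoint first_from (P : pred nat) (k m : nat) : nat :=
  if m is m'.+1 then if P k then k else first_from P k.+1 m' else k.

Definition neg (f : nat -> int) : nat -> int := fun k => - f k.

(* Rectangle k is [lft, rgt] x [n - bot, n - top]; reversing the order of the
   labels reflects the picture in the diagonal, hence the definition of top and
   bot. *)
Definition lft (f : nat -> int) (k : nat) : nat :=
  last_index (fun j => f j < f k) k.
Definition rgt (n : nat) (f : nat -> int) (k : nat) : nat :=
  first_from (fun j => f k < f j) k.+1 (n - k.+1).
Notation top f := (lft (neg f)).
Notation bot n f := (rgt n (neg f)).

(** * Sides and unit cells of the boxes given by an order of the labels *)

Definition inj_below (n : nat) (f : nat -> int) : Prop :=
  forall i j, (i < n)%N -> (j < n)%N -> f i = f j -> i = j.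

Lemma inj_below_neg n f : inj_below n f -> inj_below n (neg f).
Proof. by move=> hf i j hi hj /oppr_inj; apply: hf. Qed.

Lemma last_indexP (P : pred nat) k :
  [/\ (last_index P k <= k)%N,
      forall j, (last_index P k <= j < k)%N -> ~~ P j
    & (0 < last_index P k)%N -> P (last_index P k).-1].
Proof.
elim: k => [|k [h1 h2 h3]] /=; first by split=> // j; lia.
case: ifP => hP; split=> //; [by move=> j; lia|lia|].
move=> j hj; case: (eqVneq j k) => [->|hjk]; first by rewrite hP.
by apply: h2; lia.
Qed.

Lemma first_fromP (P : pred nat) k m :
  [/\ (k <= first_from P k m <= k + m)%N,
      forall j, (k <= j < first_from P k m)%N -> ~~ P j
    & (first_from P k m < k + m)%N -> P (first_from P k m)].
Proof.
elim: m k => [|m IH] k /=; first by split; [lia|move=> j; lia|lia].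
case: ifP => hP; first by split; [lia|move=> j; lia|].
have [h1 h2 h3] := IH k.+1; split; [lia| |by move=> h; apply: h3; lia].
move=> j hj; case: (eqVneq j k) => [->|hjk]; first by rewrite hP.
by apply: h2; lia.
Qed.

Lemma lftP n f k : inj_below n f -> (k < n)%N ->
  [/\ (lft f k <= k)%N, forall j, (lft f k <= j < k)%N -> f k < f j
    & (0 < lft f k)%N -> f (lft f k).-1 < f k].
Proof.
move=> hf hk; have [h1 h2 h3] := last_indexP (fun j => f j < f k) k.
rewrite /lft; split=> // j hj; have := h2 j hj.
by have : f j <> f k by [move=> /hf; lia]; lia.
Qed.

Lemma rgtP n f k : inj_below n f -> (k < n)%N ->
  [/\ (k < rgt n f k <= n)%N, forall j, (k < j < rgt n f k)%N -> f j < f k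
    & (rgt n f k < n)%N -> f k < f (rgt n f k)].
Proof.
move=> hf hk; have [h1 h2 h3] := first_fromP (fun j => f k < f j) k.+1 (n - k.+1).
rewrite /rgt; split; [lia| |by move=> h; apply: h3; lia].
move=> j hj; have := h2 j hj.
by have : f j <> f k by [move=> /hf; lia]; lia.
Qed.

Lemma topP n f k : inj_below n f -> (k < n)%N ->
  [/\ (top f k <= k)%N, forall j, (top f k <= j < k)%N -> f j < f k
    & (0 < top f k)%N -> f k < f (top f k).-1].
Proof.
move=> /inj_below_neg hf hk; have [h1 h2 h3] := lftP hf hk.
by split=> // [j /h2|/h3]; rewrite /neg ltrN2.
Qed.

Lemma botP n f k : inj_below n f -> (k < n)%N ->
  [/\ (k < bot n f k <= n)%N, forall j, (k < j < bot n f k)%N -> f k < f j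
    & (bot n f k < n)%N -> f (bot n f k) < f k].
Proof.
move=> /inj_below_neg hf hk; have [h1 h2 h3] := rgtP hf hk.
by split=> // [j /h2|/h3]; rewrite /neg ltrN2.
Qed.

Lemma lft_eq f k l : (l <= k)%N -> (forall j, (l <= j < k)%N -> f k < f j) ->
  ((0 < l)%N -> f l.-1 < f k) -> lft f k = l.
Proof.
move=> h1 h2 h3; have [] := last_indexP (fun j => f j < f k) k.
rewrite -/(lft f k) => g1 g2 g3; case: (ltngtP (lft f k) l) => // h.
  by have := g2 l.-1; have := h3; lia.
by have := h2 (lft f k).-1; have := g3; lia.
Qed.

Lemma rgt_eq n f k r : (k < r <= n)%N ->
  (forall j, (k < j < r)%N -> f j < f k) ->
  ((r < n)%N -> f k < f r) -> rgt n f k = r.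
Proof.
move=> h1 h2 h3; have [] := first_fromP (fun j => f k < f j) k.+1 (n - k.+1).
rewrite -/(rgt n f k) => g1 g2 g3; case: (ltngtP (rgt n f k) r) => // h.
  by have := h2 (rgt n f k); have := g3; lia.
by have := g2 r; have := h3; lia.
Qed.

Lemma top_eq f k l : (l <= k)%N -> (forall j, (l <= j < k)%N -> f j < f k) ->
  ((0 < l)%N -> f k < f l.-1) -> top f k = l.
Proof.
by move=> h1 h2 h3; apply: lft_eq => // [j /h2|/h3]; rewrite /neg ltrN2.
Qed.

Lemma bot_eq n f k r : (k < r <= n)%N ->
  (forall j, (k < j < r)%N -> f k < f j) ->
  ((r < n)%N -> f r < f k) -> bot n f k = r.
Proof.
by move=> h1 h2 h3; apply: rgt_eq => // [j /h2|/h3]; rewrite /neg ltrN2.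
Qed.

Lemma lft_le f k l : (l <= k)%N -> (forall j, (l <= j < k)%N -> f k < f j) ->
  (lft f k <= l)%N.
Proof.
move=> h1 h2; have [] := last_indexP (fun j => f j < f k) k.
rewrite -/(lft f k) => g1 g2 g3; case: (leqP (lft f k) l) => // h.
by have := h2 (lft f k).-1; have := g3; lia.
Qed.

Lemma top_le f k l : (l <= k)%N -> (forall j, (l <= j < k)%N -> f j < f k) ->
  (top f k <= l)%N.
Proof. by move=> h1 h2; apply: lft_le => // j /h2; rewrite /neg ltrN2. Qed.

Lemma rgt_ge n f k r : (k < r <= n)%N ->
  (forall j, (k < j < r)%N -> f j < f k) -> (r <= rgt n f k)%N.
Proof.
move=> h1 h2; have [] := first_fromP (fun j => f k < f j) k.+1 (n - k.+1).
rewrite -/(rgt n f k) => g1 g2 g3; case: (leqP r (rgt n f k)) => // h.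
by have := h2 (rgt n f k); have := g3; lia.
Qed.

Lemma bot_ge n f k r : (k < r <= n)%N ->
  (forall j, (k < j < r)%N -> f k < f j) -> (r <= bot n f k)%N.
Proof. by move=> h1 h2; apply: rgt_ge => // j /h2; rewrite /neg ltrN2. Qed.

Lemma lft_neg_neg f k : lft (neg (neg f)) k = lft f k.
Proof.
rewrite /lft; have : forall m, last_index (fun j => neg (neg f) j < neg (neg f) k) m
   = last_index (fun j => f j < f k) m.
  by elim=> //= m ->; rewrite /neg !opprK.
by apply.
Qed.

Lemma rgt_neg_neg n f k : rgt n (neg (neg f)) k = rgt n f k.
Proof.
rewrite /rgt; have : forall m i, first_from (fun j => neg (neg f) k < neg (neg f) j) i m
   = first_from (fun j => f k < f j) i m.
  by elim=> //= m IH i; rewrite IH /neg !opprK.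
by apply.
Qed.

Lemma max_lft_top n f k : inj_below n f -> (k < n)%N ->
  maxn (lft f k) (top f k) = k.
Proof.
move=> hf hk; have [g1 g2 g3] := lftP hf hk; have [e1 e2 e3] := topP hf hk.
by have := g2 k.-1; have := e2 k.-1; lia.
Qed.

Lemma min_rgt_bot n f k : inj_below n f -> (k < n)%N ->
  minn (rgt n f k) (bot n f k) = k.+1.
Proof.
move=> hf hk; have [g1 g2 g3] := rgtP hf hk; have [e1 e2 e3] := botP hf hk.
by have := g2 k.+1; have := e2 k.+1; lia.
Qed.

Lemma arg_min_interval (f : nat -> int) i m : (i <= m)%N ->
  exists k, (i <= k <= m)%N /\ forall j, (i <= j <= m)%N -> f k <= f j.
Proof.
elim: m => [|m IH] him; first by exists 0%N; split=> [|j]; [|case: j]; lia.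
case: (eqVneq i m.+1) => [->|hi].
  by exists m.+1; split=> [|j hj]; [lia|have -> : j = m.+1 by lia].
have [|k [hk hmin]] := IH; first by lia.
case: (lerP (f k) (f m.+1)) => h; [exists k|exists m.+1]; split; try lia;
  move=> j hj; case: (eqVneq j m.+1) => [->|hj'] //;
  have := hmin j; lia.
Qed.

Definition in_cell n f k i m :=
  ((lft f k <= i < rgt n f k) && (top f k <= m < bot n f k))%N.

Lemma in_cell_neg n f k i m : in_cell n (neg f) k i m = in_cell n f k m i.
Proof. by rewrite /in_cell lft_neg_neg rgt_neg_neg andbC. Qed.

(* The box containing a cell below the diagonal is the first one drawn among
   those whose labels lie between the two coordinates of the cell. *)
Lemma in_cell_exists n f i m : inj_below n f -> (i < n)%N -> (m < n)%N ->
  exists2 k, (k < n)%N & in_cell n f k i m.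
Proof.
wlog him : f i m / (i <= m)%N => [hw|] hf hi hm.
  case: (leqP i m) => h; first exact: hw.
  have [|k hk hc] := hw (neg f) m i (ltnW h) _ hm hi; first exact: inj_below_neg.
  by exists k => //; rewrite -in_cell_neg.
have [k [hk hmin]] := arg_min_interval f him.
have hkn : (k < n)%N by lia.
have hlt j : (i <= j <= m)%N -> j <> k -> f k < f j.
  move=> hj hjk; have := hmin j hj.
  by have : f j <> f k by [move=> /hf; lia]; lia.
exists k => //; rewrite /in_cell.
have [_ _ _] := lftP hf hkn; have [r1 _ _] := rgtP hf hkn.
have [t1 _ _] := topP hf hkn; have [_ _ _] := botP hf hkn.
have := @lft_le f k i; have := @bot_ge n f k m.+1.
move=> h1 h2.
have h3 : (lft f k <= i)%N by apply: h2 => [|j hj]; [lia|apply: hlt; lia].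
have h4 : (m.+1 <= bot n f k)%N by apply: h1 => [|j hj]; [lia|apply: hlt; lia].
lia.
Qed.

(** If k were outside [i, m], one end of this interval would be scanned by two sides of box k, once
    as a label before k and once as a label after k. With k inside, the scans for the left and
    bottom sides pass over all other labels of the interval. *)
Lemma in_cell_first n f k i m : inj_below n f -> (k < n)%N ->
  (i <= m)%N -> in_cell n f k i m ->
  (i <= k <= m)%N /\ forall j, (i <= j <= m)%N -> f k <= f j.
Proof.
move=> hf hk him; rewrite /in_cell.
have [l1 l2 l3] := lftP hf hk; have [r1 r2 r3] := rgtP hf hk.
have [t1 t2 t3] := topP hf hk; have [b1 b2 b3] := botP hf hk.
move=> hc.
have hik : (i <= k)%N.
  by rewrite leqNgt; apply/negP=> h; have := r2 i; have := b2 i; lia.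
have hkm : (k <= m)%N.
  by rewrite leqNgt; apply/negP=> h; have := l2 m; have := t2 m; lia.
split; first lia.
move=> j hj; case: (ltngtP j k) => [h|h|-> //].
  by have := l2 j; lia.
by have := b2 j; lia.
Qed.

Lemma in_cell_uniq n f k k' i m : inj_below n f -> (k < n)%N -> (k' < n)%N ->
  in_cell n f k i m -> in_cell n f k' i m -> k = k'.
Proof.
wlog him : f i m / (i <= m)%N => [hw|] hf hk hk' hc hc'.
  case: (leqP i m) => h; first exact: (hw f i m).
  apply: (hw (neg f) m i (ltnW h)) => //; rewrite ?in_cell_neg //.
  exact: inj_below_neg.
have [h1 h2] := in_cell_first hf hk him hc.
have [h3 h4] := in_cell_first hf hk' him hc'.
by apply: hf => //; have := h2 k' h3; have := h4 k h1; lia.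
Qed.

(** The vertical wall through the diagonal point p_c runs from the top of box c to the bottom of box
    c-1. It meets every row of a box whose right side lies at c, so sides of boxes can be replaced
    by walls indexed by points of X. *)
Lemma wall_of_rgt n f k m : inj_below n f -> (k < n)%N ->
  (rgt n f k < n)%N -> (top f k <= m < bot n f k)%N ->
  let c := rgt n f k in f c.-1 < f c /\ (top f c <= m < bot n f c.-1)%N.
Proof.
move=> hf hk; have [r1 r2 r3] := rgtP hf hk.
have [t1 t2 t3] := topP hf hk; have [b1 b2 b3] := botP hf hk.
move=> hc hm c; rewrite -/c in r1 r2 r3 hc; clearbody c.
have {}r3 := r3 hc.
have hcc : f c.-1 < f c.
  case: (eqVneq k c.-1) => [<- //|hkc]; have := r2 c.-1; lia.
split=> //.
have htop : (top f c <= minn m c.-1)%N.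
  apply: top_le; first by lia.
  move=> j hj; case: (ltngtP j k) => [h|h|-> //].
    by have := t2 j; lia.
  by have := r2 j; lia.
have hc1n : (c.-1 < n)%N by lia.
have [b1' _ _] := botP hf hc1n.
case: (eqVneq k c.-1) => [<-|hkc]; first by lia.
suff : (m < c.-1)%N by lia.
by have := b2 k.+1; have := r2 k.+1; lia.
Qed.

Lemma wall_of_lft n f k m : inj_below n f -> (k < n)%N ->
  (0 < lft f k)%N -> (top f k <= m < bot n f k)%N ->
  let c := lft f k in f c.-1 < f c /\ (top f c <= m < bot n f c.-1)%N.
Proof.
move=> hf hk; have [l1 l2 l3] := lftP hf hk.
have [t1 t2 t3] := topP hf hk; have [b1 b2 b3] := botP hf hk.
move=> hc hm c; rewrite -/c in l1 l2 l3 hc; clearbody c.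
have {}l3 := l3 hc.
have hcc : f c.-1 < f c.
  case: (eqVneq k c) l3 => [-> //|hkc]; have := l2 c; lia.
split=> //.
have hbot : (maxn m.+1 c.+1 <= bot n f c.-1)%N.
  apply: bot_ge; first by lia.
  move=> j hj; case: (ltngtP j k) => [h|h|-> //].
    by have := l2 j; lia.
  by have := b2 j; lia.
have hc1n : (c < n)%N by lia.
have [t1' _ _] := topP hf hc1n.
case: (eqVneq k c) => [ek|hkc]; first by rewrite ek in hm; lia.
suff : (c <= m)%N by lia.
by have := t2 k.-1; have := l2 k.-1; lia.
Qed.

(* A label between p and q preceding both and one following both hide the
   relative order of p and q from all boxes. *)
Lemma boxes_invariant n f g : inj_below n f -> inj_below n g ->
  (forall p q, (p < q < n)%N -> (f p < f q) != (g p < g q) ->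
    exists c c', [/\ (p < c < q)%N, (p < c' < q)%N,
      [/\ f c < f p, f c < f q, g c < g p & g c < g q] &
      [/\ f p < f c', f q < f c', g p < g c' & g q < g c']]) ->
  forall k, (k < n)%N -> [/\ lft f k = lft g k, rgt n f k = rgt n g k,
    top f k = top g k & bot n f k = bot n g k].
Proof.
move=> hf hg H k hk.
have nf i j : (i < n)%N -> (j < n)%N -> i <> j -> f i <> f j.
  by move=> hi hj hij /hf; lia.
have ng i j : (i < n)%N -> (j < n)%N -> i <> j -> g i <> g j.
  by move=> hi hj hij /hg; lia.
have [l1 l2 l3] := lftP hg hk; have [r1 r2 r3] := rgtP hg hk.
have [t1 t2 t3] := topP hg hk; have [b1 b2 b3] := botP hg hk.
split; [apply: lft_eq => // [j hj|hl]|apply: rgt_eq => // [j hj|hl]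
  |apply: top_eq => // [j hj|hl]|apply: bot_eq => // [j hj|hl]].
- have := H j k; case: (eqVneq (f j < f k) (g j < g k)) => [|_];
    first by have := l2 j; have := nf j k; lia.
  by case=> // [|c [c' [hc hc' [? ? ? ?] [? ? ? ?]]]]; [lia|have := l2 c; lia].
- have := H (lft g k).-1 k; case: (eqVneq (f (lft g k).-1 < f k) (g (lft g k).-1 < g k)) => [|_];
    first by have := l3; lia.
  by case=> // [|c [c' [hc hc' [? ? ? ?] [? ? ? ?]]]]; [lia|have := l2 c; lia].
- have := H k j; case: (eqVneq (f k < f j) (g k < g j)) => [|_];
    first by have := r2 j; have := nf j k; lia.
  by case=> // [|c [c' [hc hc' [? ? ? ?] [? ? ? ?]]]]; [lia|have := r2 c'; lia].
- have := H k (rgt n g k); case: (eqVneq (f k < f (rgt n g k)) (g k < g (rgt n g k))) => [|_];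
    first by have := r3; lia.
  by case=> // [|c [c' [hc hc' [? ? ? ?] [? ? ? ?]]]]; [lia|have := r2 c'; lia].
- have := H j k; case: (eqVneq (f j < f k) (g j < g k)) => [|_];
    first by have := t2 j; have := nf j k; lia.
  by case=> // [|c [c' [hc hc' [? ? ? ?] [? ? ? ?]]]]; [lia|have := t2 c'; lia].
- have := H (top g k).-1 k; case: (eqVneq (f (top g k).-1 < f k) (g (top g k).-1 < g k)) => [|_].
    by have := t3; have := nf (top g k).-1 k; have := ng (top g k).-1 k; lia.
  by case=> // [|c [c' [hc hc' [? ? ? ?] [? ? ? ?]]]]; [lia|have := t2 c'; lia].
- have := H k j; case: (eqVneq (f k < f j) (g k < g j)) => [|_];
    first by have := b2 j; have := nf j k; lia.
  by case=> // [|c [c' [hc hc' [? ? ? ?] [? ? ? ?]]]]; [lia|have := b2 c; lia].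
- have := H k (bot n g k); case: (eqVneq (f k < f (bot n g k)) (g k < g (bot n g k))) => [|_].
    by have := b3; have := nf (bot n g k) k; have := ng (bot n g k) k; lia.
  by case=> // [|c [c' [hc hc' [? ? ? ?] [? ? ? ?]]]]; [lia|have := b2 c; lia].
Qed.

Section Drawn.
Variables (n : nat) (f : nat -> int) (j k : nat).
Hypotheses (hf : inj_below n f) (hj : (j < n)%N) (hk : (k < n)%N).
Hypothesis hjk : f j < f k.

Let j_neq_k : j <> k. Proof. by move=> e; move: hjk; rewrite e ltxx. Qed.

(** The four inequalities of this section bound the boxes drawn earlier by the corners that
    [rho_step] prescribes, and give the maximality in its four cases. Here the label [(top f k).-1],
    which comes after k and hence after j, would otherwise be scanned by a side of box j as a label
    before j. *)
Lemma drawn_above : (k <= rgt n f j)%N -> (top f k <= top f j)%N.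
Proof.
have [r1 r2 r3] := rgtP hf hj; have [t1 t2 t3] := topP hf hj.
have [t1' t2' t3'] := topP hf hk.
move=> h; rewrite leqNgt; apply/negP => h'.
case: (ltngtP j (top f k).-1) => [h1|h1|h1].
- by have := r2 (top f k).-1; lia.
- by have := t2 (top f k).-1; lia.
- by rewrite -h1 in t3'; lia.
Qed.

Lemma drawn_right : (top f j <= k.+1)%N -> (rgt n f j <= rgt n f k)%N.
Proof.
have [r1 r2 r3] := rgtP hf hj; have [t1 t2 t3] := topP hf hj.
have [r1' r2' r3'] := rgtP hf hk.
move=> h; rewrite leqNgt; apply/negP => h'.
case: (ltngtP j (rgt n f k)) => [h1|h1|h1].
- by have := r2 (rgt n f k); lia.
- by have := t2 (rgt n f k); lia.
- by rewrite -h1 in r3'; lia.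
Qed.

Lemma drawn_left : (top f j <= k)%N -> (lft f j < k)%N ->
  (rgt n f j <= lft f k)%N.
Proof.
have [r1 r2 r3] := rgtP hf hj; have [t1 t2 t3] := topP hf hj.
have [l1 l2 l3] := lftP hf hj; have [l1' l2' l3'] := lftP hf hk.
move=> h0 h; rewrite leqNgt; apply/negP => h'.
have [h1|h1] := ltnP j (lft f k); last first.
  by case: (ltngtP j k) => h2; [have := l2' j|have := t2 k|]; lia.
have := r2 (lft f k); have := l2' (lft f k).
by case: (eqVneq (lft f k) k) => [e|]; [rewrite e in h' *|]; lia.
Qed.

Lemma drawn_below : (k < rgt n f j)%N -> (k.+1 < bot n f j)%N ->
  (bot n f k <= top f j)%N.
Proof.
have [r1 r2 r3] := rgtP hf hj; have [t1 t2 t3] := topP hf hj.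
have [b1 b2 b3] := botP hf hj; have [b1' b2' b3'] := botP hf hk.
move=> h0 h; rewrite leqNgt; apply/negP => h'.
have [h1|h1] := ltnP j (bot n f k).
  by case: (ltngtP j k) => h2; [have := r2 k|have := b2' j|]; lia.
have := t2 (bot n f k).-1; have := b2' (bot n f k).-1.
by case: (eqVneq (bot n f k).-1 k) => [e|]; [rewrite e|]; lia.
Qed.

End Drawn.

(** * The map rho *)

Section Boxes.
Variable F : realFieldType.
Variable n : nat.
Implicit Types (f g : nat -> int) (p q : point F).

(* Heights are measured downwards from the top edge, so that the diagonal of
   the square becomes the set of points with equal coordinates. *)
Definition nbox (l t r b : nat) : box F :=
  ((l%:R, n%:R - b%:R), (r%:R, n%:R - t%:R)).

Lemma in_nbox l t r b p :
  in_box (nbox l t r b) p =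
  (l%:R <= p.1 <= r%:R) && (t%:R <= n%:R - p.2 <= b%:R).
Proof. by rewrite /in_box /=; lra. Qed.

Lemma nbox_interior l t r b p :
  rect_interior (nbox l t r b) p =
  (l%:R < p.1 < r%:R) && (t%:R < n%:R - p.2 < b%:R).
Proof. by rewrite /rect_interior /=; lra. Qed.

Lemma nbox_inj l t r b l' t' r' b' : nbox l t r b = nbox l' t' r' b' ->
  [/\ l = l', t = t', r = r' & b = b'].
Proof.
case=> /eqP h1 /addrI/oppr_inj/eqP h2 /eqP h3 /addrI/oppr_inj/eqP h4.
by rewrite !eqr_nat in h1 h2 h3 h4; split; apply/eqP.
Qed.

Definition rbox f k := nbox (lft f k) (top f k) (rgt n f k) (bot n f k).

Definition rects f : {fset box F} := [fset b in map (rbox f) (iota 0 n)]%fset.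

Lemma rectsP f b : b \in rects f <-> exists2 k, (k < n)%N & b = rbox f k.
Proof.
rewrite in_fset /=; split.
  by move=> /mapP[k]; rewrite mem_iota => hk ->; exists k => //; nlia.
by case=> k hk ->; apply/mapP; exists k => //; rewrite mem_iota; nlia.
Qed.

Lemma mem_rects f k : (k < n)%N -> rbox f k \in rects f.
Proof. by move=> hk; apply/rectsP; exists k. Qed.

Lemma eq_rects f g : (forall k, (k < n)%N ->
    [/\ lft f k = lft g k, rgt n f k = rgt n g k,
        top f k = top g k & bot n f k = bot n g k]) -> rects f = rects g.
Proof.
move=> h; rewrite /rects.
have -> // : map (rbox f) (iota 0 n) = map (rbox g) (iota 0 n).
apply/eq_in_map => k; rewrite mem_iota => hk; rewrite /rbox.
by have [|-> -> -> ->] := h k; first by nlia.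
Qed.

Lemma rbox_rects_inj f g k j : inj_below n f -> inj_below n g ->
  (k < n)%N -> (j < n)%N -> rbox f k = rbox g j ->
  [/\ k = j, lft f k = lft g k, rgt n f k = rgt n g k,
      top f k = top g k & bot n f k = bot n g k].
Proof.
move=> hf hg hk hj /nbox_inj[e1 e2 e3 e4].
have kj : k = j by rewrite -(max_lft_top hf hk) e1 e2 (max_lft_top hg hj).
by rewrite -kj in e1 e2 e3 e4.
Qed.

Lemma rects_inj f g : inj_below n f -> inj_below n g -> rects f = rects g ->
  forall k, (k < n)%N -> [/\ lft f k = lft g k, rgt n f k = rgt n g k,
    top f k = top g k & bot n f k = bot n g k].
Proof.
move=> hf hg e k hk; have : rbox f k \in rects g by rewrite -e mem_rects.
by case/rectsP=> j hj /(rbox_rects_inj hf hg hk hj)[].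
Qed.

Lemma in_rbox_diag f j i : inj_below n f -> (j < n)%N ->
  in_box (rbox f j) (diag_pt F n i) = ((j == i) || (j.+1 == i))%N.
Proof.
move=> hf hj; have := max_lft_top hf hj; have := min_rgt_bot hf hj.
have [r1 _ _] := rgtP hf hj; have [b1 _ _] := botP hf hj.
have [l1 _ _] := lftP hf hj; have [t1 _ _] := topP hf hj.
rewrite in_nbox /= opprB addrC subrK !ler_nat; nlia.
Qed.

Section Step.
Variables (f : nat -> int) (k : nat) (T : pred (point F)).
Hypotheses (hf : inj_below n f) (hk : (k < n)%N).
Hypothesis hT : forall p, T p <->
  [\/ in_box (left_side (square F n)) p, in_box (bottom_side (square F n)) p |
      exists j, [/\ (j < n)%N, f j < f k & in_box (rbox f j) p]].

Let on_left (v : F) : 0 <= v <= n%:R -> T (0, n%:R - v).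
Proof. by move=> hv; apply/hT/Or31; rewrite /in_box /=; lra. Qed.

Let on_bottom (u : F) : 0 <= u <= n%:R -> T (u, 0).
Proof. by move=> hv; apply/hT/Or32; rewrite /in_box /=; lra. Qed.

Let in_drawn j (u v : F) : (j < n)%N -> f j < f k ->
  (lft f j)%:R <= u <= (rgt n f j)%:R -> (top f j)%:R <= v <= (bot n f j)%:R ->
  T (u, n%:R - v).
Proof.
move=> hj hjk hu hv; apply/hT/Or33; exists j; split=> //.
by rewrite in_nbox /=; lra.
Qed.

Let Tinv (u y : F) : T (u, y) ->
  [\/ u = 0 /\ 0 <= y <= n%:R, y = 0 /\ 0 <= u <= n%:R | exists j, [/\ (j < n)%N, f j < f k,
    (lft f j)%:R <= u <= (rgt n f j)%:R &
    (top f j)%:R <= n%:R - y <= (bot n f j)%:R]].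
Proof.
move=> /hT[h|h|[j [hj hjk]]].
- by apply: Or31; move: h; rewrite /in_box /=; split; lra.
- by apply: Or32; move: h; rewrite /in_box /=; split; lra.
by rewrite in_nbox => /andP[h1 h2]; apply: Or33; exists j.
Qed.

(** Only the boxes k-1 and k contain the diagonal point p_k ([in_rbox_diag]), so whether it is drawn
    before step k depends on the label k-1 alone. *)
Lemma drawn_diag_left : T (diag_pt F n k) = (k == 0)%N || (f k.-1 < f k).
Proof.
apply/idP/idP.
  move=> /Tinv[[/eqP + _]|[/eqP + _]|[j [hj hjk h1 h2]]].
  - by rewrite pnatr_eq0 => ->.
  - by rewrite subr_eq0 eqr_nat; nlia.
  have : in_box (rbox f j) (diag_pt F n k) by rewrite in_nbox /=; lra.
  rewrite in_rbox_diag // => /orP[/eqP e|/eqP e].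
    by move: hjk; rewrite e ltxx.
  by have -> : k.-1 = j by [nlia]; rewrite hjk orbT.
case: (posnP k) => [-> _|k0 /orP[/eqP|h]]; [|by nlia|].
  by apply: on_left; have := ler0n F n; lra.
apply/hT/Or33; exists k.-1; split=> //; first by nlia.
by rewrite in_rbox_diag ?prednK ?eqxx ?orbT //; nlia.
Qed.

Lemma drawn_diag_right : T (diag_pt F n k.+1) = (k.+1 == n)%N || (f k.+1 < f k).
Proof.
apply/idP/idP.
  move=> /Tinv[[/eqP + _]|[/eqP + _]|[j [hj hjk h1 h2]]].
  - by rewrite pnatr_eq0.
  - by rewrite subr_eq0 eqr_nat; nlia.
  have : in_box (rbox f j) (diag_pt F n k.+1) by rewrite in_nbox /=; lra.
  rewrite in_rbox_diag // => /orP[/eqP e|/eqP [e]]; first by rewrite -e hjk orbT.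
  by move: hjk; rewrite e ltxx.
case/orP => [/eqP ->|h].
  by rewrite /diag_pt subrr; apply: on_bottom; have := ler0n F n; lra.
case: (eqVneq k.+1 n) => [->|hkn].
  by rewrite /diag_pt subrr; apply: on_bottom; have := ler0n F n; lra.
apply/hT/Or33; exists k.+1; split=> //; first by nlia.
by rewrite in_rbox_diag ?eqxx //; nlia.
Qed.

(** In each case the corner must already be drawn, which is shown by the box of a unit cell next to
    it, and no earlier box may reach further, which is one of the inequalities on drawn boxes. *)
Lemma rho_step_rbox : rho_step n T k (rbox f k).
Proof.
have [l1 l2 l3] := lftP hf hk; have [r1 r2 r3] := rgtP hf hk.
have [t1 t2 t3] := topP hf hk; have [b1 b2 b3] := botP hf hk.
have mx := max_lft_top hf hk; have mn := min_rgt_bot hf hk.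
have n0 := ler0n F n.
split; rewrite ?drawn_diag_left ?drawn_diag_right; case: ifP => hd.
- have lk : lft f k = k by have := t2 k.-1; have := l2 k.-1; nlia.
  split; rewrite /top_left /= ?lk.
    split=> //; last by have : (top f k)%:R <= k%:R :> F by [rewrite ler_nat]; lra.
    case: (posnP k) => [k0|k0].
      have -> : k%:R = 0 :> F by rewrite k0.
      apply: on_left; rewrite ler0n ler_nat; nlia.
    have hk1 : (k.-1 < n)%N by nlia.
    have htn : (top f k < n)%N by nlia.
    have htk : (top f k <= k.-1)%N.
      by case: (eqVneq (top f k) k) => [e|]; [rewrite e in t3; nlia|nlia].
    (* The cell to the left of the corner and below it belongs to an earlier box, which contains the
       corner. This cell lies above the diagonal, so [in_cell_neg] reflects it before
       [in_cell_first] applies. *)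
    have [j hj] := in_cell_exists hf hk1 htn.
    rewrite -in_cell_neg => hc.
    have [h1 _] := in_cell_first (inj_below_neg hf) hj htk hc.
    move: hc; rewrite in_cell_neg /in_cell => hc.
    have hjk : f j < f k by have := t2 j; nlia.
    apply: (in_drawn hj hjk); rewrite !ler_nat; nlia.
  move=> [q1 q2] /= [hq e hp]; rewrite e in hq; rewrite leNgt; apply/negP => hlt.
  case: (Tinv hq) => [[/eqP + hy]|[e' _]|[j [hj hjk]]].
  - rewrite pnatr_eq0 => /eqP k0; have : (top f k <= 0)%N by nlia.
    by rewrite -(ler_nat F); lra.
  - have : (0 : F) <= n%:R - (top f k)%:R by rewrite subr_ge0 ler_nat; nlia.
    lra.
  rewrite !ler_nat => hu hv.
  have ht : (top f j < top f k)%N by rewrite -(ltr_nat F); lra.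
  by have := drawn_above hf hj hk hjk; nlia.
- have lk : top f k = k.
    by case: (eqVneq (top f k) k) => [//|]; have := t2 k.-1; nlia.
  have lk' : (lft f k < k)%N.
    rewrite ltn_neqAle l1 andbT; apply/eqP => e.
    by rewrite e in l3; nlia.
  split; rewrite /top_left /= ?lk.
    split=> //; last by rewrite ltr_nat.
    case: (posnP (lft f k)) => [k0|k0].
      have -> : (lft f k)%:R = 0 :> F by rewrite k0.
      apply: on_left; rewrite ler0n ler_nat; nlia.
    have hl1 : ((lft f k).-1 < n)%N by nlia.
    have htk : ((lft f k).-1 <= k)%N by nlia.
    have [j hj hc] := in_cell_exists hf hl1 hk.
    have [h1 h2] := in_cell_first hf hj htk hc.
    move: hc; rewrite /in_cell => hc.
    have hjk : f j < f k by have := h2 (lft f k).-1; nlia.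
    have hdr := drawn_left hf hj hk hjk.
    apply: (in_drawn hj hjk); rewrite !ler_nat; nlia.
  move=> [q1 q2] /= [hq e hp]; rewrite e in hq; rewrite leNgt; apply/negP => hlt.
  case: (Tinv hq) => [[e' _]|[/eqP + _]|[j [hj hjk]]].
  - by have := ler0n F (lft f k); lra.
  - by rewrite subr_eq0 eqr_nat; nlia.
  rewrite opprB addrC subrK !ler_nat => hu hv.
  have h1 : (lft f k < rgt n f j)%N by rewrite -(ltr_nat F); lra.
  have h2 : (lft f j < k)%N by rewrite -(ltr_nat F); lra.
  by have := drawn_left hf hj hk hjk; nlia.
- have bk : bot n f k = k.+1.
    by case: (eqVneq (bot n f k) k.+1) => [//|]; have := b2 k.+1; nlia.
  split; rewrite /bottom_right /= ?bk.
    split=> //; last by rewrite ler_nat; nlia.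
    case: (eqVneq k.+1 n) => [k0|k0].
      rewrite k0 subrr; apply: on_bottom; rewrite ler0n ler_nat; nlia.
    have hk1 : (k.+1 < n)%N by nlia.
    have hrn : ((rgt n f k).-1 < n)%N by nlia.
    have hrk : (k.+1 <= (rgt n f k).-1)%N.
      case: (eqVneq (rgt n f k) k.+1) => [e|]; [rewrite e in r3|]; nlia.
    have [j hj] := in_cell_exists hf hrn hk1.
    rewrite -in_cell_neg => hc.
    have [h1 _] := in_cell_first (inj_below_neg hf) hj hrk hc.
    move: hc; rewrite in_cell_neg /in_cell => hc.
    have hjk : f j < f k by have := r2 j; nlia.
    have hdr := drawn_right hf hj hk hjk.
    apply: (in_drawn hj hjk); rewrite !ler_nat; nlia.
  move=> [q1 q2] /= [hq e hp]; rewrite e in hq; rewrite leNgt; apply/negP => hlt.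
  case: (Tinv hq) => [[e' _]|[e' hu]|[j [hj hjk]]].
  - by have := ler0n F k.+1; have := ltr0Sn F k; lra.
  - move/eqP: e'; rewrite subr_eq0 eqr_nat => /eqP e'.
    have : (n <= rgt n f k)%N by nlia.
    by rewrite -(ler_nat F); lra.
  rewrite opprB addrC subrK !ler_nat => hu hv.
  have h1 : (rgt n f k < rgt n f j)%N by rewrite -(ltr_nat F); lra.
  by have := drawn_right hf hj hk hjk; nlia.
- have rk : rgt n f k = k.+1.
    by case: (eqVneq (rgt n f k) k.+1) => [//|]; have := r2 k.+1; nlia.
  have bk' : (k.+1 < bot n f k)%N.
    rewrite ltn_neqAle eq_sym; apply/andP; split; last by nlia.
    by apply/eqP => e; rewrite e in b3; nlia.
  split; rewrite /bottom_right /= ?rk.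
    split=> //; last by rewrite ltrD2l ltrN2 ltr_nat.
    case: (eqVneq (bot n f k) n) => [k0|k0].
      by rewrite k0 subrr; apply: on_bottom; rewrite ler0n ler_nat; nlia.
    have hk1 : (k.+1 < n)%N by nlia.
    have hbn : (bot n f k < n)%N by nlia.
    have [j hj hc] := in_cell_exists hf hk1 hbn.
    have [h1 h2] := in_cell_first hf hj (ltnW bk') hc.
    move: hc; rewrite /in_cell => hc.
    have hjk : f j < f k by have := h2 (bot n f k); nlia.
    have hdr := drawn_below hf hj hk hjk.
    apply: (in_drawn hj hjk); rewrite !ler_nat; nlia.
  move=> [q1 q2] /= [hq e hp]; rewrite e in hq; rewrite leNgt; apply/negP => hlt.
  case: (Tinv hq) => [[e' _]|[e' hu]|[j [hj hjk]]].
  - by have := ler0n F k; have := ltr0Sn F k; lra.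
  - have : (bot n f k <= n)%N by nlia.
    by rewrite -(ler_nat F); lra.
  rewrite !ler_nat => hu hv.
  have h1 : (top f j < bot n f k)%N by rewrite -(ltr_nat F); lra.
  have h2 : (k.+1 < bot n f j)%N by rewrite -(ltr_nat F); lra.
  by have := drawn_below hf hj hk hjk; nlia.
Qed.
End Step.

Lemma rho_step_uniq (T : pred (point F)) k (r r' : box F) :
  rho_step n T k r -> rho_step n T k r' -> r = r'.
Proof.
have highest_uniq (P : point F -> Prop) u (q q' : point F) :
    (forall p, P p -> p.1 = u) -> highest P q -> highest P q' -> q = q'.
  move=> hP [h1 h2] [h1' h2']; have := hP _ h1; have := hP _ h1'.
  move: (h2 _ h1') (h2' _ h1).
  by case: q q' {h1 h1' h2 h2'} => [a b] [c d] /= ? ? -> ->; congr (_, _); lra.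
have rightmost_uniq (P : point F -> Prop) v (q q' : point F) :
    (forall p, P p -> p.2 = v) -> rightmost P q -> rightmost P q' -> q = q'.
  move=> hP [h1 h2] [h1' h2']; have := hP _ h1; have := hP _ h1'.
  move: (h2 _ h1') (h2' _ h1).
  by case: q q' {h1 h1' h2 h2'} => [a b] [c d] /= ? ? -> ->; congr (_, _); lra.
move=> [h1 h2] [h1' h2'].
have [e1 e2] : top_left r = top_left r'.
  move: h1 h1'; case: ifP => _.
    by apply: (@highest_uniq _ k%:R) => p [].
  by apply: (@rightmost_uniq _ (n%:R - k%:R)) => p [].
have [e3 e4] : bottom_right r = bottom_right r'.
  move: h2 h2'; case: ifP => _.
    by apply: (@rightmost_uniq _ (n%:R - k.+1%:R)) => p [].
  by apply: (@highest_uniq _ k.+1%:R) => p [].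
by move: e1 e2 e3 e4; case: r r' {h1 h1' h2 h2'} => [[? ?] [? ?]] [[? ?] [? ?]] /= -> -> -> ->.
Qed.

End Boxes.

(** * Permutations as orders of the labels *)

Section Keys.
Variable n : nat.
Implicit Types x y : 'S_n.

(* The position of the label k in x (0 if k >= n). *)
Definition key x (k : nat) : int :=
  if insub k is Some i then (((x^-1)%g : 'S_n) i : nat)%:Z else 0.

Lemma key_ord x (i : 'I_n) : key x i = ((x^-1)%g i : nat)%:Z.
Proof. by rewrite /key valK. Qed.

Lemma key_perm x (i : 'I_n) : key x (x i) = (i : nat)%:Z.
Proof. by rewrite key_ord permK. Qed.

Lemma inj_key x : inj_below n (key x).
Proof.
move=> i j hi hj.
rewrite -[i]/(nat_of_ord (Ordinal hi)) -[j]/(nat_of_ord (Ordinal hj)) !key_ord.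
by case=> /ord_inj/perm_inj ->.
Qed.

Lemma key_lt x (i j : 'I_n) : (key x (x i) < key x (x j)) = (i < j)%N.
Proof. by rewrite !key_perm. Qed.

Lemma rho_step_drawn (F : realFieldType) x (r : 'I_n -> box F) (i : 'I_n) :
  (forall j : 'I_n, (j < i)%N -> r j = rbox F n (key x) (x j)) ->
  rho_step n (drawn r i) (x i) (rbox F n (key x) (x i)).
Proof.
move=> hr; apply: rho_step_rbox => [||p]; [exact: inj_key|exact: ltn_ord|].
split.
  case/or3P => [h|h|/existsP[j /andP[hj hp]]]; [exact: Or31|exact: Or32|].
  by apply: Or33; exists (x j); rewrite key_lt -hr.
case=> [h|h|[j [hj hjk hp]]]; apply/or3P; [exact: Or31|exact: Or32|].
apply: Or33; apply/existsP; exists ((x^-1)%g (Ordinal hj)).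
have e : x ((x^-1)%g (Ordinal hj)) = Ordinal hj by rewrite permKV.
have h : ((x^-1)%g (Ordinal hj) < i)%N by rewrite -(key_lt x) e.
by rewrite h hr // e.
Qed.

(** By induction on the step: the region drawn before it depends only on the earlier rectangles, and
    the step determines its rectangle ([rho_step_uniq]). *)
Lemma rho_rects (F : realFieldType) x (R : {fset box F}) :
  rho x R <-> R = rects F n (key x).
Proof.
split=> [[r [hr hR]]|->].
  have e i : r i = rbox F n (key x) (x i).
    have [m] := ubnP (i : nat); elim: m i => // m IH i him.
    apply: rho_step_uniq (hr i) _; apply: rho_step_drawn => j hj.
    by apply: IH; lia.
  apply/fsetP => b; apply/idP/idP => [/hR[i ->]|/rectsP[k hk ->]].
    by rewrite e mem_rects.
  by apply/hR; exists ((x^-1)%g (Ordinal hk)); rewrite e permKV.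
exists (fun i => rbox F n (key x) (x i)); split=> [i|b].
  exact: rho_step_drawn.
split=> [/rectsP[k hk ->]|[i ->]]; last by rewrite mem_rects.
by exists ((x^-1)%g (Ordinal hk)); rewrite permKV.
Qed.

Lemma perm_of_key f : inj_below n f -> exists x : 'S_n,
  forall i j, (i < n)%N -> (j < n)%N -> (key x i < key x j) = (f i < f j).
Proof.
move=> hf; pose s (i : 'I_n) := [set j : 'I_n | f j < f i].
have hs (i : 'I_n) : (#|s i| < n)%N.
  rewrite -[X in (_ < X)%N](card_ord n) -cardsT; apply: proper_card.
  by rewrite properT; apply/eqP => /setP/(_ i); rewrite !inE ltxx.
have hlt (i j : 'I_n) : f i < f j -> (#|s i| < #|s j|)%N.
  move=> hij; apply: proper_card; apply/properP; split.
    by apply/subsetP => k; rewrite !inE => h; lia.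
  by exists i; rewrite !inE ?ltxx.
have hinj : injective (fun i => Ordinal (hs i)).
  move=> i j /(congr1 val) /= e; apply/ord_inj/hf => //.
  have := hlt i j; have := hlt j i; rewrite e ltnn; lia.
exists ((perm hinj)^-1)%g => i j hi hj.
rewrite -[i]/(nat_of_ord (Ordinal hi)) -[j]/(nat_of_ord (Ordinal hj)) !key_ord.
rewrite invgK !permE /=.
have := hlt (Ordinal hi) (Ordinal hj); have := hlt (Ordinal hj) (Ordinal hi) => /=.
case: (ltgtP (f i) (f j)) => [h _ /(_ isT)|h /(_ isT) + _|h _ _]; [lia|lia|].
by have := hf _ _ hi hj h => e; rewrite (_ : Ordinal hi = Ordinal hj) ?ltxx //; apply: val_inj.
Qed.

End Keys.

(** * Weak order and twisted Baxter permutations *)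

(** A cover of the weak order in terms of the exchanged labels instead of positions. Only
    comparisons of keys occur, since the box of a label depends on nothing else. *)
Definition swap_adj n (f g : nat -> int) a b : Prop :=
  [/\ (a < b < n)%N, f a < f b, g b < g a,
      forall c, (c < n)%N -> ~ (f a < f c < f b)
    & forall p q, (p < n)%N -> (q < n)%N ->
        (p, q) <> (a, b) -> (p, q) <> (b, a) -> (g p < g q) = (f p < f q)].

(** Containment of inversion sets, the second description of the weak order; the two are identified
    by [weak_le_inv_sub] and [inv_sub_weak_le]. *)
Definition inv_sub n (f g : nat -> int) : Prop :=
  forall a b, (a < b < n)%N -> f b < f a -> g b < g a.

Lemma inv_sub_trans n g f h : inv_sub n f g -> inv_sub n g h -> inv_sub n f h.
Proof. by move=> h1 h2 a b hab /(h1 a b hab); apply: h2. Qed.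

Section Weak.
Variable n : nat.
Implicit Types x y z : 'S_n.

Lemma swap_adj_tperm x (i j : 'I_n) : (j == i.+1 :> nat) -> (x i < x j)%N ->
  swap_adj n (key x) (key (tperm i j * x)%g) (x i) (x j).
Proof.
move=> /eqP hij hx.
have k' (k : 'I_n) : key (tperm i j * x)%g (x k) = (tperm i j k : nat)%:Z.
  by rewrite key_ord invMg permM permK tpermV.
split; rewrite ?k' ?tpermL ?tpermR ?key_perm; try (have := ltn_ord (x j); lia).
move=> p q hp hq.
rewrite -[p]/(nat_of_ord (Ordinal hp)) -[q]/(nat_of_ord (Ordinal hq)).
rewrite -(permKV x (Ordinal hp)) -(permKV x (Ordinal hq)) !k' !key_perm.
move: ((x^-1)%g (Ordinal hp)) ((x^-1)%g (Ordinal hq)) => u v h1 h2.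
have {h1} h1 : (u, v) <> (i, j) by move=> [e1 e2]; apply: h1; rewrite e1 e2.
have {h2} h2 : (u, v) <> (j, i) by move=> [e1 e2]; apply: h2; rewrite e1 e2.
have toN (s t : 'I_n) : s <> t -> (s : nat) <> t by move=> h /val_inj.
case: tpermP h1 h2 => [->|->|/toN ? /toN ?];
  case: tpermP => [->|->|/toN ? /toN ?] h1 h2 //; lia.
Qed.

Lemma weak_cover_swap x y : weak_cover x y ->
  exists a b, swap_adj n (key x) (key y) a b.
Proof.
case/existsP=> i /existsP[j /and3P[hij hx /eqP ->]].
by exists (x i), (x j); apply: swap_adj_tperm.
Qed.

Lemma adjacent_positions x a b : (a < n)%N -> (b < n)%N -> key x a < key x b ->
  (forall c, (c < n)%N -> ~ (key x a < key x c < key x b)) ->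
  exists i j : 'I_n, [/\ (j == i.+1 :> nat)%N, x i = a :> nat & x j = b :> nat].
Proof.
move=> ha hb hab hadj.
exists ((x^-1)%g (Ordinal ha)), ((x^-1)%g (Ordinal hb)); rewrite !permKV.
split=> //; move: hab hadj.
rewrite -{1 2}[a]/(nat_of_ord (Ordinal ha)) -{1 2}[b]/(nat_of_ord (Ordinal hb)).
rewrite !key_ord.
move: ((x^-1)%g (Ordinal ha)) ((x^-1)%g (Ordinal hb)) => i j hij hadj.
have hi : (i.+1 < n)%N by have := ltn_ord j; lia.
have := hadj (x (Ordinal hi)) (ltn_ord _); rewrite key_perm /=; lia.
Qed.

Lemma swap_adj_up x a b : (a < b < n)%N -> key x a < key x b ->
  (forall c, (c < n)%N -> ~ (key x a < key x c < key x b)) ->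
  exists2 y, weak_cover x y & swap_adj n (key x) (key y) a b.
Proof.
move=> /andP[hab hb] hx hadj.
have [|i [j [hij ei ej]]] := adjacent_positions (ltn_trans hab hb) hb hx; first by [].
exists (tperm i j * x)%g.
  by apply/existsP; exists i; apply/existsP; exists j; rewrite hij ei ej hab /=.
by rewrite -ei -ej; apply: swap_adj_tperm => //; rewrite ei ej.
Qed.

Lemma swap_adj_down x a b : (a < b < n)%N -> key x b < key x a ->
  (forall c, (c < n)%N -> ~ (key x b < key x c < key x a)) ->
  exists2 y, weak_cover y x & swap_adj n (key y) (key x) a b.
Proof.
move=> /andP[hab hb] hx hadj.
have [|i [j [hij ei ej]]] := adjacent_positions hb (ltn_trans hab hb) hx; first by [].
pose y := (tperm i j * x)%g.
have ex : x = (tperm i j * y)%g by rewrite /y mulgA tperm2 mul1g.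
have yi : y i = a :> nat by rewrite permM tpermL.
have yj : y j = b :> nat by rewrite permM tpermR.
exists y.
  apply/existsP; exists i; apply/existsP; exists j.
  by rewrite hij yi yj hab -ex eqxx.
rewrite ex -[in X in swap_adj _ _ _ X]yi -yj; apply: swap_adj_tperm => //.
by rewrite yi yj.
Qed.

Lemma key_inj x y : (forall p q, (p < n)%N -> (q < n)%N ->
    (key x p < key x q) = (key y p < key y q)) -> x = y.
Proof.
move=> h.
have rank z (k : 'I_n) : #|[set j : 'I_n | key z j < key z k]| = (z^-1)%g k.
  have -> : [set j : 'I_n | key z j < key z k] =
      (z^-1)%g @^-1: [set i : 'I_n | (i < (z^-1)%g k)%N].
    by apply/setP => j; rewrite !inE !key_ord.
  rewrite card_preimset; last exact: perm_inj.
  rewrite -sum1dep_card -(big_ord_widen n (fun=> 1%N)); last exact: ltnW.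
  by rewrite sum1_card card_ord.
apply: invg_inj; apply/permP => k; apply: val_inj.
rewrite /= -!rank; congr #|pred_of_set _|; apply/setP => j; rewrite !inE.
exact: h.
Qed.

Lemma inv_sub_anti x y : inv_sub n (key x) (key y) -> inv_sub n (key y) (key x) ->
  x = y.
Proof.
move=> h1 h2; apply: key_inj => p q hp hq.
have := @inj_key n x p q hp hq; have := @inj_key n y p q hp hq.
by case: (ltngtP p q) => [h|h|->]; [have := h1 p q; have := h2 p q|
  have := h1 q p; have := h2 q p|]; lia.
Qed.

Lemma swap_adj_inv_sub f g a b : swap_adj n f g a b -> inv_sub n f g.
Proof.
move=> [hab h1 h2 _ h3] p q hpq; have := h3 q p.
case: (eqVneq (p, q) (a, b)) => [[-> ->]|/eqP hne]; first by lia.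
move=> -> //; try lia; first by case=> *; lia.
by case=> *; apply: hne; congr (_, _).
Qed.

Lemma weak_le_inv_sub x y : weak_le x y -> inv_sub n (key x) (key y).
Proof.
case/connectP=> s; elim: s x => [|z s IH] x /=; first by move=> _ ->.
case/andP=> /weak_cover_swap[a [b /swap_adj_inv_sub hxz]] hs hy.
exact: inv_sub_trans hxz (IH _ hs hy).
Qed.

End Weak.

Section Order.
Variable n : nat.
Implicit Types x y z : 'S_n.

(** Induction on the number of inversions of y missing in x. If the entries in no two adjacent
    positions of x stand in the opposite order in y, then y lists the labels in the order of x.
    Otherwise such a pair cannot be an inversion of x, and swapping it moves x up while staying
    below y. *)
Lemma inv_sub_weak_le x y : inv_sub n (key x) (key y) -> weak_le x y.
Proof.
pose inv_diff x' := [set p : 'I_n * 'I_n |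
  [&& (p.1 < p.2)%N, key y p.2 < key y p.1 & key x' p.1 < key x' p.2]].
have [m] := ubnP #|inv_diff x|; elim: m x => // m IH x hm hxy.
case: (boolP [exists i : 'I_n, exists j : 'I_n,
    (j == i.+1 :> nat) && (key y (x j) < key y (x i))]); last first.
  move=> /existsPn hall; have -> : x = y; last exact: connect0.
  have mono (i j : 'I_n) : (i < j)%N -> key y (x i) < key y (x j).
    case: i j => [i hi] [j hj] /=; elim: j hj => // j IHj hj hij.
    have hj' : (j < n)%N by lia.
    have : key y (x (Ordinal hj')) < key y (x (Ordinal hj)).
      have /existsPn/(_ (Ordinal hj)) := hall (Ordinal hj').
      rewrite /= eqxx /= -leNgt le_eqVlt => /orP[/eqP|//].
      by move/(inj_key (ltn_ord _) (ltn_ord _))/ord_inj/perm_inj => [] /eqP; lia.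
    case: (eqVneq i j) => [e|hne]; last by have := IHj hj'; lia.
    by rewrite (_ : Ordinal hi = Ordinal hj') //; apply: val_inj.
  apply: key_inj => p q hp hq.
  rewrite -[p]/(nat_of_ord (Ordinal hp)) -[q]/(nat_of_ord (Ordinal hq)).
  rewrite -(permKV x (Ordinal hp)) -(permKV x (Ordinal hq)) key_lt.
  move: ((x^-1)%g (Ordinal hp)) ((x^-1)%g (Ordinal hq)) => i j.
  have := mono i j; have := mono j i.
  by case: (ltngtP i j) => [||/ord_inj ->]; lia.
case/existsP=> i /existsP[j /andP[/eqP hij hy]].
have hne : x i <> x j :> nat by move=> /ord_inj/perm_inj e; move: hij; rewrite e; lia.
have hx : (x i < x j)%N.
  rewrite ltn_neqAle; apply/andP; split; first exact/eqP.
  rewrite leqNgt; apply/negP => h; have := hxy (x j) (x i).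
  by rewrite key_lt h /=; have := ltn_ord (x i); lia.
have hij' : (j == i.+1 :> nat) by apply/eqP.
have hs := swap_adj_tperm hij' hx.
set z := (tperm i j * x)%g in hs.
apply: (@connect_trans _ _ z).
  apply: connect1; apply/existsP; exists i; apply/existsP; exists j.
  by rewrite hij' hx eqxx.
have [_ h1 h2 _ h3] := hs.
apply: IH.
  apply: (@leq_trans #|inv_diff x|); last by rewrite -ltnS.
  apply: proper_card; apply/properP; split.
    apply/subsetP => -[p q]; rewrite !inE /= => /and3P[hpq -> hz]; rewrite hpq /=.
    case: (eqVneq (p : nat, q : nat) (x i : nat, x j : nat)) => [[-> ->] //|/eqP hne'].
    by rewrite -h3 //; case=> *; lia.
  exists (x i, x j); rewrite !inE /= ?hx ?hy ?h1 //.
  by rewrite negb_and -leNgt (ltW h2) orbT.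
move=> a b hab hz; case: (eqVneq (a, b) (x i : nat, x j : nat)) => [[-> ->] //|/eqP hne'].
apply: hxy => //; rewrite -h3 //; try lia; first by case=> *; lia.
by case=> *; apply: hne'; congr (_, _).
Qed.

(** Both forbidden patterns at once: d stands immediately before a, with c earlier and c' later. The
    pattern is 2-41-3 if c < c' and 3-41-2 if c' < c. *)
Definition tB_key (f : nat -> int) : Prop := forall a d c c',
  (d < n)%N -> (a < c < d)%N -> (a < c' < d)%N ->
  (forall e, (e < n)%N -> ~ (f d < f e < f a)) ->
  f c < f d -> f d < f a -> f a < f c' -> False.

Lemma twisted_baxter_key x : twisted_baxter x <-> tB_key (key x).
Proof.
split.
  move=> [h1 h2] a d c c' hd hac hac' hadj hcd hda hac''.
  have han : (a < n)%N by lia.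
  have [j [j' [/eqP hj ed ea]]] := adjacent_positions hd han hda hadj.
  have hc : (c < n)%N by lia.
  have hc' : (c' < n)%N by lia.
  have ec := permKV x (Ordinal hc); have ec' := permKV x (Ordinal hc').
  rewrite -ed -[c]/(nat_of_ord (Ordinal hc)) -ec in hcd.
  rewrite -ea -[c']/(nat_of_ord (Ordinal hc')) -ec' in hac''.
  move: hcd hac'' ec ec'; rewrite !key_lt.
  move: ((x^-1)%g (Ordinal hc)) ((x^-1)%g (Ordinal hc')) => i l hij hjl ei el.
  case: (ltngtP c c') => [hcc|hcc|hcc].
  - by apply: h2; exists i, j, j', l; split=> //; rewrite ei el /= ed ea; lia.
  - by apply: h1; exists i, j, j', l; split=> //; rewrite ei el /= ed ea; lia.
  - have : i = l by apply: (@perm_inj _ x); rewrite ei el; apply: val_inj.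
    by move=> e; rewrite e in hij; lia.
move=> h; split=> -[i [j [j' [l [hij hj hjl /and3P[h1 h2 h3]]]]]];
  apply: (h (x j') (x j) (x i) (x l)); rewrite ?key_lt ?ltn_ord //; try lia;
  move=> e he; rewrite -[e]/(nat_of_ord (Ordinal he)) -(permKV x (Ordinal he)) !key_lt; lia.
Qed.

(** An entry standing between D and A is at most A or at least D, so it can replace one of them.
    This narrows the gap until an adjacent descent is reached; the two values only move apart, so
    labels between A and D stay between them. *)
Lemma descent_between f A D : inj_below n f -> (A < D < n)%N -> f D < f A ->
  (forall c, (A < c < D)%N -> ~ (f D < f c < f A)) ->
  exists a d, [/\ (a <= A)%N, (D <= d < n)%N, f D <= f d < f a, f a <= f A
    & forall e, (e < n)%N -> ~ (f d < f e < f a)].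
Proof.
move=> hf hAD hDA hbetween.
have [m] := ubnP `|f A - f D|%N.
suff gen : forall m a d, (`|f a - f d|%N < m)%N ->
    (a <= A)%N -> (D <= d < n)%N -> f D <= f d -> f d < f a -> f a <= f A ->
    exists a d, [/\ (a <= A)%N, (D <= d < n)%N, f D <= f d < f a, f a <= f A
      & forall e, (e < n)%N -> ~ (f d < f e < f a)].
  by move=> hm; apply: (gen m A D); lia.
elim=> // {}m IH a d hm ha hd h1 h2 h3.
case: (boolP [exists e : 'I_n, f d < f e < f a]) => [/existsP[[e he] /= hde]|].
  have [hA|hA] := leqP e A; first by apply: (IH e d); lia.
  have [hD|hD] := leqP D e; first by apply: (IH a e); lia.
  by have := hbetween e; lia.
move/existsPn => hne; exists a, d; split=> // [|e he]; first by rewrite h1.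
by have := hne (Ordinal he) => /=; lia.
Qed.

(* The inversions that can be read off the sides of the two boxes. *)
Definition visible_inv (f : nat -> int) a d : Prop := f d < f a /\
  ((forall c, (a < c < d)%N -> f c < f d) \/ (forall c, (a < c < d)%N -> f a < f c)).

(** A label between a and d that precedes both, together with one that follows both, would complete
    a forbidden pattern around the adjacent descent found by [descent_between]. *)
Lemma tB_visible f a d : inj_below n f -> tB_key f -> (a < d < n)%N -> f d < f a ->
  (forall c, (a < c < d)%N -> ~ (f d < f c < f a)) -> visible_inv f a d.
Proof.
move=> hf htB had hda hno; split=> //.
have [a' [d' [h1 h2 h3 h5 h6]]] := descent_between hf had hda hno.
have nf i j : (i < n)%N -> (j < n)%N -> i <> j -> f i <> f j.
  by move=> hi hj hij /hf; lia.
case: (boolP [exists c : 'I_n, (a < c < d)%N && (f c < f d)]); last first.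
  move/existsPn => h; right=> c hc; have hcn : (c < n)%N by lia.
  have := h (Ordinal hcn); have := hno c hc; have := nf c a; have := nf c d => /=.
  by rewrite hc /=; lia.
case/existsP=> -[c hcn] /= /andP[hc hcd].
left=> c' hc'; have := hno c' hc'; have := nf c' d; have := nf c' a.
move=> n1 n2 n3; rewrite ltNge; apply/negP => hle.
by apply: (htB a' d' c c') => //; lia.
Qed.

(** Induction on d - a: a label between a and d in value and in position splits the inversion into
    two shorter ones, and if there is none the inversion is visible. *)
Lemma tB_inv_sub f g : inj_below n f -> tB_key f ->
  (forall a d, (a < d < n)%N -> visible_inv f a d -> g d < g a) -> inv_sub n f g.
Proof.
move=> hf htB hg a d; have [m] := ubnP (d - a); elim: m a d => // m IH a d hm had hda.
case: (boolP [exists c : 'I_n, (a < c < d)%N && (f d < f c < f a)]).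
  case/existsP=> -[c hc] /= /andP[hacd hdca].
  by have := IH a c; have := IH c d; lia.
move/existsPn => hno; apply: hg => //; apply: tB_visible => // c hc hdca.
have hcn : (c < n)%N by lia.
by have := hno (Ordinal hcn); rewrite /= hc hdca.
Qed.

(** The two alternatives of a visible inversion amount to [top f d = a.+1] and [bot n f a = d], so
    horizontal sides decide. *)
Lemma visible_inv_boxes f g a d : inj_below n f -> inj_below n g ->
  (forall k, (k < n)%N -> top f k = top g k /\ bot n f k = bot n g k) ->
  (a < d < n)%N -> visible_inv f a d -> visible_inv g a d.
Proof.
move=> hf hg e had [hda [h|h]].
  have td : top f d = a.+1 by apply: top_eq => //; lia.
  have hd : (d < n)%N by lia.
  have [t1 t2 t3] := topP hg hd; move: t1 t2 t3.
  by have [<- _] := e d hd; rewrite td => t1 t2 t3; split; [apply: t3|left].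
have td : bot n f a = d by apply: bot_eq => //; lia.
have ha : (a < n)%N by lia.
have [t1 t2 t3] := botP hg ha; move: t1 t2 t3.
by have [_ <-] := e a ha; rewrite td => t1 t2 t3; split; [apply: t3; lia|right].
Qed.

(** The pair (a, b) is the only one to change its order, and c and c' hide it. *)
Lemma swap_adj_mixed f g a b c c' : inj_below n f -> inj_below n g ->
  swap_adj n f g a b -> (a < c < b)%N -> (a < c' < b)%N ->
  f c < f a -> f b < f c' ->
  forall k, (k < n)%N -> [/\ lft f k = lft g k, rgt n f k = rgt n g k,
    top f k = top g k & bot n f k = bot n g k].
Proof.
move=> hf hg [hab h1 h2 h3 h4] hc hc' hca hbc'; apply: boxes_invariant => // p q hpq hne.
case: (eqVneq (p, q) (a, b)) => [[-> ->]|/eqP hne']; last first.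
  by move: hne; rewrite h4 ?eqxx //; try lia; case=> *; lia.
exists c, c'; split=> //; split; rewrite ?h4 //; try lia; by case=> *; lia.
Qed.

(** From g to h only the inversion (a, b) is lost, and f cannot have it: being visible in f, it
    would force c' before b or c after a there, so f and hence g would have the inversion (a, c') or
    (c, b), which g lacks. *)
Lemma swap_adj_tB_inv_sub f g h a b c c' : inj_below n f -> tB_key f ->
  swap_adj n h g a b -> (a < c < b)%N -> (a < c' < b)%N ->
  h c < h a -> h b < h c' ->
  inv_sub n f g -> inv_sub n f h.
Proof.
move=> hf htB [hab h1 h2 h3 h4] hc hc' hca hbc' hfg p q hpq hqp.
case: (eqVneq (p, q) (a, b)) => [[ep eq]|/eqP hne]; last first.
  by have := hfg p q hpq hqp; rewrite h4 //; try lia; case=> *; [lia|apply: hne; congr (_, _)].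
exfalso; rewrite {}ep {}eq in hpq hqp.
have gh u v : (u < n)%N -> (v < n)%N -> (u, v) <> (a, b) -> (u, v) <> (b, a) ->
  (g u < g v) = (h u < h v) by exact: h4.
have gca : g c < g b by rewrite gh //; [lia|lia|lia|case=> *; lia|case=> *; lia].
have gca' : g c < g a by rewrite gh //; [lia|lia|case=> *; lia|case=> *; lia].
have gc'a : g a < g c' by rewrite gh //; [lia|lia|lia|case=> *; lia|case=> *; lia].
have gc'b : g b < g c' by rewrite gh //; [lia|lia|case=> *; lia|case=> *; lia].
have hno e : (a < e < b)%N -> ~ (f b < f e < f a).
  move=> he /andP[he1 he2]; have := hfg a e; have := hfg e b.
  have := gh a e; have := gh e b; have := h3 e.
  by rewrite !pair_equal_spec; lia.
have [_ [hall|hall]] := tB_visible hf htB hpq hqp hno.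
  by have := hall c' hc'; have := hfg a c'; lia.
by have := hall c hc; have := hfg c b; lia.
Qed.

(** Undoing the descent of a forbidden pattern keeps the boxes and removes an inversion, so the
    process ends at a twisted Baxter permutation. By the last clause it is the greatest one below y,
    which makes the passage from y to z monotone. *)
Lemma tB_below y : exists z, [/\ twisted_baxter z,
  inv_sub n (key z) (key y),
  forall k, (k < n)%N -> [/\ lft (key z) k = lft (key y) k,
    rgt n (key z) k = rgt n (key y) k,
    top (key z) k = top (key y) k & bot n (key z) k = bot n (key y) k]
  & forall x, twisted_baxter x -> inv_sub n (key x) (key y) ->
      inv_sub n (key x) (key z)].
Proof.
pose inv x' := [set p : 'I_n * 'I_n | (p.1 < p.2)%N && (key x' p.2 < key x' p.1)].
have [m] := ubnP #|inv y|; elim: m y => // m IH y hm.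
pose pattern (p : 'I_n * 'I_n * 'I_n * 'I_n) := let: (a, d, c, c') := p in
  [&& (a < c < d)%N, (a < c' < d)%N, key y d < key y a,
    [forall e : 'I_n, ~~ (key y d < key y e < key y a)],
    key y c < key y d & key y a < key y c'].
case: (pickP pattern) => [[[[a d] c] c']|hnone]; last first.
  exists y; split=> //; apply/twisted_baxter_key => a d c c' hd hc hc' hno hcd hda hac'.
  have ha : (a < n)%N by lia.
  have hcn : (c < n)%N by lia.
  have hcn' : (c' < n)%N by lia.
  have := hnone (Ordinal ha, Ordinal hd, Ordinal hcn, Ordinal hcn').
  rewrite /= hc hc' hda hcd hac' !andbT /= => /forallP[] e.
  by apply/negP/hno.
case/and5P=> hc hc' hda /forallP hno /andP[hcd hac'].
have hadn : (a < d < n)%N by have := ltn_ord d; lia.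
have [|z hzy hs] := swap_adj_down hadn hda.
  by move=> e he; apply/negP; exact: (hno (Ordinal he)).
have [_ s1 s2 s3 s4] := hs.
have zc : key z c < key z a by rewrite -s4 //; [lia|case=> *; lia|case=> *; lia].
have zc' : key z d < key z c' by rewrite -s4 //; [lia|case=> *; lia|case=> *; lia].
have [|w [w1 w2 w3 w4]] := IH z.
  apply: (@leq_trans #|inv y|); last by rewrite -ltnS.
  apply: proper_card; apply/properP; split.
    apply/subsetP => -[p q]; rewrite !inE /= => /andP[hpq hz]; rewrite hpq /=.
    by apply: (swap_adj_inv_sub hs) => //; rewrite hpq ltn_ord.
  exists (a, d); rewrite !inE /= ?hda ?andbT; first by lia.
  by rewrite negb_and -leNgt (ltW s1) orbT.
exists w; split=> //.
- exact: inv_sub_trans w2 (swap_adj_inv_sub hs).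
- move=> k hk; have [-> -> -> ->] := w3 k hk.
  exact: (swap_adj_mixed (@inj_key n z) (@inj_key n y) hs hc hc' zc zc').
- move=> x hx hxy; apply: w4 => //.
  exact: (swap_adj_tB_inv_sub (@inj_key n x) ((twisted_baxter_key x).1 hx) hs hc hc' zc zc').
Qed.

End Order.

(** * Covers of the quotient order as swaps *)

Section Covers.
Variables (F : realFieldType) (n : nat).
Implicit Types (x y z : 'S_n) (R : {fset box F}).

Lemma rects_key_inj x y : rects F n (key x) = rects F n (key y) ->
  forall k, (k < n)%N -> [/\ lft (key x) k = lft (key y) k,
    rgt n (key x) k = rgt n (key y) k,
    top (key x) k = top (key y) k & bot n (key x) k = bot n (key y) k].
Proof. exact: rects_inj (@inj_key n x) (@inj_key n y). Qed.

(** A twisted Baxter permutation is the least element of its fiber: its visible inversions are read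
    off the boxes, hence shared by y, and they generate the others. *)
Lemma tB_rects_inv_sub x y : twisted_baxter x ->
  rects F n (key x) = rects F n (key y) -> inv_sub n (key x) (key y).
Proof.
move=> /twisted_baxter_key hx /rects_key_inj e.
apply: (tB_inv_sub (@inj_key n x) hx) => a d had.
move/(visible_inv_boxes (@inj_key n x) (@inj_key n y)).
by case=> // k /e[].
Qed.

Lemma tB_rects_inj x y : twisted_baxter x -> twisted_baxter y ->
  rects F n (key x) = rects F n (key y) -> x = y.
Proof. by move=> hx hy e; apply: inv_sub_anti; apply: tB_rects_inv_sub. Qed.

Lemma tB_rects y : exists z, [/\ twisted_baxter z, inv_sub n (key z) (key y),
  rects F n (key z) = rects F n (key y)
  & forall x, twisted_baxter x -> inv_sub n (key x) (key y) ->
      inv_sub n (key x) (key z)].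
Proof.
by have [z [h1 h2 h3 h4]] := tB_below y; exists z; split=> //; exact: eq_rects.
Qed.

Lemma drec_le_tB x y : twisted_baxter x -> twisted_baxter y ->
  drec_le n (rects F n (key x)) (rects F n (key y)) <-> inv_sub n (key x) (key y).
Proof.
move=> hx hy; split=> [[x' [y' [hx' hy' /rho_rects ex /rho_rects ey /weak_le_inv_sub]]]|h].
  by rewrite (tB_rects_inj hx hx' ex) (tB_rects_inj hy hy' ey).
by exists x, y; split=> //; [apply/rho_rects|apply/rho_rects|apply: inv_sub_weak_le].
Qed.

(** An intermediate rectangulation has a representative q between x and x', the twisted Baxter
    permutations below y and y'. If q inverts a and b, it has all visible inversions of x', since
    those other than (a, b) are visible in y and so in x; then q = x'. If it does not, its
    inversions, which are inversions of y', are inversions of y, and the maximality of x gives q =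
    x. *)
Lemma covers_of_swap y y' a b : swap_adj n (key y) (key y') a b ->
  rects F n (key y) <> rects F n (key y') ->
  drec_covers n (rects F n (key y)) (rects F n (key y')).
Proof.
move=> hs hne; have hyy := swap_adj_inv_sub hs.
have [x [tx xy ex maxx]] := tB_rects y; have [x' [tx' xy' ex' maxx']] := tB_rects y'.
split.
  split=> //; rewrite -ex -ex'; apply/drec_le_tB => //.
  by apply: maxx' => //; apply: inv_sub_trans xy hyy.
case=> Q [_ [[x1 [q [tx1 tq /rho_rects e1 /rho_rects eq /weak_le_inv_sub xq]]] h1]
  [[q' [x2 [tq' tx2 /rho_rects eq' /rho_rects e2 /weak_le_inv_sub qx]]] h2]].
have ?: q' = q by apply: tB_rects_inj => //; rewrite -eq.
have ?: x1 = x by apply: tB_rects_inj => //; rewrite ex.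
have ?: x2 = x' by apply: tB_rects_inj => //; rewrite ex'.
subst q' x1 x2.
have [hab s1 s2 s3 s4] := hs.
have qy' := inv_sub_trans qx xy'.
case: (ltP (key q b) (key q a)) => hq.
  apply: h2; rewrite eq -ex'; congr (rects F n (key _)).
  apply: inv_sub_anti => //.
  apply: (tB_inv_sub (@inj_key n x') ((twisted_baxter_key x').1 tx')) => p d hpd.
  move/(visible_inv_boxes (@inj_key n x') (@inj_key n y')) => hv.
  have {}hv : visible_inv (key y') p d by apply: hv => // k /(rects_key_inj ex')[].
  case: (eqVneq (p, d) (a, b)) => [[-> ->] //|/eqP hne'].
  apply: xq => //.
  have : visible_inv (key x) p d.
    apply: (visible_inv_boxes (@inj_key n y) (@inj_key n x)) => //.
      by move=> k /(rects_key_inj ex)[].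
    have hpd' : (d, p) <> (a, b) by case=> *; lia.
    have hpd'' : (d, p) <> (b, a) by case=> *; apply: hne'; congr (_, _).
    have [hv1 hv2] := hv.
    split; first by rewrite -s4 //; lia.
    case: hv2 => hv2; [left|right] => c hc; have := hv2 c hc.
      case: (eqVneq (c, d) (a, b)) => [[-> ->]|/eqP ?]; first by lia.
      by rewrite s4 //; try lia; case=> *; lia.
    case: (eqVneq (p, c) (a, b)) => [[-> ->]|/eqP ?]; first by lia.
    by rewrite s4 //; try lia; case=> *; lia.
  by case.
apply: h1; rewrite eq -ex; congr (rects F n (key _)); apply: inv_sub_anti => //.
apply: maxx => // p d hpd hqdp; have := qy' p d hpd hqdp.
case: (eqVneq (p, d) (a, b)) => [[ep ed]|/eqP hne']; first by move: hqdp; rewrite ep ed; lia.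
by rewrite s4 //; try lia; case=> *; [lia|apply: hne'; congr (_, _)].
Qed.

(** The swap is the last step, from y to x', of a chain in the weak order from x to x'. The twisted
    Baxter permutation below y lies between x and x' and differs from x' because it lacks the last
    inversion, so the cover relation forces it to represent R. *)
Lemma swap_of_covers R R' : (forall x, is_drec n (rects F n (key x))) ->
  drec_covers n R R' -> exists y y' a b, [/\ R = rects F n (key y),
    R' = rects F n (key y') & swap_adj n (key y) (key y') a b].
Proof.
move=> hdrec [[[x [x' [tx tx' /rho_rects ex /rho_rects ex' hxx']]] hne] hcov].
case/connectP: hxx' => s; case/lastP: s => [_ e|s z].
  by case: hne; rewrite ex ex' e.
rewrite rcons_path last_rcons => /andP[hs hlast] ez; subst z.
set y := last x s in hlast.
have hxy : weak_le x y by apply/connectP; exists s.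
have [a [b hsw]] := weak_cover_swap hlast.
have [z [tz zy ez maxz]] := tB_rects y.
exists y, x', a, b; split=> //; rewrite -ez.
case: (eqVneq R (rects F n (key z))) => [//|/eqP hRz].
case: hcov; exists (rects F n (key z)); split; first exact: hdrec.
  split=> //; rewrite ex; apply/drec_le_tB => //.
  by apply: maxz => //; apply: weak_le_inv_sub.
rewrite ex'; split.
  by apply/drec_le_tB => //; apply: inv_sub_trans zy (swap_adj_inv_sub hsw).
move=> e; have ezx := tB_rects_inj tz tx' e.
have [hab h1 h2 _ _] := hsw.
by have := zy a b hab; rewrite ezx; lia.
Qed.

End Covers.

(** * Walls *)

Lemma le_diag_cell (F : realFieldType) (n : nat) (u : F) : (0 < n)%N ->
  0 <= u <= n%:R -> exists2 i, (i < n)%N & i%:R <= u <= i.+1%:R.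
Proof.
elim: n => // n IH _ /andP[h0 hn].
case: (lerP u n%:R) => h; last by exists n => //; lra.
case: n IH h hn => [|n] IH h hn; first by exists 0%N => //; lra.
by have [||i hi hu] := IH; [|lra|exists i => //; nlia].
Qed.

(** Supplies heights strictly inside a row of cells: there the boundaries of boxes are met only in
    vertical sides. *)
Lemma exists_in_cell (F : realFieldType) (n : nat) (a b : F) :
  0 <= a -> a < b -> b <= n%:R ->
  exists m v, [/\ (m < n)%N, a < v < b & m%:R < v < m.+1%:R].
Proof.
move=> h0 hab hb; have hn : (0 < n)%N.
  by rewrite -(ltr_nat F); lra.
have [m hm /andP[hm1]] := @le_diag_cell _ _ a hn ltac:(lra).
rewrite le_eqVlt => /orP[/eqP e|hlt]; last first.
  exists m, ((a + Num.min b m.+1%:R) / 2); split=> //;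
  by case: (leP b m.+1%:R) => h; lra.
have hm' : (m.+1 < n)%N by rewrite -(ltr_nat F); lra.
exists m.+1, ((a + Num.min b m.+2%:R) / 2); split=> //;
have h2 : m.+2%:R = m.+1%:R + 1 :> F by rewrite -[in LHS]addn1 natrD.
all: by case: (leP b m.+2%:R) => h; lra.
Qed.

Section Transpose.
Variables (F : realFieldType) (n : nat).
Implicit Types (p : point F) (b w s : box F) (R : {fset box F}).

(* Reflection of the square in its diagonal. *)
Definition refl p : point F := (n%:R - p.2, n%:R - p.1).
Definition refl_box b : box F := (refl b.2, refl b.1).

Lemma reflK : involutive refl.
Proof. by case=> x y; rewrite /refl /=; congr (_, _); ring. Qed.

Lemma refl_boxK : involutive refl_box.
Proof. by case=> x y; rewrite /refl_box /= !reflK. Qed.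

Lemma in_refl_box b p : in_box (refl_box b) (refl p) = in_box b p.
Proof. by rewrite /in_box /=; lra. Qed.

Lemma refl_box_interior b p :
  rect_interior (refl_box b) (refl p) = rect_interior b p.
Proof. by rewrite /rect_interior /=; lra. Qed.

Lemma refl_box_boundary b p :
  rect_boundary (refl_box b) (refl p) = rect_boundary b p.
Proof. by rewrite /rect_boundary in_refl_box refl_box_interior. Qed.

Lemma box_sub_refl b c : box_sub b c -> box_sub (refl_box b) (refl_box c).
Proof.
by move=> h p; rewrite -(reflK p) !in_refl_box; apply: h.
Qed.

Lemma vertical_refl b : vertical (refl_box b) = horizontal b.
Proof. by rewrite /vertical /horizontal /=; lra. Qed.

Lemma horizontal_refl b : horizontal (refl_box b) = vertical b.
Proof. by rewrite /vertical /horizontal /=; lra. Qed.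

Lemma is_seg_refl b : is_seg (refl_box b) = is_seg b.
Proof. by rewrite /is_seg vertical_refl horizontal_refl orbC. Qed.

Lemma refl_sides w : w \in sides (square F n) ->
  refl_box w \in sides (square F n).
Proof.
rewrite !inE => /or4P[] /eqP ->; apply/or4P;
  [apply: Or44|apply: Or43|apply: Or42|apply: Or41];
  by rewrite /refl_box /refl /= ?subrr ?subr0.
Qed.

Lemma wall_refl R R' w : (forall p, skeleton R p <-> skeleton R' (refl p)) ->
  wall (square F n) R w -> wall (square F n) R' (refl_box w).
Proof.
move=> hRR' [[h1 h2] h3 h4].
have hR'R p : skeleton R' p <-> skeleton R (refl p) by rewrite hRR' reflK.
split.
- split; first by rewrite is_seg_refl.
  by move=> p; rewrite -(reflK p) in_refl_box => /h2 /hRR'.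
- move=> s [s1 s2] hs; rewrite -(refl_boxK s); congr refl_box.
  apply: h3; last by rewrite -(refl_boxK w); apply: box_sub_refl.
  split; first by rewrite is_seg_refl.
  by move=> p; rewrite -(reflK p) in_refl_box => /s2 /hR'R.
- by apply: contra h4 => /refl_sides; rewrite refl_boxK.
Qed.

End Transpose.

Lemma box_sub_coords (F : realFieldType) (b c : box F) : box_sub b c ->
  b.1.1 <= b.2.1 -> b.1.2 <= b.2.2 ->
  [/\ c.1.1 <= b.1.1, b.2.1 <= c.2.1, c.1.2 <= b.1.2 & b.2.2 <= c.2.2].
Proof.
move=> h h1 h2; have := h b.1; have := h b.2; rewrite /in_box.
move=> /(_ ltac:(lra)) ? /(_ ltac:(lra)) ?; split; lra.
Qed.

Lemma box_eqP (F : realFieldType) (b c : box F) :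
  b.1.1 = c.1.1 -> b.1.2 = c.1.2 -> b.2.1 = c.2.1 -> b.2.2 = c.2.2 -> b = c.
Proof. by case: b c => [[? ?] [? ?]] [[? ?] [? ?]] /= -> -> -> ->. Qed.

Section Walls.
Variables (F : realFieldType) (n : nat).
Hypothesis hn : (0 < n)%N.
Local Notation S := (square F n).
Local Notation rects := (rects F n).
Local Notation rbox := (rbox F n).
Implicit Types (f : nat -> int) (p : point F).

Lemma rects_subdivision f : inj_below n f -> subdivision S (rects f).
Proof.
move=> hf; split.
- move=> r /rectsP[k hk ->]; rewrite /is_rect /= ltr_nat ltrD2l ltrN2 ltr_nat.
  have := max_lft_top hf hk; have := min_rgt_bot hf hk; nlia.
- move=> p; split.
    rewrite /in_box /= => /andP[h1 h2].
    have [i hi hi'] := le_diag_cell hn h1.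
    have [m hm hm'] := @le_diag_cell _ _ (n%:R - p.2) hn ltac:(lra).
    have [k hk hc] := in_cell_exists hf hi hm.
    exists (rbox f k); first exact: mem_rects.
    have /and4P[] : [&& (lft f k)%:R <= i%:R :> F, i.+1%:R <= (rgt n f k)%:R :> F,
       (top f k)%:R <= m%:R :> F & m.+1%:R <= (bot n f k)%:R :> F].
      by move: hc; rewrite /in_cell !ler_nat; nlia.
    rewrite /=; lra.
  case=> r /rectsP[k hk ->]; rewrite in_nbox /in_box /=.
  have [_ _ _] := lftP hf hk; have [r1 _ _] := rgtP hf hk; have [b1 _ _] := botP hf hk.
  have : (rgt n f k)%:R <= n%:R :> F by rewrite ler_nat; nlia.
  have : (bot n f k)%:R <= n%:R :> F by rewrite ler_nat; nlia.
  have := ler0n F (lft f k); have := ler0n F (top f k); lra.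
- move=> r r' p /rectsP[k hk ->] /rectsP[k' hk' ->].
  rewrite !nbox_interior => h h'.
  have [r1 _ _] := rgtP hf hk; have [b1 _ _] := botP hf hk.
  have hrn : (rgt n f k)%:R <= n%:R :> F by rewrite ler_nat; nlia.
  have hbn : (bot n f k)%:R <= n%:R :> F by rewrite ler_nat; nlia.
  have h0 := ler0n F (lft f k); have h0' := ler0n F (top f k).
  have [i hi hi'] := @le_diag_cell _ _ p.1 hn ltac:(lra).
  have [m hm hm'] := @le_diag_cell _ _ (n%:R - p.2) hn ltac:(lra).
  have in_c (a b : nat) (u : F) j : a%:R < u < b%:R -> j%:R <= u <= j.+1%:R -> (a <= j < b)%N.
    by move=> ? ?; rewrite -ltnS -(ltr_nat F) -(ltr_nat F j b); lra.
  have c1 : in_cell n f k i m.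
    by apply/andP; split; [apply: (in_c _ _ p.1)|apply: (in_c _ _ (n%:R - p.2))]; lra.
  have c2 : in_cell n f k' i m.
    by apply/andP; split; [apply: (in_c _ _ p.1)|apply: (in_c _ _ (n%:R - p.2))]; lra.
  by rewrite (in_cell_uniq hf hk hk' c1 c2).
Qed.

Lemma skeleton_neg f p : skeleton (rects f) p <-> skeleton (rects (neg f)) (refl n p).
Proof.
have e g k : rbox (neg g) k = refl_box n (rbox g k).
  rewrite /rbox /refl_box /refl /= lft_neg_neg rgt_neg_neg /nbox.
  by congr ((_, _), (_, _)); rewrite /=; ring.
split=> [] [r /rectsP[k hk ->] h].
  by exists (rbox (neg f) k); [apply: mem_rects|rewrite e refl_box_boundary].
exists (rbox f k); first exact: mem_rects.
by rewrite -(refl_box_boundary n) -e.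
Qed.

(** At a height inside a row only vertical sides occur, and [wall_of_lft] and [wall_of_rgt] put them
    on walls through the diagonal. *)
Lemma skeleton_row f (c v : F) m : inj_below n f -> (m < n)%N ->
  m%:R < v < m.+1%:R -> skeleton (rects f) (c, n%:R - v) ->
  [\/ c = 0, c = n%:R | exists i, [/\ (0 < i < n)%N, c = i%:R, f i.-1 < f i &
     (top f i <= m < bot n f i.-1)%N]].
Proof.
move=> hf hm hv [r /rectsP[k hk ->]]; rewrite /rect_boundary in_nbox nbox_interior /=.
rewrite opprB addrC subrK => /andP[/andP[hu htb] hni].
have htb' : (top f k <= m < bot n f k)%N.
  by rewrite -ltnS -(ltr_nat F) -(ltr_nat F m (bot n f k)); lra.
have ht1 : (top f k)%:R <= m%:R :> F by rewrite ler_nat; nlia.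
have ht2 : m.+1%:R <= (bot n f k)%:R :> F by rewrite ler_nat; nlia.
have /orP[/eqP ec|/eqP ec] : (c == (lft f k)%:R) || (c == (rgt n f k)%:R) by lra.
  have [l1 _ _] := lftP hf hk.
  case: (posnP (lft f k)) => h0; first by apply: Or31; rewrite ec h0.
  have [w1 w2] := wall_of_lft hf hk h0 htb'.
  by apply: Or33; exists (lft f k); split=> //; nlia.
have [r1 _ _] := rgtP hf hk.
case: (ltnP (rgt n f k) n) => h0; last by apply: Or32; rewrite ec; congr (_%:R); nlia.
have [w1 w2] := wall_of_rgt hf hk h0 htb'.
by apply: Or33; exists (rgt n f k); split=> //; nlia.
Qed.

Lemma skeleton_in_square f p : inj_below n f -> skeleton (rects f) p -> in_box S p.
Proof.
move=> hf [r hr /andP[h _]]; have [_ h2 _] := rects_subdivision hf.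
by apply/h2; exists r.
Qed.

(** One height inside a row identifies the wall. If the segment passed an end of this wall, a height
    inside a row of the excess would contradict [skeleton_row]. *)
Lemma skeleton_column f (c v1 v2 : F) : inj_below n f -> v1 < v2 ->
  (forall v, v1 <= v <= v2 -> skeleton (rects f) (c, n%:R - v)) ->
  [/\ 0 <= v1, v2 <= n%:R &
  [\/ c = 0, c = n%:R | exists i, [/\ (0 < i < n)%N, c = i%:R, f i.-1 < f i &
     (top f i)%:R <= v1 /\ v2 <= (bot n f i.-1)%:R]]].
Proof.
move=> hf hv h.
have hv1 : 0 <= v1 <= n%:R.
  by have := skeleton_in_square hf (h v1 ltac:(lra)); rewrite /in_box /=; lra.
have hv2 : 0 <= v2 <= n%:R.
  by have := skeleton_in_square hf (h v2 ltac:(lra)); rewrite /in_box /=; lra.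
split; try lra.
have [m [v [hm hvv hvm]]] := @exists_in_cell _ n v1 v2 ltac:(lra) hv ltac:(lra).
case: (skeleton_row hf hm hvm (h v ltac:(lra))) => [e|e|[i [hi e hfi _]]];
  [exact: Or31|exact: Or32|apply: Or33; exists i; split=> //].
have same w m' : (m' < n)%N -> m'%:R < w < m'.+1%:R -> v1 < w < v2 ->
    (top f i <= m' < bot n f i.-1)%N.
  move=> hm' hw hw'.
  case: (skeleton_row hf hm' hw (h w ltac:(lra))); rewrite e.
  - by move/eqP; rewrite pnatr_eq0; nlia.
  - by move/eqP; rewrite eqr_nat; nlia.
  by move=> [j [_ /eqP + _]]; rewrite eqr_nat => /eqP <-.
split; rewrite leNgt; apply/negP => hlt.
  have [m' [w [hm' hw hwm]]] := @exists_in_cell _ n v1 (Num.min v2 (top f i)%:R)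
    ltac:(lra) ltac:(by rewrite lt_min hv) ltac:(by rewrite ge_min; apply/orP; left; lra).
  have hw2 : w < v2 /\ w < (top f i)%:R by move: hw; rewrite lt_min; lra.
  have := same w m' hm' hwm ltac:(lra) => /andP[+ _].
  by rewrite -(ler_nat F); lra.
have [m' [w [hm' hw hwm]]] := @exists_in_cell _ n (Num.max v1 (bot n f i.-1)%:R) v2
    ltac:(by rewrite le_max; apply/orP; left; lra) ltac:(by rewrite gt_max hv) ltac:(lra).
have hw2 : v1 < w /\ (bot n f i.-1)%:R < w by move: hw; rewrite gt_max; lra.
have := same w m' hm' hwm ltac:(lra) => /andP[_].
by rewrite -(ler_nat F); lra.
Qed.

(** The wall through p_i is covered by the left side of box i above the diagonal and the right side
    of box i-1 below it. *)
Lemma skeleton_vline f i (v : F) : inj_below n f -> (0 < i < n)%N -> f i.-1 < f i ->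
  (top f i)%:R <= v <= (bot n f i.-1)%:R -> skeleton (rects f) (i%:R, n%:R - v).
Proof.
move=> hf hi hfi hv.
have hi1 : (i < n)%N by nlia.
have hi2 : (i.-1 < n)%N by nlia.
have mx := max_lft_top hf hi1; have mn := min_rgt_bot hf hi2.
have [l1 l2 l3] := lftP hf hi1; have [r1 r2 r3] := rgtP hf hi2.
have [t1 t2 t3] := topP hf hi2; have [b1 b2 b3] := botP hf hi1.
case: (lerP v i%:R) => hvi.
  exists (rbox f i); first exact: mem_rects.
  have ei : lft f i = i by have := l2 i.-1; nlia.
  have : i.+1%:R <= (bot n f i)%:R :> F by rewrite ler_nat; nlia.
  have : i%:R <= i.+1%:R :> F by rewrite ler_nat.
  have : i%:R <= (rgt n f i)%:R :> F by have [? _ _] := rgtP hf hi1; rewrite ler_nat; nlia.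
  by rewrite /rect_boundary in_nbox nbox_interior /= ei; lra.
exists (rbox f i.-1); first exact: mem_rects.
have ei : rgt n f i.-1 = i by have := r2 i; nlia.
have : (top f i.-1)%:R <= i%:R :> F by rewrite ler_nat; nlia.
have : (lft f i.-1)%:R <= i%:R :> F by have [? _ _] := lftP hf hi2; rewrite ler_nat; nlia.
by rewrite /rect_boundary in_nbox nbox_interior /= ei; lra.
Qed.

Lemma skeleton_side f p s : inj_below n f -> s \in sides S -> in_box s p ->
  skeleton (rects f) p.
Proof.
move=> hf hs hp; have [_ h2 _] := rects_subdivision hf.
have n0 := ler0n F n.
have hsp : in_box S p.
  by move: hs hp; rewrite !inE => /or4P[] /eqP ->; rewrite /in_box /=; lra.
have [r hr hrp] := (h2 p).1 hsp; exists r => //; rewrite /rect_boundary hrp /=.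
case/rectsP: hr => k hk er; rewrite er nbox_interior.
have [r1 _ _] := rgtP hf hk; have [b1 _ _] := botP hf hk.
have hrn : (rgt n f k)%:R <= n%:R :> F by rewrite ler_nat; nlia.
have hbn : (bot n f k)%:R <= n%:R :> F by rewrite ler_nat; nlia.
have h0 := ler0n F (lft f k); have h0' := ler0n F (top f k).
by move: hs hp; rewrite !inE => /or4P[] /eqP ->; rewrite /in_box /=; lra.
Qed.

End Walls.

(** * Every order of the labels gives a diagonal rectangulation *)

Section DRec.
Variables (F : realFieldType) (n : nat).
Hypothesis hn : (0 < n)%N.
Local Notation S := (square F n).
Local Notation rects := (rects F n).
Implicit Types (f : nat -> int) (p : point F) (w : box F).

Definition vwall f i : box F :=
  ((i%:R, n%:R - (bot n f i.-1)%:R), (i%:R, n%:R - (top f i)%:R)).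
Definition hwall f i := refl_box n (vwall (neg f) i).

Lemma in_vwall f i p : in_box (vwall f i) p =
  (p.1 == i%:R) && ((top f i)%:R <= n%:R - p.2 <= (bot n f i.-1)%:R).
Proof. by rewrite /in_box /=; lra. Qed.

Lemma top_lt_wall f i : inj_below n f -> (0 < i < n)%N -> f i.-1 < f i ->
  (top f i < i < bot n f i.-1)%N.
Proof.
move=> hf hi hfi; have hi1 : (i < n)%N by nlia. have hi2 : (i.-1 < n)%N by nlia.
have [? ? ?] := topP hf hi1; have [? ? ?] := botP hf hi2.
have [? h ?] := lftP hf hi1; have [? h' ?] := rgtP hf hi2.
have := max_lft_top hf hi1; have := min_rgt_bot hf hi2.
have ei : (top f i <= i.-1)%N by apply: top_le => [|j hj]; [nlia|have -> : j = i.-1 by nlia].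
have ei' : (i.+1 <= bot n f i.-1)%N by apply: bot_ge => [|j hj]; [nlia|have -> : j = i by nlia].
nlia.
Qed.

Lemma vwall_skeleton f i : inj_below n f -> (0 < i < n)%N -> f i.-1 < f i ->
  seg_in_skeleton (rects f) (vwall f i).
Proof.
move=> hf hi hfi; split.
  rewrite /is_seg /vertical /= eqxx ltrD2l ltrN2 ltr_nat /=.
  by have := top_lt_wall hf hi hfi; nlia.
case=> u y; rewrite in_vwall /= => /andP[/eqP -> hy].
have -> : y = n%:R - (n%:R - y) by ring.
exact: skeleton_vline.
Qed.

Lemma vertical_in_skeleton f w : inj_below n f -> vertical w ->
  (forall p, in_box w p -> skeleton (rects f) p) ->
  [\/ box_sub w (left_side S), box_sub w (right_side S) |
     exists i, [/\ (0 < i < n)%N, f i.-1 < f i, w.1.1 = i%:R & box_sub w (vwall f i)]].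
Proof.
case: w => [[c y1] [c' y2]] hf; rewrite /vertical /= => /andP[/eqP <- hy] hw.
have [||h1 h2 h3] := @skeleton_column _ _ hn f c (n%:R - y2) (n%:R - y1) hf.
- lra.
- by move=> v hv; apply: hw; rewrite /in_box /=; lra.
case: h3 => [e|e|[i [hi e hfi [h3 h4]]]].
- by apply: Or31 => p; rewrite /in_box /=; lra.
- by apply: Or32 => p; rewrite /in_box /=; lra.
apply: Or33; exists i; split=> // p; rewrite in_vwall /in_box /= e.
by move=> hp; apply/andP; split; lra.
Qed.

Lemma side_in_skeleton f s : inj_below n f -> s \in sides S ->
  seg_in_skeleton (rects f) s.
Proof.
move=> hf hs; split; last by move=> p; exact: skeleton_side hs.
have : (0 : F) < n%:R by rewrite ltr0n.
by move: hs; rewrite !inE => /or4P[] /eqP ->; rewrite /is_seg /vertical /horizontal /=; lra.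
Qed.

Lemma vertical_wall f w : inj_below n f -> vertical w -> wall S (rects f) w ->
  exists i, [/\ (0 < i < n)%N, f i.-1 < f i & w = vwall f i].
Proof.
move=> hf hv [[_ h1] h2 h3].
have hL : left_side S \in sides S by rewrite !inE eqxx.
have hR : right_side S \in sides S by rewrite !inE eqxx ?orbT.
case: (vertical_in_skeleton hf hv h1) => [h|h|[i [hi hfi _ h]]].
- by move: h3; rewrite -(h2 _ (side_in_skeleton hf hL) h) hL.
- by move: h3; rewrite -(h2 _ (side_in_skeleton hf hR) h) hR.
by exists i; split=> //; rewrite (h2 _ (vwall_skeleton hf hi hfi) h).
Qed.

Lemma vwall_wall f i : inj_below n f -> (0 < i < n)%N -> f i.-1 < f i ->
  wall S (rects f) (vwall f i).
Proof.
move=> hf hi hfi; have hb := top_lt_wall hf hi hfi.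
have htb : n%:R - (bot n f i.-1)%:R < n%:R - (top f i)%:R :> F.
  by rewrite ltrD2l ltrN2 ltr_nat; nlia.
have i0 : (0 : F) < i%:R by rewrite ltr0n; nlia.
have i_n : i%:R < n%:R :> F by rewrite ltr_nat; nlia.
split; first exact: vwall_skeleton.
  move=> s [hs hsk] hsub; have [||s1 s2 s3 s4] := box_sub_coords hsub; [by rewrite /=; lra..|].
  rewrite /= in s1 s2 s3 s4.
  have hv : vertical s by move: hs; rewrite /is_seg /vertical /horizontal; lra.
  have ec : s.1.1 = i%:R by move: hv; rewrite /vertical; lra.
  have ec' : s.2.1 = i%:R by move: hv; rewrite /vertical; lra.
  case: (vertical_in_skeleton hf hv hsk) => [h|h|[j [hj hfj ej h]]].
  - by exfalso; have [||] := box_sub_coords h; rewrite /=; lra.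
  - by exfalso; have [||] := box_sub_coords h; rewrite /=; lra.
  move: ej; rewrite ec => /eqP; rewrite eqr_nat => /eqP ej; rewrite -ej in h.
  have [||] := box_sub_coords h; rewrite /=; [lra|lra|].
  by move=> *; apply: box_eqP => /=; lra.
rewrite !inE !negb_or; apply/and4P; split; apply/eqP => e;
  move: (congr1 (fun b => b.1.1) e) (congr1 (fun b => b.2.1) e) => /=; lra.
Qed.

Lemma wall_neg f w : wall S (rects f) w <-> wall S (rects (neg f)) (refl_box n w).
Proof.
split; first by apply: wall_refl => p; exact: skeleton_neg.
rewrite -{2}(refl_boxK n w); apply: wall_refl => p.
by rewrite (skeleton_neg n f (refl n p)) reflK.
Qed.

Lemma wallP f w : inj_below n f -> wall S (rects f) w <->
  exists i, (0 < i < n)%N /\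
    ((f i.-1 < f i /\ w = vwall f i) \/ (f i < f i.-1 /\ w = hwall f i)).
Proof.
move=> hf; have hnf := inj_below_neg hf; split; last first.
  case=> i [hi [[hfi ->]|[hfi ->]]]; first exact: vwall_wall.
  by apply/wall_neg; rewrite refl_boxK; apply: vwall_wall => //; rewrite /neg ltrN2.
move=> hw; have [[/orP[hv|hh] _] _ _] := hw.
  by have [i [hi hfi e]] := vertical_wall hf hv hw; exists i; split=> //; left.
move/wall_neg: hw; rewrite -(vertical_refl n) in hh => hw.
have [i [hi hfi e]] := vertical_wall hnf hh hw; exists i; split=> //; right.
by split; [move: hfi; rewrite /neg ltrN2|rewrite -(refl_boxK n w) e].
Qed.

Lemma in_hwall f i p : in_box (hwall f i) p =
  (p.2 == n%:R - i%:R) && ((lft f i)%:R <= p.1 <= (rgt n f i.-1)%:R).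
Proof.
rewrite /hwall -(reflK n p) in_refl_box in_vwall /= lft_neg_neg rgt_neg_neg.
lra.
Qed.

Lemma vwall_interior f i p : seg_interior (vwall f i) p ->
  p.1 = i%:R /\ (top f i)%:R < n%:R - p.2 < (bot n f i.-1)%:R.
Proof.
case/and3P; rewrite in_vwall => /andP[/eqP e1 h] h1 h2; split=> //.
have {}h1 : p.2 != n%:R - (bot n f i.-1)%:R.
  by apply: contra h1 => /eqP e; rewrite (surjective_pairing p) e1 e.
have {}h2 : p.2 != n%:R - (top f i)%:R.
  by apply: contra h2 => /eqP e; rewrite (surjective_pairing p) e1 e.
lra.
Qed.

Lemma hwall_interior f i p : seg_interior (hwall f i) p ->
  n%:R - p.2 = i%:R /\ (lft f i)%:R < p.1 < (rgt n f i.-1)%:R.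
Proof.
case/and3P => h h1 h2.
have : seg_interior (vwall (neg f) i) (refl n p).
  rewrite /seg_interior -(in_refl_box n) reflK h /=; apply/andP; split.
    by apply: contra h2 => /eqP e; rewrite -[p](reflK n) e.
  by apply: contra h1 => /eqP e; rewrite -[p](reflK n) e.
by move/vwall_interior => /=; rewrite lft_neg_neg rgt_neg_neg; case; split; lra.
Qed.

Lemma rects_is_drec f : inj_below n f -> is_drec n (rects f).
Proof.
move=> hf; have hnf := inj_below_neg hf; split.
- exact: rects_subdivision.
(* If i < j, the lower part of the vertical wall forces i-1 before j and the left part of the
   horizontal wall forces it after j. If j < i, the labels j-1 and i are in the same conflict. *)
- have cross i j p : (0 < i < n)%N -> (0 < j < n)%N -> f i.-1 < f i -> f j < f j.-1 ->
      seg_interior (vwall f i) p -> seg_interior (hwall f j) p -> False.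
    move=> hi hj hfi hfj /vwall_interior[e0 h1] /hwall_interior[e].
    move: h1; rewrite e e0 !ltr_nat => h1 h2.
    have hi1 : (i < n)%N by nlia. have hi2 : (i.-1 < n)%N by nlia.
    have hj1 : (j < n)%N by nlia. have hj2 : (j.-1 < n)%N by nlia.
    have [_ t2 _] := topP hf hi1; have [_ b2 _] := botP hf hi2.
    have [_ l2 _] := lftP hf hj1; have [_ r2 _] := rgtP hf hj2.
    case: (ltngtP i j) => h; last by rewrite h in hfi; nlia.
      by have := b2 j; have := l2 i.-1; nlia.
    by have := t2 j.-1; have := r2 i; nlia.
  move=> w w' p /(wallP _ hf)[i [hi hw]] /(wallP _ hf)[j [hj hw']].
  case: hw => [[hfi ->]|[hfi ->]]; case: hw' => [[hfj ->]|[hfj ->]] h h'.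
  + have [+ _] := vwall_interior h; have [-> _] := vwall_interior h'.
    by move/eqP; rewrite eqr_nat => /eqP ->.
  + by case: (cross i j p).
  + by case: (cross j i p).
  + have [+ _] := hwall_interior h; have [-> _] := hwall_interior h'.
    by move/eqP; rewrite eqr_nat => /eqP ->.
- move=> w /(wallP _ hf)[i [hi hw]]; exists (diag_pt F n i); first by exists i.
  case: hw => [[hfi ->]|[hfi ->]].
    rewrite in_vwall /= eqxx opprB addrC subrK !ler_nat /=.
    by have := top_lt_wall hf hi hfi; nlia.
  have hfi' : neg f i.-1 < neg f i by rewrite /neg ltrN2.
  have := top_lt_wall hnf hi hfi'; rewrite lft_neg_neg rgt_neg_neg.
  by rewrite in_hwall /= eqxx !ler_nat /=; nlia.
- move=> p [i [hi ->]].
  have nfi : f i.-1 <> f i by move=> /hf; nlia.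
  have vdiag j : in_box (vwall f j) (diag_pt F n i) -> j = i.
    by rewrite in_vwall /= eqr_nat => /andP[/eqP].
  have hdiag j : in_box (hwall f j) (diag_pt F n i) -> j = i.
    by rewrite in_hwall /= => /andP[/eqP/addrI/oppr_inj/eqP]; rewrite eqr_nat => /eqP.
  case: (ltgtP (f i.-1) (f i)) => [hfi|hfi|//].
    exists (vwall f i); split.
      split; first by apply/wallP => //; exists i; split=> //; left.
      rewrite in_vwall /= eqxx opprB addrC subrK !ler_nat /=.
      by have := top_lt_wall hf hi hfi; nlia.
    move=> w [/(wallP _ hf)[j [hj [[hfj ->]|[hfj ->]]]] hd].
      by rewrite (vdiag j hd).
    by rewrite (hdiag j hd) in hfj; nlia.
  exists (hwall f i); split.
    split; first by apply/wallP => //; exists i; split=> //; right.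
    have hfi' : neg f i.-1 < neg f i by rewrite /neg ltrN2.
    have := top_lt_wall hnf hi hfi'; rewrite lft_neg_neg rgt_neg_neg.
    by rewrite in_hwall /= eqxx !ler_nat /=; nlia.
  move=> w [/(wallP _ hf)[j [hj [[hfj ->]|[hfj ->]]]] hd].
    by rewrite (vdiag j hd) in hfj; nlia.
  by rewrite (hdiag j hd).
Qed.

End DRec.

(** * Permutations from rectangulations *)

Definition box_cell (l t r b : nat -> nat) k i m :=
  ((l k <= i < r k) && (t k <= m < b k))%N.

(* The conditions on maxn and minn say that (k, k) is the only diagonal cell of
   the box of label k. *)
Definition diag_tiling n (l t r b : nat -> nat) : Prop :=
  [/\ forall k, (k < n)%N -> [/\ maxn (l k) (t k) = k,
        minn (r k) (b k) = k.+1, (r k <= n)%N & (b k <= n)%N],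
      forall i m, (i < n)%N -> (m < n)%N ->
        exists2 k, (k < n)%N & box_cell l t r b k i m
    & forall k k' i m, (k < n)%N -> (k' < n)%N ->
        box_cell l t r b k i m -> box_cell l t r b k' i m -> k = k'].

Lemma diag_tilingC n l t r b : diag_tiling n l t r b -> diag_tiling n t l b r.
Proof.
move=> [h1 h2 h3]; split.
- by move=> k /h1[? ? ? ?]; split=> //; lia.
- by move=> i m hi hm; have [k hk] := h2 m i hm hi; exists k => //; rewrite /box_cell andbC.
- move=> k k' i m hk hk'; rewrite /box_cell andbC => h; rewrite andbC.
  by apply: h3 h.
Qed.

(** The comparisons between the labels i < k that are forced on an order with these boxes, first by
    the left and top sides of box k, then by the right and bottom sides of box i. *)
Definition sides_order (l t r b : nat -> nat) (f : nat -> int) i k : Prop :=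
  [/\ [/\ (l k <= i)%N -> f k < f i, i.+1 = l k -> f i < f k,
          (t k <= i)%N -> f i < f k & i.+1 = t k -> f k < f i]
    & [/\ (k < r i)%N -> f k < f i, k = r i -> f i < f k,
          (k < b i)%N -> f i < f k & k = b i -> f k < f i]].

Lemma sides_orderC l t r b f i k :
  sides_order l t r b f i k -> sides_order t l b r (neg f) i k.
Proof. by case=> [[? ? ? ?] [? ? ? ?]]; rewrite /sides_order /neg !ltrN2. Qed.

(** For i < m. Exchanging l with t and r with b turns it into the condition that i has to come after
    m. *)
Definition must_precede (l t r b : nat -> nat) m i : bool :=
  [|| i.+1 == l m, (t m <= i)%N, m == r i | (m < b i)%N].

(* Labels already inserted that have to come before m precede those that have
   to come after m, so that m can be inserted between them. *)
Lemma tiling_separation n l t r b f m i j : diag_tiling n l t r b -> (m < n)%N ->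
  (forall i k, (i < k < m)%N -> sides_order l t r b f i k) ->
  (i < m)%N -> (j < m)%N ->
  must_precede l t r b m i -> must_precede t l b r m j -> f i < f j.
Proof.
wlog lm : l t r b f i j / l m = m => [hw|] ht hm hso hi hj hB hA.
  have [h1 _ _] := ht; have [h _ _ _] := h1 m hm.
  case: (eqVneq (l m) m) => [e|hne]; first exact: (hw l t r b).
  have : neg f j < neg f i; last by rewrite /neg ltrN2.
  apply: (hw t l b r) => //; [lia|exact: diag_tilingC|].
  by move=> i' k hik; apply/sides_orderC/hso.
have [h1 h2 h3] := ht.
have [m1 m2 m3 m4] := h1 m hm.
have label k a c : (k < n)%N -> box_cell l t r b k a c -> (minn a c <= k <= maxn a c)%N.
  by move=> hk; have [? ? ? ?] := h1 k hk; rewrite /box_cell; lia.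
have in_n k : (k < m)%N -> (k < n)%N by move=> ?; lia.
(* Since [l m = m], a label forced after m has a box that crosses column m above box m. A label
   forced before m ([hBi]) lies beside the left side of box m or has a box reaching down to row m.
   The boxes of the two cells with coordinates m and j, or m and i, settle the cases. *)
have hAj : (j < t m)%N && (m < r j)%N.
  have [j1 j2 j3 j4] := h1 j (in_n j hj).
  case/or4P: hA => [/eqP e|e|/eqP e|e].
  - have [k hk hc] := h2 m j hm (in_n _ hj); have hl := label _ _ _ hk hc.
    case: (ltngtP k m) => [hkm|hkm|hkm]; [|lia|by move: hc; rewrite /box_cell hkm; lia].
    suff ekj : k = j by move: hc; rewrite /box_cell ekj; lia.
    case: (ltngtP k j) => [hkj|hkj|//]; first by lia.
    have [k1 k2 k3 k4] := h1 k hk.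
    have : k = m; last by lia.
    by apply: (h3 k m m k) => //; move: hc; rewrite /box_cell; lia.
  - by lia.
  - have [k hk hc] := h2 j m (in_n _ hj) hm; have hl := label _ _ _ hk hc.
    case: (ltngtP k m) => [hkm|hkm|hkm]; [|lia|by move: hc; rewrite /box_cell hkm; lia].
    have [k1 k2 k3 k4] := h1 k hk.
    have ekj : k = j.
      apply: (h3 k j j m.-1) => //; [exact: in_n|move: hc|]; rewrite /box_cell; lia.
    by move: hc; rewrite /box_cell ekj; lia.
  - rewrite e andbT ltnNge; apply/negP => h; have : j = m; last by lia.
    by apply: (h3 j m m j) => //; [exact: in_n|rewrite /box_cell; lia|rewrite /box_cell; lia].
have hBi : (t m <= i)%N || (m < b i)%N.
  have [i1 i2 i3 i4] := h1 i (in_n i hi).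
  case/or4P: hB => [/eqP e|->|/eqP e|->]; rewrite ?orbT //.
  - have [k hk hc] := h2 m i hm (in_n _ hi); have hl := label _ _ _ hk hc.
    case: (ltngtP k m) => [hkm|hkm|hkm]; [|lia|by move: hc; rewrite /box_cell hkm; lia].
    have ek : k = i by lia.
    have [k' hk' hc'] := h2 i m (in_n _ hi) hm; have hl' := label _ _ _ hk' hc'.
    case: (ltngtP k' m) => [hkm'|hkm'|hkm']; [|lia|by move: hc'; rewrite /box_cell hkm'; lia].
    have ek' : k' = i by lia.
    by move: hc hc'; rewrite /box_cell ek ek'; lia.
  - have [k hk hc] := h2 m i hm (in_n _ hi); have hl := label _ _ _ hk hc.
    case: (ltngtP k m) => [hkm|hkm|hkm]; [|lia|by move: hc; rewrite /box_cell hkm; lia].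
    have [k1 k2 k3 k4] := h1 k hk.
    have ekj : k = i.
      apply: (h3 k i m.-1 i) => //; [exact: in_n|move: hc|]; rewrite /box_cell; lia.
    by move: hc; rewrite /box_cell ekj; lia.
have [i1 i2 i3 i4] := h1 i (in_n i hi).
case: (ltngtP i j) => h.
- by have [_ [_ _ h' _]] := hso i j ltac:(lia); apply: h'; lia.
- by have [_ [h' _ _ _]] := hso j i ltac:(lia); apply: h'; lia.
- by rewrite h in hBi i2; lia.
Qed.

Lemma tiling_key n l t r b : diag_tiling n l t r b ->
  exists2 f, inj_below n f & forall i k, (i < k < n)%N -> sides_order l t r b f i k.
Proof.
move=> ht; suff : forall m, (m <= n)%N -> exists2 f, inj_below m f &
    forall i k, (i < k < m)%N -> sides_order l t r b f i k by apply.
elim=> [_|m IH hm]; first by exists (fun=> 0) => // i k; lia.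
have [f hf hso] := IH (ltnW hm).
have hsep i j := tiling_separation ht hm hso (i := i) (j := j).
(* q is one more than the largest key forced below that of m, or a lower bound of all keys if there
   is none. *)
have [q hqB hqA] : exists2 q : int,
    forall i, (i < m)%N -> must_precede l t r b m i -> f i < q &
    forall j, (j < m)%N -> must_precede t l b r m j -> q <= f j.
  have : exists c, forall j, (j < m)%N -> c <= f j.
    elim: (m) => [|m' [c hc]]; first by exists 0.
    exists (Num.min c (f m')) => j; rewrite ltnS leq_eqVlt => /orP[/eqP ->|hj].
      by lia.
    by have := hc j hj; lia.
  case=> c hc.
  have : forall m', (m' <= m)%N -> exists2 q : int,
      (forall i, (i < m')%N -> must_precede l t r b m i -> f i < q) &
      (forall j, (j < m)%N -> must_precede t l b r m j -> q <= f j).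
    elim=> [_|m' IH' hm']; first by exists c => // j hj _; apply: hc.
    have [q hq1 hq2] := IH' (ltnW hm').
    case: (boolP (must_precede l t r b m m')) => hp; last first.
      exists q => // i; rewrite ltnS leq_eqVlt => /orP[/eqP ->|]; last exact: hq1.
      by rewrite (negbTE hp).
    exists (Num.max q (f m' + 1)).
      move=> i; rewrite ltnS leq_eqVlt => /orP[/eqP -> _|hi hpi]; first by lia.
      by have := hq1 i hi hpi; lia.
    by move=> j hj hpj; have := hq2 j hj hpj; have := hsep m' j hm' hj hp hpj; lia.
  by move=> h; apply: h.
(* Doubling makes room: old keys become odd and the new one even, so both [f i < q] and [q <= f j]
   turn into strict inequalities between distinct keys. *)
pose f' k := if k == m then 2 * q else 2 * f k + 1.
have fm : f' m = 2 * q by rewrite /f' eqxx.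
have fk k : (k < m)%N -> f' k = 2 * f k + 1 by rewrite /f'; case: eqP => //; lia.
clearbody f'; clear hsep ; exists f'.
  move=> i j; rewrite ltnS leq_eqVlt => hi; rewrite ltnS leq_eqVlt => hj.
  case/orP: hi => [/eqP ei|hi]; case/orP: hj => [/eqP ej|hj].
  - by rewrite ei ej.
  - by rewrite ei fm (fk _ hj) => e; exfalso; clear -e; lia.
  - by rewrite ej fm (fk _ hi) => e; exfalso; clear -e; lia.
  - by rewrite (fk _ hi) (fk _ hj) => e; apply: (hf _ _ hi hj); clear -e; lia.
move=> i k /andP[hik]; rewrite ltnS leq_eqVlt => /orP[/eqP ek|hk]; last first.
  have [[? ? ? ?] [? ? ? ?]] := hso i k ltac:(lia).
  by rewrite /sides_order !fk; [split; split; lia|lia|lia].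
rewrite ek in hik *; rewrite /sides_order fm fk //.
have hB : must_precede l t r b m i -> 2 * f i + 1 < 2 * q by move=> /(hqB i hik); lia.
have hA : must_precede t l b r m i -> 2 * q < 2 * f i + 1 by move=> /(hqA i hik); lia.
split; split=> h; [apply: hA|apply: hB|apply: hB|apply: hA|apply: hA|apply: hB
  |apply: hB|apply: hA]; by rewrite /must_precede h ?eqxx ?orbT.
Qed.

Lemma tiling_boxes n l t r b : diag_tiling n l t r b -> exists2 f, inj_below n f &
  forall k, (k < n)%N -> [/\ lft f k = l k, rgt n f k = r k, top f k = t k
    & bot n f k = b k].
Proof.
move=> ht; have [f hf hso] := tiling_key ht; exists f => // k hk.
have [h1 _ _] := ht; have [k1 k2 k3 k4] := h1 k hk.
have low i : (i < k)%N -> [/\ (l k <= i)%N -> f k < f i, i.+1 = l k -> f i < f k,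
          (t k <= i)%N -> f i < f k & i.+1 = t k -> f k < f i].
  by move=> hi; have [] := hso i k ltac:(lia).
have high i : (k < i < n)%N -> [/\ (i < r k)%N -> f i < f k, i = r k -> f k < f i,
          (i < b k)%N -> f k < f i & i = b k -> f i < f k].
  by move=> hi; have [] := hso k i ltac:(lia).
have lk : (l k <= k)%N by lia.
have tk : (t k <= k)%N by lia.
have rk : (k < r k <= n)%N by lia.
have bk : (k < b k <= n)%N by lia.
split.
- apply: lft_eq => // [j /andP[h1' h2']|h]; first by have [h' _ _ _] := low j h2'; exact: h'.
  by have [_ h' _ _] := low (l k).-1 ltac:(lia); apply: h'; lia.
- apply: rgt_eq => // [j h|h]; first by have [h' _ _ _] := high j ltac:(lia); apply: h'; lia.
  by have [_ h' _ _] := high (r k) ltac:(lia); apply: h'.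
- apply: top_eq => // [j /andP[h1' h2']|h]; first by have [_ _ h' _] := low j h2'; exact: h'.
  by have [_ _ _ h'] := low (t k).-1 ltac:(lia); apply: h'; lia.
- apply: bot_eq => // [j h|h]; first by have [_ _ h' _] := high j ltac:(lia); apply: h'; lia.
  by have [_ _ _ h'] := high (b k) ltac:(lia); apply: h'.
Qed.

(** * Maximal intervals in a finite union of intervals *)

Section Intervals.
Variable F : realFieldType.
Implicit Types (s : seq (F * F)) (y a b : F).

Definition covered s y := has (fun i => i.1 <= y <= i.2) s.

(** An ordered field need not have suprema, so maximality comes from finiteness: as long as an
    interval contains b and ends beyond it, jump to its end. The number of intervals ending beyond b
    decreases. *)
Lemma extend_right s b : exists b', [/\ b <= b',
  forall y, b < y <= b' -> covered s y
  & forall b'', b' < b'' -> exists2 y, b' < y <= b'' & ~~ covered s y].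
Proof.
have [m] := ubnP (count (fun i => b < i.2) s); elim: m b => // m IH b hm.
case: (boolP (has (fun i => i.1 <= b < i.2) s)) => [|hno].
  case/hasP=> i his /andP[hi1 hi2].
  have [|b' [h1 h2 h3]] := IH i.2.
    suff : (count (fun j => (i.2 < j.2)%R) s + 1 <= count (fun j => (b < j.2)%R) s)%N.
      by move: hm; clear; lia.
    elim: (s) his {hm} => [//|j s' IHs]; rewrite inE => /orP[/eqP <-|/IHs] /=.
      rewrite ltxx hi2 add0n addnC leq_add2l.
      by apply: sub_count => k /=; apply: lt_trans.
    have : (i.2 < j.2) ==> (b < j.2) by apply/implyP; apply: lt_trans.
    by case: (i.2 < j.2); case: (b < j.2) => //= _; clear; lia.
  exists b'; split=> //; first by lra.
  move=> y hy; case: (leP y i.2) => h; last by apply: h2; lra.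
  by apply/hasP; exists i => //; lra.
exists b; split=> // [y|b'' hb]; first by lra.
(* Just to the right of b there is a gap up to the nearest left endpoint; the midpoint of b and c
   lies in it. *)
have [c hc hcs] : exists2 c, b < c <= b'' & forall i, i \in s -> b < i.1 -> c <= i.1.
  elim: (s) => [|i s' [c hc IHs]]; first by exists b'' => //; lra.
  case: (ltP b i.1) => h.
    exists (Num.min c i.1) => [|j]; first by case: (leP c i.1) => ?; lra.
    rewrite inE => /orP[/eqP ->|/IHs hj /hj]; first by rewrite ge_min lexx orbT.
    by rewrite ge_min => ->.
  by exists c => // j; rewrite inE => /orP[/eqP ->|/IHs //]; lra.
exists ((b + c) / 2); first lra.
apply/hasP => -[i his hi]; case: (ltP b i.1) => h; first by have := hcs i his h; lra.
by move/hasPn: hno => /(_ i his); lra.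
Qed.

Lemma extend_left s a : exists a', [/\ a' <= a,
  forall y, a' <= y < a -> covered s y
  & forall a'', a'' < a' -> exists2 y, a'' <= y < a' & ~~ covered s y].
Proof.
pose s' := [seq (- i.2, - i.1) | i <- s].
have hs' y : covered s' y = covered s (- y).
  rewrite /covered has_map; apply: eq_has => i /=; lra.
have [b [h1 h2 h3]] := extend_right s' (- a); exists (- b); split; first by lra.
  by move=> y hy; rewrite -(opprK y) -hs'; apply: h2; lra.
move=> a'' ha; have [|y hy hc] := h3 (- a''); first by lra.
by exists (- y); [lra|rewrite -hs'].
Qed.

Lemma maximal_interval s a b : a <= b -> (forall y, a <= y <= b -> covered s y) ->
  exists a' b', [/\ a' <= a, b <= b', forall y, a' <= y <= b' -> covered s y
    & forall a'' b'', a'' <= a' -> b' <= b'' ->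
      (forall y, a'' <= y <= b'' -> covered s y) -> a'' = a' /\ b'' = b'].
Proof.
move=> hab hc; have [b' [h1 h2 h3]] := extend_right s b.
have [a' [g1 g2 g3]] := extend_left s a.
exists a', b'; split=> //.
  move=> y hy; case: (ltP y a) => ha; first by apply: g2; lra.
  by case: (leP y b) => hb; [apply: hc; lra|apply: h2; lra].
move=> a'' b'' ha hb h; split; apply: le_anti; apply/andP; split=> //.
  rewrite leNgt; apply/negP => hlt; have [y hy] := g3 a'' hlt.
  by rewrite h //; lra.
rewrite leNgt; apply/negP => hlt; have [y hy] := h3 b'' hlt.
by rewrite h //; lra.
Qed.

End Intervals.

Section FromDRec.
Variables (F : realFieldType) (n : nat).
Hypothesis hn : (0 < n)%N.
Local Notation S := (square F n).
Implicit Types (R : {fset box F}) (p : point F) (w r b : box F).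

Lemma skeleton_line R (c : F) : (forall r, r \in R -> is_rect r) ->
  exists s, forall y, skeleton R (c, y) <-> covered s y.
Proof.
move=> hR; have : forall r, r \in enum_fset R -> is_rect r by [].
suff : forall l : seq (box F), (forall r, r \in l -> is_rect r) ->
    exists s, forall y, (exists2 r, r \in l & rect_boundary r (c, y)) <-> covered s y.
  by move=> h /h.
elim=> [_|r l IH hl]; first by exists [::] => y; split=> // -[].
have [|s hs] := IH; first by move=> q hq; apply: hl; rewrite inE hq orbT.
have /andP[r1 r2] : is_rect r by apply: hl; rewrite inE eqxx.
(* The boundary of r meets the line x = c in a full vertical side, in two single points of its
   horizontal sides (degenerate intervals), or not at all. *)
exists ((if (c == r.1.1) || (c == r.2.1) then [:: (r.1.2, r.2.2)]
  else if r.1.1 < c < r.2.1 then [:: (r.1.2, r.1.2); (r.2.2, r.2.2)] else [::]) ++ s).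
move=> y; rewrite /covered has_cat -/(covered s y).
have -> : has (fun i => i.1 <= y <= i.2) (if (c == r.1.1) || (c == r.2.1)
    then [:: (r.1.2, r.2.2)] else if r.1.1 < c < r.2.1
    then [:: (r.1.2, r.1.2); (r.2.2, r.2.2)] else [::]) = rect_boundary r (c, y).
  rewrite /rect_boundary /in_box /rect_interior /=.
  by case: ifP => h1 /=; [|case: ifP => h2 /=]; lra.
split=> [[q]|/orP[h|/hs[q hq h]]].
- by rewrite inE => /orP[/eqP -> ->//|hq h]; apply/orP; right; apply/hs; exists q.
- by exists r => //; rewrite inE eqxx.
- by exists q => //; rewrite inE hq orbT.
Qed.

Lemma vertical_wall_exists R w : (forall r, r \in R -> is_rect r) ->
  vertical w -> (forall p, in_box w p -> skeleton R p) ->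
  0 < w.1.1 -> w.1.1 < n%:R ->
  exists w', [/\ wall S R w', vertical w' & box_sub w w'].
Proof.
case: w => [[c y1] [c' y2]] hR; rewrite /vertical /= => /andP[/eqP <- hy] hw c0 cn.
have [s hs] := skeleton_line c hR.
have [|a [b [h1 h2 h3 h4]]] := @maximal_interval _ s y1 y2 (ltW hy).
  by move=> y hyy; apply/hs/hw; rewrite /in_box /=; lra.
have hv : vertical ((c, a), (c, b)) by rewrite /vertical /=; lra.
exists ((c, a), (c, b)); split=> //; last by move=> p; rewrite /in_box /=; lra.
split.
- split; first by rewrite /is_seg hv.
  case=> u y; rewrite /in_box /= => hp; have -> : u = c by lra.
  by apply/hs/h3; lra.
- move=> t [ht htR] hsub.
  have [||t1 t2 t3 t4] := box_sub_coords hsub; [by rewrite /=; lra..|].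
  rewrite /= in t1 t2 t3 t4.
  have hvt : vertical t by move: ht; rewrite /is_seg /vertical /horizontal; lra.
  have ec : t.1.1 = c by move: hvt; rewrite /vertical; lra.
  have ec' : t.2.1 = c by move: hvt; rewrite /vertical; lra.
  have [|e1 e2] := h4 t.1.2 t.2.2 t3 t4; last exact: box_eqP.
  by move=> y hyy; apply/hs/htR; rewrite /in_box /= ec ec'; lra.
- rewrite !inE !negb_or; apply/and4P; split; apply/eqP => e;
  move: (congr1 (fun b => b.1.1) e) (congr1 (fun b => b.2.1) e) => /=; lra.
Qed.

Definition refl_set R : {fset box F} := [fset b in map (refl_box n) (enum_fset R)]%fset.

Lemma mem_refl_set R b : (refl_box n b \in refl_set R) = (b \in R).
Proof.
rewrite in_fset /= mem_map //; exact: (can_inj (@refl_boxK _ n)).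
Qed.

Lemma mem_refl_set' R b : (b \in refl_set R) = (refl_box n b \in R).
Proof. by rewrite -(mem_refl_set R (refl_box n b)) refl_boxK. Qed.

Lemma skeleton_refl_set R p : skeleton R p <-> skeleton (refl_set R) (refl n p).
Proof.
split=> [[r hr hp]|[r]].
  by exists (refl_box n r); rewrite ?mem_refl_set ?refl_box_boundary.
rewrite mem_refl_set' -{2}(refl_boxK n r) refl_box_boundary => hr hp.
by exists (refl_box n r).
Qed.

Lemma wall_refl_set R w : wall S (refl_set R) w <-> wall S R (refl_box n w).
Proof.
split; last first.
  by rewrite -{2}(refl_boxK n w); apply: wall_refl => p; exact: skeleton_refl_set.
by apply: wall_refl => p; rewrite (skeleton_refl_set R (refl n p)) reflK.
Qed.

Lemma refl_diag i : refl n (diag_pt F n i) = diag_pt F n i.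
Proof. by rewrite /refl /diag_pt /=; congr (_, _); ring. Qed.

Lemma in_refl_box' b p : in_box (refl_box n b) p = in_box b (refl n p).
Proof. by rewrite -(in_refl_box n b) reflK. Qed.

Lemma refl_set_is_drec R : is_drec n R -> is_drec n (refl_set R).
Proof.
case=> [[h1 h2 h3] hcross hX huniq]; split.
- split.
  + move=> r; rewrite mem_refl_set' => /h1; rewrite /is_rect /=; lra.
  + move=> p; split=> [hp|[r]].
      have /h2[r hr hpr] : in_box S (refl n p) by move: hp; rewrite /in_box /=; lra.
      by exists (refl_box n r); rewrite ?mem_refl_set // in_refl_box'.
    rewrite mem_refl_set' => hr hp.
    have : in_box S (refl n p) by apply/h2; exists (refl_box n r); rewrite // in_refl_box' reflK.
    by rewrite /in_box /=; lra.
  + move=> r r' p; rewrite !mem_refl_set' => hr hr' hp hp'.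
    apply: (can_inj (@refl_boxK F n)); apply: (h3 _ _ (refl n p)) => //;
    by rewrite refl_box_interior.
- move=> w w' p /wall_refl_set hw /wall_refl_set hw' hp hp'.
  apply: (can_inj (@refl_boxK F n)); apply: (hcross _ _ (refl n p)) => //.
    by move: hp => /and3P[i1 i2 i3]; rewrite /seg_interior in_refl_box i1 /=
      !(inj_eq (can_inj (@reflK F n))) i2 i3.
  by move: hp' => /and3P[i1 i2 i3]; rewrite /seg_interior in_refl_box i1 /=
      !(inj_eq (can_inj (@reflK F n))) i2 i3.
- move=> w /wall_refl_set/hX[p [i [hi ->]] hp].
  exists (diag_pt F n i); first by exists i.
  by rewrite -refl_diag -in_refl_box' .
- move=> p [i [hi ->]].
  have [w [[hw1 hw2] hw3]] := huniq (diag_pt F n i) ltac:(by exists i).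
  exists (refl_box n w); split.
    by split; [apply/wall_refl_set; rewrite refl_boxK|rewrite -refl_diag in_refl_box].
  move=> w' [/wall_refl_set hw' hd]; rewrite -[w'](refl_boxK n); congr refl_box.
  by apply: hw3; split=> //; rewrite -refl_diag in_refl_box.
Qed.

End FromDRec.

(** * Every diagonal rectangulation comes from an order of the labels *)

Section Integral.
Variables (F : realFieldType) (n : nat).
Hypothesis hn : (0 < n)%N.
Local Notation S := (square F n).
Implicit Types (R : {fset box F}) (p : point F) (w x : box F).

Lemma drec_rect_in_square R (r : box F) : is_drec n R -> r \in R ->
  [/\ is_rect r, 0 <= r.1.1, r.2.1 <= n%:R, 0 <= r.1.2 & r.2.2 <= n%:R].
Proof.
move=> [[h1 h2 _] _ _ _] hr; have /andP[r1 r2] := h1 r hr.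
have hS p : in_box r p -> in_box S p by move=> hp; apply/h2; exists r.
have := hS r.1; have := hS r.2; rewrite /in_box /is_rect /= r1 r2.
by move=> /(_ ltac:(lra)) ? /(_ ltac:(lra)) ?; split=> //; lra.
Qed.

(* A vertical side inside the square extends to a wall, which contains a point
   of X. *)
Lemma vertical_wall_of_side R (r : box F) (c : F) : is_drec n R -> r \in R ->
  0 < c < n%:R -> c = r.1.1 \/ c = r.2.1 ->
  exists i w, [/\ (0 < i < n)%N, c = i%:R, wall S R w, vertical w &
    in_box w (diag_pt F n i) /\
    (forall y, r.1.2 <= y <= r.2.2 -> in_box w (c, y))].
Proof.
move=> hR hr hc hcr; have [/andP[r1 r2] _ _ _ _] := drec_rect_in_square hR hr.
have [[h1 h2 h3] _ hX _] := hR.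
have hv : vertical ((c, r.1.2), (c, r.2.2)) by rewrite /vertical eqxx.
have [|||w [hw hwv hsub]] := @vertical_wall_exists F n R _ h1 hv;
  [|by rewrite /=; lra|by rewrite /=; lra|].
  case=> u y; rewrite /in_box /= => hp; exists r => //.
  by rewrite /rect_boundary /in_box /rect_interior /=; case: hcr => e; lra.
have [p [i [hi ep]] hpw] := hX w hw; rewrite ep in hpw.
have [||s1 s2 s3 s4] := box_sub_coords hsub; [by rewrite /=; lra..|].
rewrite /= in s1 s2 s3 s4.
have e : c = i%:R by move: hwv hpw; rewrite /vertical /in_box /=; lra.
exists i, w; split=> //; split=> // y hy; apply: hsub; rewrite /in_box /=; lra.
Qed.

Lemma natural_abscissae R (r : box F) : is_drec n R -> r \in R ->
  exists l m : nat, [/\ (l < m <= n)%N, r.1.1 = l%:R & r.2.1 = m%:R].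
Proof.
move=> hR hr; have [/andP[r1 r2] h1 h2 _ _] := drec_rect_in_square hR hr.
have [l el] : exists l : nat, r.1.1 = l%:R.
  case: (eqVneq r.1.1 0) => [->|h0]; first by exists 0%N.
  have [||i [w [_ e _ _ _]]] := @vertical_wall_of_side R r r.1.1 hR hr; last by exists i.
    by lra.
  by left.
have [m em] : exists m : nat, r.2.1 = m%:R.
  case: (eqVneq r.2.1 n%:R) => [->|h0]; first by exists n.
  have [||i [w [_ e _ _ _]]] := @vertical_wall_of_side R r r.2.1 hR hr; last by exists i.
    by lra.
  by right.
exists l, m; split=> //; move: r1 h2; rewrite el em ltr_nat ler_nat; nlia.
Qed.

Lemma refl_nbox l t r b : refl_box n (nbox F n l t r b) = nbox F n t l b r.
Proof. by apply: box_eqP; rewrite /=; ring. Qed.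

Lemma drec_nbox R x : is_drec n R -> x \in R -> exists l t r b : nat,
  [/\ x = nbox F n l t r b, (l < r <= n)%N & (t < b <= n)%N].
Proof.
move=> hR hx; have [l [r [h1 h2 h3]]] := natural_abscissae hR hx.
have hx' : refl_box n x \in refl_set n R by rewrite mem_refl_set.
have [t [b [h4 h5 h6]]] := natural_abscissae (refl_set_is_drec hR) hx'.
exists l, t, r, b; split=> //; rewrite /= in h5 h6.
by apply: box_eqP => /=; lra.
Qed.

(** If r <= t, the box lies entirely below the diagonal. Its right and top sides extend to walls
    through p_r and p_t. These cross at the top right corner of the box if r < t, and are two walls
    through the same point of X if r = t. *)
Lemma nbox_meets_diag R l t r b : is_drec n R -> nbox F n l t r b \in R ->
  (l < r <= n)%N -> (t < b <= n)%N -> (t < r)%N.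
Proof.
move=> hR hx hlr htb; rewrite ltnNge; apply/negP => hrt.
have [_ hcross _ huniq] := hR.
have r0 : 0 < r%:R :> F by rewrite ltr0n; nlia.
have rn : r%:R < n%:R :> F by rewrite ltr_nat; nlia.
have t0 : 0 < t%:R :> F by rewrite ltr0n; nlia.
have tn : t%:R < n%:R :> F by rewrite ltr_nat; nlia.
have hrt' : r%:R <= t%:R :> F by rewrite ler_nat.
have hlr' : l%:R < r%:R :> F by rewrite ltr_nat; nlia.
have htb' : t%:R < b%:R :> F by rewrite ltr_nat; nlia.
have [||i [w [hi e hw hwv [hd hside]]]] :=
  @vertical_wall_of_side R _ r%:R hR hx; [by lra|by right|].
have ei : i = r by apply/eqP; rewrite -(eqr_nat F) e.
rewrite {}ei {e} in hd hi.
have hx' : nbox F n t l b r \in refl_set n R by rewrite -refl_nbox mem_refl_set.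
have [||j [w' [hj e' hw' hwv' [hd' hside']]]] :=
  @vertical_wall_of_side (refl_set n R) _ t%:R (refl_set_is_drec hR) hx'; [by lra|by left|].
have ej : j = t by apply/eqP; rewrite -(eqr_nat F) e'.
rewrite {}ej {e'} in hd' hj.
have {}hw' := (wall_refl_set n R w').1 hw'.
have {}hd' : in_box (refl_box n w') (diag_pt F n t) by rewrite -refl_diag in_refl_box.
have hne : w <> refl_box n w'.
  by move=> e; move: hwv hwv'; rewrite e vertical_refl /horizontal /vertical; lra.
apply: hne; case: (ltngtP r t) hrt => // [hlt _|ert _]; last first.
  have [w0 [_ hw0]] := huniq (diag_pt F n r) ltac:(by exists r).
  by rewrite -(hw0 w) ?(hw0 (refl_box n w')) // ert.
have hlt' : r%:R < t%:R :> F by rewrite ltr_nat.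
have q1 := hside (n%:R - b%:R) ltac:(rewrite /=; lra).
have q2 := hside (n%:R - t%:R) ltac:(rewrite /=; lra).
have q1' := hside' (n%:R - r%:R) ltac:(rewrite /=; lra).
have q2' := hside' (n%:R - l%:R) ltac:(rewrite /=; lra).
apply: (hcross _ _ (r%:R, n%:R - t%:R)) => //.
  apply/and3P; split=> //; apply/eqP => e.
    by move: q1; rewrite /in_box -e /=; lra.
  by move: hd; rewrite /in_box -e /=; lra.
rewrite /seg_interior.
have -> : (r%:R, n%:R - t%:R) = refl n (t%:R, n%:R - r%:R) :> point F.
  by rewrite /refl /=; congr (_, _); ring.
rewrite in_refl_box q1' /=; apply/andP; split; apply/eqP => e.
  move: q2'; rewrite /in_box -(reflK n w'.2) -e reflK /=; lra.
move: hd'; rewrite -refl_diag in_refl_box /in_box -(reflK n w'.1) -e reflK /=; lra.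
Qed.

(** The point lies on a wall, hence on the boundary of some box x'. Being interior to the given box,
    it has a neighbouring cell (a, m) in both boxes, so they coincide, and the point cannot be
    interior and on the boundary. *)
Lemma nbox_avoids_X R l t r b i : is_drec n R -> nbox F n l t r b \in R ->
  (0 < i < n)%N -> (l < i < r)%N -> (t < i < b)%N -> False.
Proof.
move=> hR hx hi hlr htb; have [[h1 h2 h3] hcross hX huniq] := hR.
have [w [[[[_ hw] _ _] hwd] _]] := huniq (diag_pt F n i) ltac:(by exists i).
have [x' hx' /andP[hb hni]] := hw _ hwd.
have [l' [t' [r' [b' [e hlr' htb']]]]] := drec_nbox hR hx'.
rewrite e in_nbox nbox_interior in hb hni.
have hint : rect_interior (nbox F n l t r b) (diag_pt F n i).
  by rewrite nbox_interior /= opprB addrC subrK !ltr_nat; nlia.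
move: hb; rewrite /= opprB addrC subrK !ler_nat => hb.
pose a := if (i < r')%N then i else i.-1; pose m := if (i < b')%N then i else i.-1.
have ha : (l' <= a < r')%N && (l <= a < r)%N by rewrite /a; case: ltnP; nlia.
have hm : (t' <= m < b')%N && (t <= m < b)%N by rewrite /m; case: ltnP; nlia.
clearbody a m.
have q1 : l'%:R <= a%:R :> F by rewrite ler_nat; nlia.
have q2 : a.+1%:R <= r'%:R :> F by rewrite ler_nat; nlia.
have q3 : l%:R <= a%:R :> F by rewrite ler_nat; nlia.
have q4 : a.+1%:R <= r%:R :> F by rewrite ler_nat; nlia.
have q5 : t'%:R <= m%:R :> F by rewrite ler_nat; nlia.
have q6 : m.+1%:R <= b'%:R :> F by rewrite ler_nat; nlia.
have q7 : t%:R <= m%:R :> F by rewrite ler_nat; nlia.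
have q8 : m.+1%:R <= b%:R :> F by rewrite ler_nat; nlia.
have s1 : a.+1%:R = a%:R + 1 :> F by rewrite -addn1 natrD.
have s2 : m.+1%:R = m%:R + 1 :> F by rewrite -addn1 natrD.
have ex : x' = nbox F n l t r b.
  apply: (h3 _ _ (a%:R + 1 / 2, n%:R - (m%:R + 1 / 2))) => //;
  by rewrite ?e nbox_interior /=; lra.
by move: hni; rewrite -nbox_interior -e ex hint.
Qed.

(** The diagonal cells of the box are those from [maxn l t] to [minn r b] exclusive. There is at
    least one by [nbox_meets_diag] for R and its reflection, and at most one because the box has no
    point of X in its interior. *)
Lemma drec_labels R l t r b : is_drec n R -> nbox F n l t r b \in R ->
  (l < r <= n)%N -> (t < b <= n)%N -> minn r b = (maxn l t).+1.
Proof.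
move=> hR hx hlr htb.
have h1 := nbox_meets_diag hR hx hlr htb.
have hx' : nbox F n t l b r \in refl_set n R by rewrite -refl_nbox mem_refl_set.
have h2 := nbox_meets_diag (refl_set_is_drec hR) hx' htb hlr.
have h3 := @nbox_avoids_X R l t r b (maxn l t).+1 hR hx.
case: (ltngtP (minn r b) (maxn l t).+1) => h; [by nlia| |by []].
by exfalso; apply: h3; nlia.
Qed.

Lemma finite_choice (T : Type) (x0 : T) (P : nat -> T -> Prop) m :
  (forall k, (k < m)%N -> exists z : T, P k z) ->
  exists g, forall k, (k < m)%N -> P k (g k).
Proof.
elim: m => [|m IH] h; first by exists (fun=> x0).
have [|g hg] := IH; first by move=> k hk; apply: h; lia.
have [z hz] := h m (leqnn _).
exists (fun k => if k == m then z else g k) => k hk.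
by case: eqP => [->//|hkm]; apply: hg; lia.
Qed.

Definition center i m : point F := (i%:R + 1 / 2, n%:R - (m%:R + 1 / 2)).

(** Centers of cells avoid all grid lines, so closed and open boxes contain the same ones; this
    translates statements about R into statements about cells. *)
Lemma center_nbox l t r b i m :
  in_box (nbox F n l t r b) (center i m) = ((l <= i < r) && (t <= m < b))%N /\
  rect_interior (nbox F n l t r b) (center i m) = ((l <= i < r) && (t <= m < b))%N.
Proof.
have lo (a c : nat) : (a%:R <= c%:R + 1 / 2 :> F) = (a <= c)%N /\
    (a%:R < c%:R + 1 / 2 :> F) = (a <= c)%N.
  case: (leqP a c) => h.
    by have : a%:R <= c%:R :> F by [rewrite ler_nat]; split; lra.
  have : c.+1%:R <= a%:R :> F by rewrite ler_nat.
  have -> : c.+1%:R = c%:R + 1 :> F by rewrite -addn1 natrD.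
  by split; lra.
have hi (a c : nat) : (c%:R + 1 / 2 <= a%:R :> F) = (c < a)%N /\
    (c%:R + 1 / 2 < a%:R :> F) = (c < a)%N.
  case: (ltnP c a) => h; last first.
    by have : a%:R <= c%:R :> F by [rewrite ler_nat]; split; lra.
  have : c.+1%:R <= a%:R :> F by rewrite ler_nat.
  have -> : c.+1%:R = c%:R + 1 :> F by rewrite -addn1 natrD.
  by split; lra.
rewrite in_nbox nbox_interior /center [(_, _).1]/= [(_, _).2]/=.
have -> : n%:R - (n%:R - (m%:R + 1 / 2)) = m%:R + 1 / 2 :> F by ring.
by rewrite !(lo _ _).1 !(lo _ _).2 !(hi _ _).1 !(hi _ _).2.
Qed.

Lemma drec_cell R i m : is_drec n R -> (i < n)%N -> (m < n)%N ->
  exists l t r b, [/\ nbox F n l t r b \in R, ((l <= i < r) && (r <= n))%N & ((t <= m < b) && (b <= n))%N].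
Proof.
move=> hR hi hm; have [[h1 h2 h3] _ _ _] := hR.
have hS : in_box S (center i m).
  have : i.+1%:R <= n%:R :> F by rewrite ler_nat.
  have : m.+1%:R <= n%:R :> F by rewrite ler_nat.
  have := ler0n F i; have := ler0n F m.
  have -> : i.+1%:R = i%:R + 1 :> F by rewrite -addn1 natrD.
  have -> : m.+1%:R = m%:R + 1 :> F by rewrite -addn1 natrD.
  by rewrite /in_box /=; lra.
have [x hx hxc] := (h2 _).1 hS.
have [l [t [r [b [e hlr htb]]]]] := drec_nbox hR hx.
exists l, t, r, b; rewrite -e; split=> //; move: hxc; rewrite e (center_nbox _ _ _ _ _ _).1; nlia.
Qed.

(** Label k goes to the box of the diagonal cell (k, k). Every box contains exactly one such cell,
    so the boxes form a [diag_tiling], to which the insertion of labels applies. *)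
Lemma drec_key R : is_drec n R -> exists2 f, inj_below n f & R = rects F n f.
Proof.
move=> hR; have [[_ _ h3] _ _ _] := hR.
pose P k (q : nat * nat * nat * nat) := let: (l, t, r, b) := q in
  [/\ nbox F n l t r b \in R, ((l <= k < r) && (r <= n))%N & ((t <= k < b) && (b <= n))%N].
have [|g hg] := @finite_choice _ (0, 0, 0, 0)%N P n.
  by move=> k hk; have [l [t [r [b h]]]] := drec_cell hR hk hk; exists (l, t, r, b).
pose l k := (g k).1.1.1; pose t k := (g k).1.1.2.
pose r k := (g k).1.2; pose b k := (g k).2.
have {}hg k : (k < n)%N -> [/\ nbox F n (l k) (t k) (r k) (b k) \in R,
    (l k <= k < r k)%N, (t k <= k < b k)%N, (r k <= n)%N & (b k <= n)%N].
  move=> /hg; rewrite /P /l /t /r /b; case: (g k) => [[[? ?] ?] ?] /= [-> ? ?].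
  by split=> //; nlia.
clearbody l t r b; clear P g.
have lab k : (k < n)%N -> maxn (l k) (t k) = k /\ minn (r k) (b k) = k.+1.
  move=> hk; have [k1 k2 k3 k4 k5] := hg k hk.
  by have := drec_labels hR k1 ltac:(nlia) ltac:(nlia); nlia.
have same x y i m : x \in R -> y \in R -> rect_interior x (center i m) ->
  rect_interior y (center i m) -> x = y by move=> *; apply: (h3 _ _ (center i m)).
have label_of x : x \in R -> exists2 k, (k < n)%N & x = nbox F n (l k) (t k) (r k) (b k).
  move=> hx; have [l' [t' [r' [b' [e hlr htb]]]]] := drec_nbox hR hx.
  rewrite e in hx *; have hl := drec_labels hR hx hlr htb.
  have hk : (maxn l' t' < n)%N by nlia.
  exists (maxn l' t') => //; have [k1 k2 k3 k4 k5] := hg _ hk.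
  apply: (same _ _ (maxn l' t') (maxn l' t')) => //;
    rewrite (center_nbox _ _ _ _ _ _).2; nlia.
have ht : diag_tiling n l t r b.
  split.
  - by move=> k hk; have [? ?] := lab k hk; have [_ _ _ ? ?] := hg k hk.
  - move=> i m hi hm; have [l' [t' [r' [b' [hx hlr htb]]]]] := drec_cell hR hi hm.
    have [k hk /nbox_inj[e1 e2 e3 e4]] := label_of _ hx.
    by exists k => //; rewrite /box_cell -e1 -e2 -e3 -e4; nlia.
  - move=> k k' i m hk hk' hc hc'; have [k1 _ _ _ _] := hg k hk.
    have [k1' _ _ _ _] := hg k' hk'.
    have /nbox_inj[e1 e2 _ _] :
        nbox F n (l k) (t k) (r k) (b k) = nbox F n (l k') (t k') (r k') (b k').
      by apply: (same _ _ i m) => //; rewrite (center_nbox _ _ _ _ _ _).2.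
    by rewrite -(lab k hk).1 -(lab k' hk').1 e1 e2.
have [f hf hb] := tiling_boxes ht; exists f => //.
have eb k : (k < n)%N -> rbox F n f k = nbox F n (l k) (t k) (r k) (b k).
  by move=> /hb[e1 e2 e3 e4]; rewrite /rbox e1 e2 e3 e4.
apply/fsetP => x; apply/idP/idP.
  by move=> /label_of[k hk ->]; rewrite -eb // mem_rects.
by case/rectsP => k hk ->; rewrite eb //; have [] := hg k hk.
Qed.

End Integral.

(** * Pivots *)

Lemma eq_boxes_low n f g k : inj_below n f -> inj_below n g -> (k < n)%N ->
  (forall j, (j < k)%N -> (f j < f k) = (g j < g k)) ->
  lft f k = lft g k /\ top f k = top g k.
Proof.
move=> hf hg hk h.
have h' j : (j < k)%N -> (f k < f j) = (g k < g j).
  move=> hj; have := h j hj; have : f j <> f k by [move=> /hf; lia].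
  by have : g j <> g k by [move=> /hg; lia]; lia.
have [l1 l2 l3] := lftP hg hk; have [t1 t2 t3] := topP hg hk.
split; [apply: lft_eq|apply: top_eq] => // [j hj|h0|j hj|h0].
- by rewrite h'; [apply: l2|lia].
- by rewrite h; [apply: l3|lia].
- by rewrite h; [apply: t2|lia].
- by rewrite h'; [apply: t3|lia].
Qed.

Lemma eq_boxes_high n f g k : inj_below n f -> inj_below n g -> (k < n)%N ->
  (forall j, (k < j < n)%N -> (f j < f k) = (g j < g k)) ->
  rgt n f k = rgt n g k /\ bot n f k = bot n g k.
Proof.
move=> hf hg hk h.
have h' j : (k < j < n)%N -> (f k < f j) = (g k < g j).
  move=> hj; have := h j hj; have : f j <> f k by [move=> /hf; lia].
  by have : g j <> g k by [move=> /hg; lia]; lia.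
have [l1 l2 l3] := rgtP hg hk; have [t1 t2 t3] := botP hg hk.
split; [apply: rgt_eq|apply: bot_eq] => // [j hj|h0|j hj|h0].
- by rewrite h; [apply: l2|lia].
- by rewrite h'; [apply: l3|lia].
- by rewrite h'; [apply: t2|lia].
- by rewrite h; [apply: t3|lia].
Qed.

(* Two boxes on the two sides of a vertical edge that can be pivoted: the edge
   crosses the diagonal, lies below it, or lies above it. *)
Definition pivotable n f a b : Prop :=
  [/\ (a < b < n)%N, rgt n f a = lft f b &
    [\/ [/\ b = a.+1, lft f b = b, top f a = top f b & bot n f a = bot n f b],
        [/\ (a.+1 < b)%N, lft f b = a.+1, top f b = b & bot n f a = bot n f b]
      | [/\ (a.+1 < b)%N, lft f b = b, top f a = top f b & bot n f a = a.+1]]].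

(* The boxes of g replacing those of f in the respective three cases. *)
Definition pivoted n f g a b : Prop :=
  [/\ lft g a = lft f a, top g a = top f a, rgt n g b = rgt n f b,
      bot n g b = bot n f b &
    [/\ b = a.+1 -> [/\ rgt n g a = rgt n f b, bot n g a = b, lft g b = lft f a
          & top g b = b],
        (a.+1 < b)%N -> lft f b = a.+1 -> [/\ rgt n g a = a.+1, bot n g a = b,
          lft g b = lft f a & top g b = b]
      & (a.+1 < b)%N -> lft f b = b -> [/\ rgt n g a = rgt n f b,
          bot n g a = a.+1, lft g b = b & top g b = a.+1]]].

Section SwapBoxes.
Variables (n : nat) (f g : nat -> int) (a b : nat).
Hypotheses (hf : inj_below n f) (hg : inj_below n g).
Hypothesis hs : swap_adj n f g a b.

Let hab : (a < b < n)%N. Proof. by case: hs. Qed.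
Let ha : (a < n)%N. Proof. by have := hab; lia. Qed.
Let hb : (b < n)%N. Proof. by have := hab; lia. Qed.

(** No label stands between a and b, so any other label has the same relation to both, before and
    after the swap. All comparisons below are reduced to [f j < f a]. *)
Let fa_b j : (j < n)%N -> j <> a -> j <> b -> (f j < f b) = (f j < f a).
Proof.
move=> hj ja jb; have [_ h1 _ h2 _] := hs.
have : f j <> f a by move=> /hf; lia.
by have := h2 j hj; lia.
Qed.

Let g_f j k : (j < n)%N -> (k < n)%N -> (j, k) <> (a, b) -> (j, k) <> (b, a) ->
  (f j < f k) = (g j < g k).
Proof. by have [_ _ _ _ h] := hs; move=> *; rewrite h. Qed.

Let ga j : (j < n)%N -> j <> a -> j <> b -> (g j < g a) = (f j < f a).
Proof. by move=> hj ja jb; rewrite g_f //; case=> *; lia. Qed.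

Let gb j : (j < n)%N -> j <> a -> j <> b -> (g j < g b) = (f j < f a).
Proof. by move=> hj ja jb; rewrite -fa_b // g_f //; case=> *; lia. Qed.

Let after_f j : (j < n)%N -> j <> a -> j <> b -> (f a < f j) = ~~ (f j < f a).
Proof. by move=> hj ja jb; have : f j <> f a by [move=> /hf; lia]; lia. Qed.

Let after_fb j : (j < n)%N -> j <> a -> j <> b -> (f b < f j) = ~~ (f j < f a).
Proof.
by move=> hj ja jb; rewrite -fa_b //; have : f j <> f b by [move=> /hf; lia]; lia.
Qed.

Let after_ga j : (j < n)%N -> j <> a -> j <> b -> (g a < g j) = ~~ (f j < f a).
Proof.
by move=> hj ja jb; rewrite -ga //; have : g j <> g a by [move=> /hg; lia]; lia.
Qed.

Let after_gb j : (j < n)%N -> j <> a -> j <> b -> (g b < g j) = ~~ (f j < f a).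
Proof.
by move=> hj ja jb; rewrite -gb //; have : g j <> g b by [move=> /hg; lia]; lia.
Qed.

Lemma swap_boxes_other k : (k < n)%N -> k <> a -> k <> b ->
  [/\ lft f k = lft g k, rgt n f k = rgt n g k,
      top f k = top g k & bot n f k = bot n g k].
Proof.
move=> hk ka kb; have [|-> ->] := @eq_boxes_low n f g k hf hg hk.
- by move=> j hj; apply: g_f; [lia|lia|case=> *; lia|case=> *; lia].
have [|-> ->] := @eq_boxes_high n f g k hf hg hk.
- by move=> j hj; apply: g_f; [lia|lia|case=> *; lia|case=> *; lia].
by split.
Qed.

(** The scans of a towards smaller labels and of b towards larger ones do not see the swap. For the
    other sides, all labels between a and b lie on the same side of the pair in the order, so a scan
    either stops at once or runs across the whole interval. *)
Lemma swap_boxes :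
  ((forall c, (a < c < b)%N -> f a < f c) \/ (forall c, (a < c < b)%N -> f c < f a)) ->
  pivotable n f a b /\ pivoted n f g a b.
Proof.
move=> hmid; have [_ fab gba _ _] := hs.
have [ela eta] : lft f a = lft g a /\ top f a = top g a.
  apply: (@eq_boxes_low n) => // j hj.
  by apply: g_f; [lia|lia|case=> *; lia|case=> *; lia].
have [erb ebb] : rgt n f b = rgt n g b /\ bot n f b = bot n g b.
  apply: (@eq_boxes_high n) => // j hj.
  by apply: g_f; [lia|lia|case=> *; lia|case=> *; lia].
have [la1 la2 la3] := lftP hf ha; have [ta1 ta2 ta3] := topP hf ha.
have [rb1 rb2 rb3] := rgtP hf hb; have [bb1 bb2 bb3] := botP hf hb.
have bot_a : (forall c, (a < c < b)%N -> f a < f c) -> bot n f a = bot n f b.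
  move=> hm; apply: bot_eq => [|j hj|h]; first by lia.
    case: (ltngtP j b) => [h|h|-> //]; first by apply: hm; lia.
    by have := bb2 j ltac:(lia); rewrite after_fb ?after_f //; lia.
  by have := bb3 h; rewrite fa_b; lia.
have top_b : (forall c, (a < c < b)%N -> f c < f a) -> top f b = top f a.
  move=> hm; apply: top_eq => [|j hj|h]; first by lia.
    case: (ltngtP j a) => [h|h|-> //]; last by rewrite fa_b; [apply: hm|..]; lia.
    by have := ta2 j ltac:(lia); rewrite fa_b; lia.
  by have := ta3 h; rewrite after_f ?after_fb; lia.
have rgt_ga : (forall c, (a < c < b)%N -> f c < f a) -> rgt n g a = rgt n f b.
  move=> hm; apply: rgt_eq => [|j hj|h]; first by lia.
    case: (ltngtP j b) => [h|h|-> //]; first by rewrite ga; [apply: hm|..]; lia.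
    by have := rb2 j ltac:(lia); rewrite fa_b ?ga; lia.
  by have := rb3 h; rewrite after_fb ?after_ga; lia.
have lft_gb : (forall c, (a < c < b)%N -> f a < f c) -> lft g b = lft f a.
  move=> hm; apply: lft_eq => [|j hj|h]; first by lia.
    case: (ltngtP j a) => [h|h|-> //]; last first.
      by have := hm j ltac:(lia); rewrite after_f ?after_gb; lia.
    by have := la2 j ltac:(lia); rewrite after_f ?after_gb; lia.
  by have := la3 h; rewrite gb; lia.
case: (eqVneq b a.+1) => [eb|nb].
  have hm c : ~ (a < c < b)%N by lia.
  have lfb : lft f b = b by apply: lft_eq => [|j hj|_]; [lia|lia|rewrite eb /= -eb].
  have rfa : rgt n f a = b by apply: rgt_eq => [|j /hm|_]; [lia|by []|by []].
  split.
    split=> //; first by rewrite rfa.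
    apply: Or31; split=> //; first by rewrite top_b // => c /hm.
    by rewrite bot_a // => c /hm.
  split=> //; split; [|lia|lia] => _; split.
  - by rewrite rgt_ga // => c /hm.
  - by apply: bot_eq => [|j|_]; [lia|lia|].
  - by rewrite lft_gb // => c /hm.
  - by apply: top_eq => [|j|_]; [lia|lia|rewrite {2}eb].
have hab1 : (a.+1 < b)%N by lia.
case: hmid => hm.
  have lfb : lft f b = a.+1.
    apply: lft_eq => [|j hj|_] //=; first by lia.
    by have := hm j ltac:(lia); rewrite after_f ?after_fb; lia.
  have rfa : rgt n f a = a.+1.
    by apply: rgt_eq => [|j hj|_]; [lia|lia|apply: hm; lia].
  split.
    split=> //; first by rewrite rfa.
    apply: Or32; split=> //; last exact: bot_a.
    apply: top_eq => [|j hj|_]; [lia|lia|].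
    by have := hm b.-1 ltac:(lia); rewrite after_f ?after_fb; lia.
  split=> //; split; [lia| |lia] => _ _; split.
  - apply: rgt_eq => [|j hj|_]; [lia|lia|].
    by have := hm a.+1 ltac:(lia); rewrite after_f ?after_ga; lia.
  - apply: bot_eq => [|j hj|_] //; first by lia.
    by have := hm j ltac:(lia); rewrite after_f ?after_ga; lia.
  - exact: lft_gb.
  - apply: top_eq => [|j hj|_]; [lia|lia|].
    by have := hm b.-1 ltac:(lia); rewrite after_f ?after_gb; lia.
have lfb : lft f b = b.
  apply: lft_eq => [|j hj|_] //=; first by lia.
  by have := hm b.-1 ltac:(lia); rewrite fa_b; lia.
have rfa : rgt n f a = b.
  by apply: rgt_eq => [|j hj|_] //; [lia|apply: hm; lia].
split.
  split=> //; first by rewrite rfa.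
  apply: Or33; split=> //; first by rewrite top_b.
  by apply: bot_eq => [|j hj|_]; [lia|lia|apply: hm; lia].
split=> //; split; [lia|lia|] => _ _; split.
- exact: rgt_ga.
- apply: bot_eq => [|j hj|_]; [lia|lia|].
  by have := hm a.+1 ltac:(lia); rewrite ga; lia.
- apply: lft_eq => [|j hj|_]; [lia|lia|].
  by have := hm b.-1 ltac:(lia); rewrite gb; lia.
- apply: top_eq => [|j hj|_] //=; first by lia.
  by have := hm j ltac:(lia); rewrite gb; lia.
Qed.

End SwapBoxes.

Lemma swap_not_mixed n f g a b : inj_below n f -> inj_below n g -> swap_adj n f g a b ->
  ~ (forall k, (k < n)%N -> [/\ lft f k = lft g k, rgt n f k = rgt n g k,
      top f k = top g k & bot n f k = bot n g k]) ->
  (forall c, (a < c < b)%N -> f a < f c) \/ (forall c, (a < c < b)%N -> f c < f a).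
Proof.
move=> hf hg hs hne; have [hab fab _ hno _] := hs.
case: (boolP [exists c : 'I_n, (a < c < b)%N && (f c < f a)]); last first.
  move/existsPn => h; left=> c hc; have hcn : (c < n)%N by lia.
  have := h (Ordinal hcn); rewrite /= hc /= => h'.
  by have : f c <> f a by [move=> /hf; lia]; lia.
case/existsP=> -[c hcn] /= /andP[hc hca]; right=> c' hc'.
rewrite ltNge; apply/negP => hac; apply: hne.
apply: (swap_adj_mixed hf hg hs hc hc') => //.
have : f c' <> f a by move=> /hf; lia.
have : f c' <> f b by move=> /hf; lia.
by have := hno c' ltac:(lia); lia.
Qed.

(** * Vertices, edges and locking *)

Section Edges.
Variables (F : realFieldType) (n : nat) (f : nat -> int).
Hypotheses (hn : (0 < n)%N) (hf : inj_below n f).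
Local Notation R := (rects F n f).

Definition grid_pt c v : point F := (c%:R, n%:R - v%:R).
(** Heights are measured downwards, so the lower end has the larger height [v2]. *)
Definition vseg c v1 v2 : box F := (grid_pt c v2, grid_pt c v1).

Definition is_vertex c v : bool := [exists k : 'I_n,
  ((c == lft f k) || (c == rgt n f k)) && ((v == top f k) || (v == bot n f k))]%N.

Lemma grid_pt_inj c v c' v' : grid_pt c v = grid_pt c' v' -> c = c' /\ v = v'.
Proof.
by case=> /eqP h /addrI/oppr_inj/eqP; rewrite !eqr_nat in h * => /eqP; move/eqP: h.
Qed.

Lemma vertexP p : vertex R p -> exists c v, p = grid_pt c v /\ is_vertex c v.
Proof.
case=> r /rectsP[k hk ->]; rewrite !inE => h.
have [c [v [-> hc hv]]] : exists c v, [/\ p = grid_pt c v,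
    (c == lft f k) || (c == rgt n f k) & (v == top f k) || (v == bot n f k)].
  case/or4P: h => /eqP ->; [exists (lft f k), (bot n f k)|exists (rgt n f k), (bot n f k)
    |exists (lft f k), (top f k)|exists (rgt n f k), (top f k)];
  by rewrite !eqxx ?orbT.
by exists c, v; split=> //; apply/existsP; exists (Ordinal hk); rewrite hc hv.
Qed.

Lemma vertex_grid c v : vertex R (grid_pt c v) <-> is_vertex c v.
Proof.
split=> [/vertexP[c' [v' [/grid_pt_inj[-> ->] //]]]|].
case/existsP=> -[k hk] /= /andP[hc hv]; exists (rbox F n f k); first exact: mem_rects.
by case/orP: hc => /eqP ->; case/orP: hv => /eqP ->;
  rewrite !inE /bottom_left /bottom_right /top_left /top_right /= !eqxx ?orbT.
Qed.

Lemma vertical_vseg c v1 v2 : vertical (vseg c v1 v2) = (v1 < v2)%N.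
Proof. by rewrite /vertical /= eqxx ltrD2l ltrN2 ltr_nat. Qed.

Lemma in_vseg c v1 v2 p : in_box (vseg c v1 v2) p =
  (p.1 == c%:R) && (v1%:R <= n%:R - p.2 <= v2%:R).
Proof. by rewrite /in_box /=; lra. Qed.

Lemma vseg_edge k c v1 v2 : (k < n)%N -> (c == lft f k) || (c == rgt n f k) ->
  (top f k <= v1 < v2)%N -> (v2 <= bot n f k)%N ->
  is_vertex c v1 -> is_vertex c v2 ->
  (forall v, (v1 < v < v2)%N -> ~~ is_vertex c v) -> edge R (vseg c v1 v2).
Proof.
move=> hk hc h1 h2 w1 w2 hno; split.
- by rewrite /is_seg vertical_vseg; nlia.
- have e1 : (top f k)%:R <= v1%:R :> F by rewrite ler_nat; nlia.
  have e2 : v2%:R <= (bot n f k)%:R :> F by rewrite ler_nat; nlia.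
  case/orP: hc => /eqP ec; exists (rbox F n f k).
    exists (left_side (rbox F n f k)); split; rewrite ?mem_rects ?inE ?eqxx //.
    by move=> p; rewrite in_vseg ec /in_box /=; lra.
  exists (right_side (rbox F n f k)); split; rewrite ?mem_rects ?inE ?eqxx ?orbT //.
  by move=> p; rewrite in_vseg ec /in_box /=; lra.
- exact/vertex_grid.
- exact/vertex_grid.
- move=> p /vertexP[c' [v [-> hv]]]; apply/negP => /and3P[].
  rewrite in_vseg /= opprB addrC subrK !ler_nat eqr_nat => /andP[/eqP ec h] n1 n2.
  rewrite {}ec in hv n1 n2.
  have nv1 : v <> v1 by move=> e; rewrite e eqxx in n2.
  have nv2 : v <> v2 by move=> e; rewrite e eqxx in n1.
  by have := hno v ltac:(nlia); rewrite hv.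
Qed.

Lemma edge_up k c v1 v2 : (k < n)%N -> (c == lft f k) || (c == rgt n f k) ->
  (top f k <= v1 < v2)%N -> (v2 <= bot n f k)%N ->
  is_vertex c v1 -> is_vertex c v2 ->
  exists e, edge R e /\ leaves e (grid_pt c v2) Up.
Proof.
move=> hk hc h1 h2 w1 w2.
pose P v := is_vertex c v && (v1 <= v < v2)%N.
have exP : exists v, P v by exists v1; rewrite /P w1; nlia.
have bP v : P v -> (v <= v2)%N by case/andP=> _; nlia.
case: (ex_maxnP exP bP) => v /andP[hv1 hv2] hmax.
exists (vseg c v v2); split; last by split=> //; rewrite vertical_vseg; nlia.
apply: (vseg_edge hk hc) => //; first by nlia.
move=> u hu; apply/negP => hu'; have := hmax u; rewrite /P hu'; nlia.
Qed.

Lemma edge_down k c v1 v2 : (k < n)%N -> (c == lft f k) || (c == rgt n f k) ->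
  (top f k <= v1 < v2)%N -> (v2 <= bot n f k)%N ->
  is_vertex c v1 -> is_vertex c v2 ->
  exists e, edge R e /\ leaves e (grid_pt c v1) Down.
Proof.
move=> hk hc h1 h2 w1 w2.
pose P v := is_vertex c v && (v1 < v <= v2)%N.
have exP : exists v, P v by exists v2; rewrite /P w2; nlia.
case: (ex_minnP exP) => v /andP[hv1 hv2] hmin.
exists (vseg c v1 v); split; last by split=> //; rewrite vertical_vseg; nlia.
apply: (vseg_edge hk hc) => //; first by nlia.
  by nlia.
move=> u hu; apply/negP => hu'; have := hmin u; rewrite /P hu'; nlia.
Qed.

Lemma edge_in_skeleton e : edge R e -> forall p, in_box e p -> skeleton R p.
Proof.
case=> _ [r [s [hr hs hsub]]] _ _ _ p /hsub hp; exists r => //.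
have [[/(_ r hr) /andP[r1 r2] _ _] _ _ _] := rects_is_drec F hn hf.
move: hs hp; rewrite !inE => /or4P[] /eqP ->;
  rewrite /rect_boundary /in_box /rect_interior /=; lra.
Qed.

(** A vertical segment of the skeleton on the line x = c lies in the wall through p_c
    ([skeleton_column]), whose upper end has height [top f c]. *)
Lemma no_edge_above e c v : (0 < c < n)%N -> (v <= top f c)%N -> edge R e ->
  ~ leaves e (grid_pt c v) Up.
Proof.
move=> hc hv he [hvert eq].
have [||_ _] := @skeleton_column F n hn f c%:R (n%:R - e.2.2) v%:R hf.
- by move: hvert; rewrite /vertical -eq /=; lra.
- move=> y hy; apply: (edge_in_skeleton he); move: hvert.
  by rewrite /vertical /in_box -eq /=; lra.
case=> [/eqP|/eqP|[i [hi /eqP + _ [h1 _]]]].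
- by rewrite pnatr_eq0; nlia.
- by rewrite eqr_nat; nlia.
rewrite eqr_nat => /eqP ec; rewrite -ec in h1.
have : v%:R <= (top f c)%:R :> F by rewrite ler_nat.
by move: hvert; rewrite /vertical -eq /=; lra.
Qed.

Lemma no_edge_below e c v : (0 < c < n)%N -> (bot n f c.-1 <= v)%N -> edge R e ->
  ~ leaves e (grid_pt c v) Down.
Proof.
move=> hc hv he [hvert eq].
have [||_ _] := @skeleton_column F n hn f c%:R v%:R (n%:R - e.1.2) hf.
- by move: hvert; rewrite /vertical -eq /=; lra.
- move=> y hy; apply: (edge_in_skeleton he); move: hvert.
  by rewrite /vertical /in_box -eq /=; lra.
case=> [/eqP|/eqP|[i [hi /eqP + _ [_ h1]]]].
- by rewrite pnatr_eq0; nlia.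
- by rewrite eqr_nat; nlia.
rewrite eqr_nat => /eqP ec; rewrite -ec in h1.
have : (bot n f c.-1)%:R <= v%:R :> F by rewrite ler_nat.
by move: hvert; rewrite /vertical -eq /=; lra.
Qed.

Lemma leaves_vseg_top c v1 v2 d : (v1 < v2)%N ->
  leaves (vseg c v1 v2) (grid_pt c v1) d -> d = Down.
Proof.
move=> h; case: d => //= -[].
- by move=> _ /grid_pt_inj[_]; nlia.
- by move=> + _; rewrite /horizontal /= ltxx.
- by move=> + _; rewrite /horizontal /= ltxx.
Qed.

Lemma leaves_vseg_bot c v1 v2 d : (v1 < v2)%N ->
  leaves (vseg c v1 v2) (grid_pt c v2) d -> d = Up.
Proof.
move=> h; case: d => //= -[].
- by move=> _ /grid_pt_inj[_]; nlia.
- by move=> + _; rewrite /horizontal /= ltxx.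
- by move=> + _; rewrite /horizontal /= ltxx.
Qed.

Section Vseg.
Variables c v1 v2 : nat.
Local Notation E := (vseg c v1 v2).
Hypotheses (hv : (v1 < v2)%N) (hE : edge R E).

Let dn : leaves E (grid_pt c v1) Down.
Proof. by split=> //; rewrite vertical_vseg. Qed.

Let up : leaves E (grid_pt c v2) Up.
Proof. by split=> //; rewrite vertical_vseg. Qed.

Lemma matched_top : matched R (grid_pt c v1) E <->
  exists e, edge R e /\ leaves e (grid_pt c v1) Up.
Proof.
split=> [[_ [d [/(leaves_vseg_top hv) -> //]]]|h].
by split=> //; exists Down.
Qed.

Lemma matched_bot : matched R (grid_pt c v2) E <->
  exists e, edge R e /\ leaves e (grid_pt c v2) Down.
Proof.
split=> [[_ [d [/(leaves_vseg_bot hv) -> //]]]|h].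
by split=> //; exists Up.
Qed.

Lemma unmatched_top : unmatched R (grid_pt c v1) E <->
  ~ exists e, edge R e /\ leaves e (grid_pt c v1) Up.
Proof.
split=> [[_ [d [/(leaves_vseg_top hv) -> //]]]|h].
by split=> //; exists Down.
Qed.

Lemma unmatched_bot : unmatched R (grid_pt c v2) E <->
  ~ exists e, edge R e /\ leaves e (grid_pt c v2) Down.
Proof.
split=> [[_ [d [/(leaves_vseg_bot hv) -> //]]]|h].
by split=> //; exists Up.
Qed.

(** The edge avoids the corners of the square, and a vertical edge leaves an endpoint toward the
    diagonal only when this is its upper end, above the diagonal, or its lower end, below it. *)
Lemma locked_vseg : (0 < c < n)%N -> locked n R E ->
  [\/ (v1 < c)%N /\ ~ unmatched R (grid_pt c v1) E |
      (c < v2)%N /\ ~ unmatched R (grid_pt c v2) E].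
Proof.
move=> hc; have c0 : (0 : F) < c%:R by rewrite ltr0n; nlia.
have cn : c%:R < n%:R :> F by rewrite ltr_nat; nlia.
have ncorner v : grid_pt c v \notin corners (square F n).
  by rewrite !inE !negb_or; apply/and4P; split; apply/eqP => -[]; lra.
case=> [h|[h|[p [_ _ _ [d hd ht] hu]]]].
- by move: h; rewrite (negbTE (ncorner v2)).
- by move: h; rewrite (negbTE (ncorner v1)).
case: d hd ht => -[].
- move=> _ ep; rewrite ep in hu *; rewrite /= => h; apply: or_intror; split=> //.
  by rewrite -(ltr_nat F); lra.
- move=> _ ep; rewrite ep in hu *; rewrite /= => h; apply: or_introl; split=> //.
  by rewrite -(ltr_nat F); lra.
- by move=> + _; rewrite /horizontal /= ltxx.
- by move=> + _; rewrite /horizontal /= ltxx.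
Qed.

Lemma not_locked_top : (0 < c < n)%N -> (v1 < c)%N -> ~ locked n R E ->
  ~ exists e, edge R e /\ leaves e (grid_pt c v1) Up.
Proof.
move=> hc h hl hup; apply: hl; right; right; exists (grid_pt c v1).
have c0 : (0 : F) < c%:R by rewrite ltr0n; nlia.
have cn : c%:R < n%:R :> F by rewrite ltr_nat; nlia.
split=> //; first by case: hE.
- by rewrite !inE !negb_or; apply/and4P; split; apply/eqP => -[]; lra.
- exists Down => //=; have : v1%:R < c%:R :> F by rewrite ltr_nat.
  lra.
- by move/unmatched_top.
Qed.

Lemma not_locked_bot : (0 < c < n)%N -> (c < v2)%N -> ~ locked n R E ->
  ~ exists e, edge R e /\ leaves e (grid_pt c v2) Down.
Proof.
move=> hc h hl hup; apply: hl; right; right; exists (grid_pt c v2).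
have c0 : (0 : F) < c%:R by rewrite ltr0n; nlia.
have cn : c%:R < n%:R :> F by rewrite ltr_nat; nlia.
split=> //; first by case: hE.
- by rewrite !inE !negb_or; apply/and4P; split; apply/eqP => -[]; lra.
- exists Up => //=; have : c%:R < v2%:R :> F by rewrite ltr_nat.
  lra.
- by move/unmatched_bot.
Qed.

End Vseg.

(** A box with a corner strictly inside the overlap covers a cell along the common side. This cell
    belongs to a or b, so the box is a or b, and neither has a corner there. *)
Lemma overlap_no_vertex a b v : (a < n)%N -> (b < n)%N -> rgt n f a = lft f b ->
  (maxn (top f a) (top f b) < v < minn (bot n f a) (bot n f b))%N ->
  ~~ is_vertex (lft f b) v.
Proof.
move=> ha hb hab hv; apply/existsP => -[[k hk] /= /andP[hc hvk]].
have [la _ _] := lftP hf ha; have [ra _ _] := rgtP hf ha.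
have [lb _ _] := lftP hf hb; have [rb _ _] := rgtP hf hb.
have [lk _ _] := lftP hf hk; have [rk _ _] := rgtP hf hk.
have [tk _ _] := topP hf hk; have [bk _ _] := botP hf hk.
have [m [hm1 hm2]] : exists m, (top f k <= m < bot n f k)%N /\ (v.-1 <= m <= v)%N.
  by case/orP: hvk => /eqP e; [exists v|exists v.-1]; nlia.
case/orP: hc => /eqP ec.
  have ekb : k = b.
    by apply: (@in_cell_uniq n f k b (lft f b) m) => //; rewrite /in_cell; nlia.
  by rewrite ekb in hvk; nlia.
have eka : k = a.
  by apply: (@in_cell_uniq n f k a (lft f b).-1 m) => //; rewrite /in_cell; nlia.
by rewrite eka in hvk; nlia.
Qed.

Definition shared_edge a b :=
  vseg (lft f b) (maxn (top f a) (top f b)) (minn (bot n f a) (bot n f b)).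

Lemma vertex_corner k c v : (k < n)%N -> (c == lft f k) || (c == rgt n f k) ->
  (v == top f k) || (v == bot n f k) -> is_vertex c v.
Proof. by move=> hk h1 h2; apply/existsP; exists (Ordinal hk); rewrite h1 h2. Qed.

Lemma vertex_shared_top a b : (a < n)%N -> (b < n)%N -> rgt n f a = lft f b ->
  is_vertex (lft f b) (maxn (top f a) (top f b)).
Proof.
move=> ha hb e; case: (leqP (top f a) (top f b)) => _.
  by apply: (@vertex_corner b); rewrite ?eqxx.
by apply: (@vertex_corner a); rewrite ?e ?eqxx ?orbT.
Qed.

Lemma vertex_shared_bot a b : (a < n)%N -> (b < n)%N -> rgt n f a = lft f b ->
  is_vertex (lft f b) (minn (bot n f a) (bot n f b)).
Proof.
move=> ha hb e; case: (leqP (bot n f a) (bot n f b)) => _.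
  by apply: (@vertex_corner a); rewrite ?e ?eqxx ?orbT.
by apply: (@vertex_corner b); rewrite ?eqxx ?orbT.
Qed.

Lemma shared_edge_edge a b : (a < n)%N -> (b < n)%N -> rgt n f a = lft f b ->
  (maxn (top f a) (top f b) < minn (bot n f a) (bot n f b))%N ->
  edge R (shared_edge a b).
Proof.
move=> ha hb e h; apply: (vseg_edge hb); rewrite ?eqxx //; try nlia.
- exact: vertex_shared_top.
- exact: vertex_shared_bot.
- by move=> v; apply: overlap_no_vertex.
Qed.

(** Where a case of [pivotable] gives equal tops or equal bottoms, the edge ends together with its
    wall and is unmatched. In the two vertex cases the other end is matched, but the edge leads from
    it away from the diagonal, so this end does not lock it. *)
Lemma pivotable_edge a b : pivotable n f a b ->
  let E := shared_edge a b in [/\ edge R E, ~ locked n R E &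
    if b == a.+1 then unmatched R E.1 E /\ unmatched R E.2 E
    else vertex_pivot_at R E].
Proof.
move=> [hab erl hcase]; rewrite /=.
have ha : (a < n)%N by nlia. have hb : (b < n)%N by nlia.
have [la _ _] := lftP hf ha; have [ra1 ra2 ra3] := rgtP hf ha.
have [ta1 ta2 ta3] := topP hf ha; have [ba1 ba2 ba3] := botP hf ha.
have [lb _ _] := lftP hf hb; have [rb _ _] := rgtP hf hb.
have [tb _ _] := topP hf hb; have [bb _ _] := botP hf hb.
have htb : (maxn (top f a) (top f b) < minn (bot n f a) (bot n f b))%N.
  by case: hcase => -[]; nlia.
have hc : (0 < lft f b < n)%N by nlia.
have hE := shared_edge_edge ha hb erl htb.
have vt := vertex_shared_top ha hb erl; have vb := vertex_shared_bot ha hb erl.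
have no_up : maxn (top f a) (top f b) = top f (lft f b) ->
    unmatched R (grid_pt (lft f b) (maxn (top f a) (top f b))) (shared_edge a b).
  by move=> e; apply/unmatched_top => //; case=> x [hx]; apply: no_edge_above; rewrite ?e.
have no_down : minn (bot n f a) (bot n f b) = bot n f (lft f b).-1 ->
    unmatched R (grid_pt (lft f b) (minn (bot n f a) (bot n f b))) (shared_edge a b).
  by move=> e; apply/unmatched_bot => //; case=> x [hx]; apply: no_edge_below; rewrite ?e.
case: hcase => -[h1 h2 h3 h4].
- have ut := no_up ltac:(rewrite h2; nlia).
  have eb : b.-1 = a by nlia.
  have ub := no_down ltac:(rewrite h2 eb; nlia).
  split=> //; last by case: (b =P a.+1).
  by case/(locked_vseg htb hc) => -[_]; apply.
- have ub := no_down ltac:(rewrite h2 /=; nlia).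
  split=> //.
    by case/(locked_vseg htb hc) => -[h]; [exfalso; nlia|apply].
  case: (b =P a.+1) => [e|_]; first by exfalso; nlia.
  right; split=> //; apply/matched_top => //.
  apply: (@edge_up a _ (top f a)) => //; rewrite ?erl ?eqxx ?orbT //; try nlia.
  by apply: (@vertex_corner a); rewrite ?erl ?eqxx ?orbT.
- have ut := no_up ltac:(rewrite h2; nlia).
  split=> //.
    by case/(locked_vseg htb hc) => -[h]; [apply|exfalso; nlia].
  case: (b =P a.+1) => [e|_]; first by exfalso; nlia.
  left; split=> //; apply/matched_bot => //.
  apply: (@edge_down b _ _ (bot n f b)) => //; rewrite ?eqxx ?orbT //; try nlia.
  by apply: (@vertex_corner b); rewrite ?eqxx ?orbT.
Qed.

End Edges.

(** * Cutting the union of two boxes *)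

Section Cuts.
Variable F : realFieldType.
Implicit Types (E U V : box F) (p : point F) (A : point F -> Prop) (x y : F).

Lemma cuts_into_sym E A V1 V2 : cuts_into E A V1 V2 -> cuts_into E A V2 V1.
Proof.
case=> h1 h2 h3 h4 h5; split=> // p; first by rewrite h4; tauto.
by rewrite h5; tauto.
Qed.

Lemma cut_is_thin E A V1 V2 x y x' y' : cuts_into E A V1 V2 -> x < x' -> y < y' ->
  in_box V1 (x, y) -> in_box V2 (x, y) -> in_box V1 (x', y') -> in_box V2 (x', y') ->
  False.
Proof.
move=> [hs _ _ _ h] hx hy h1 h2 h3 h4.
have := (h (x, y)).2 (conj h1 h2); have := (h (x', y')).2 (conj h3 h4).
by move: hs; rewrite /is_seg /vertical /horizontal /in_box /=; lra.
Qed.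

Lemma cut_eq E A V1 V2 x y x' y' : cuts_into E A V1 V2 ->
  x <= x' -> y <= y' ->
  (forall p, in_box V1 p && in_box V2 p = in_box ((x, y), (x', y')) p) ->
  E = ((x, y), (x', y')).
Proof.
move=> [hs _ _ _ h] hx hy hV.
have hE p : in_box E p = in_box ((x, y), (x', y')) p.
  by rewrite -hV; apply/idP/andP => /h.
have := hE E.1; have := hE E.2; have := hE (x, y); have := hE (x', y').
move: hs; rewrite /is_seg /vertical /horizontal /in_box /= => hs e1 e2 e3 e4.
by apply: box_eqP => /=; lra.
Qed.

(** The distribution of the four corners over the two boxes shows that the cut is a full horizontal
    or vertical segment; the point (x1, y) then fixes its position, and the vertical choice is
    excluded. *)
Lemma cut_rectangle E V1 V2 x0 x1 x2 y0 y y2 : x0 < x1 -> x1 < x2 -> y0 < y -> y < y2 ->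
  cuts_into E (fun p => in_box ((x0, y0), (x1, y2)) p \/ in_box ((x1, y0), (x2, y2)) p)
    V1 V2 ->
  in_box E (x1, y) -> E <> ((x1, y0), (x1, y2)) ->
  (V1 = ((x0, y), (x2, y2)) /\ V2 = ((x0, y0), (x2, y))) \/
  (V2 = ((x0, y), (x2, y2)) /\ V1 = ((x0, y0), (x2, y))).
Proof.
move=> hx01 hx12 hy0 hy2; wlog : V1 V2 / in_box V1 (x0, y2) => [hw|h1] hcut hp hE.
  have [_ _ _ h _] := hcut.
  have /(h (x0, y2)).1[hV|hV] : in_box ((x0, y0), (x1, y2)) (x0, y2) \/
      in_box ((x1, y0), (x2, y2)) (x0, y2) by left; rewrite /in_box /=; lra.
    exact: hw.
  by case: (hw _ _ hV (cuts_into_sym hcut) hp hE); [right|left].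
left; have thin := cut_is_thin hcut; have heq := cut_eq hcut.
have [hs r1 r2 h hi] := hcut.
have [hp1 hp2] := (hi _).1 hp.
have in1 p : in_box V1 p -> x0 <= p.1 <= x2 /\ y0 <= p.2 <= y2.
  by move=> hV; have [] := (h p).2 (or_introl hV); rewrite /in_box /=; split; lra.
have in2 p : in_box V2 p -> x0 <= p.1 <= x2 /\ y0 <= p.2 <= y2.
  by move=> hV; have [] := (h p).2 (or_intror hV); rewrite /in_box /=; split; lra.
have q2 : in_box V1 (x2, y2) \/ in_box V2 (x2, y2).
  by apply/h; right; rewrite /in_box /=; lra.
have q3 : in_box V1 (x2, y0) \/ in_box V2 (x2, y0).
  by apply/h; right; rewrite /in_box /=; lra.
have q4 : in_box V1 (x0, y0) \/ in_box V2 (x0, y0).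
  by apply/h; left; rewrite /in_box /=; lra.
case: V1 V2 => [[a1 c1] [b1 d1]] [[a2 c2] [b2 d2]] in hcut thin heq h1 r1 r2 h hi hp1 hp2 in1 in2 q2 q3 q4 *.
move: r1 r2; rewrite /is_rect /= => /andP[r1 r1'] /andP[r2 r2'].
have [/andP[i1 _] /andP[i1' _]] := in1 (a1, c1) ltac:(rewrite /in_box /=; lra).
have [/andP[_ i2] /andP[_ i2']] := in1 (b1, d1) ltac:(rewrite /in_box /=; lra).
have [/andP[i3 _] /andP[i3' _]] := in2 (a2, c2) ltac:(rewrite /in_box /=; lra).
have [/andP[_ i4] /andP[_ i4']] := in2 (b2, d2) ltac:(rewrite /in_box /=; lra).
rewrite /= in i1 i2 i3 i4 i1' i2' i3' i4'.
rewrite /in_box /= in h1 hp1 hp2 q2 q3 q4 thin.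
clear in1 in2 h hi hs.
have ea1 : a1 = x0 by clear -h1 i1; lra.
have ed1 : d1 = y2 by clear -h1 i2'; lra.
subst a1 d1.
(* Neither box contains the other, since they overlap only in a segment: [hthin2] excludes V2 inside
   V1, and [hthin1] the converse. *)
have hthin2 : (x0 <= a2) && (b2 <= b1) && (c1 <= c2) && (d2 <= y2) -> False.
  by move=> hh; apply: (thin a2 c2 b2 d2) => //; clear -hh r2 r2'; lra.
have hthin1 : (a2 <= x0) && (b1 <= b2) && (c2 <= c1) && (y2 <= d2) -> False.
  by move=> hh; apply: (thin x0 c1 b1 y2) => //; clear -hh r1 r1'; lra.
have {}q3 : b2 = x2 /\ c2 = y0.
  case: q3 => q3; last by clear -q3 i4 i3'; split; lra.
  by case: hthin2; clear -q3 i3 i4 i3' i4'; lra.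
case: q3 => eb2 ec2; subst b2 c2.
(* V1 holds the top left corner and V2 the bottom right one. With the top right corner in V1 the cut
   is horizontal at height y; with this corner in V2 it would be the excluded vertical segment. *)
case: q2 => q2.
  have eb1 : b1 = x2 by clear -q2 i2; lra.
  subst b1; case: q4 => q4; first by case: hthin2; clear -q4 i3 i4'; lra.
  have ea2 : a2 = x0 by clear -q4 i3; lra.
  subst a2.
  have ecd : c1 = d2.
    case: (ltP c1 d2) => hcd; last by clear -hcd hp1 hp2; lra.
    by exfalso; apply: (thin x0 c1 x2 d2) => //; clear -hcd r1 r1' r2 r2' i1' i4'; lra.
  have ecy : c1 = y by clear -ecd hp1 hp2; lra.
  by rewrite -ecd ecy.
have ed2 : d2 = y2 by clear -q2 i4'; lra.
subst d2; case: q4 => q4; last by case: hthin1; clear -q4 i2 i1'; lra.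
have ec1 : c1 = y0 by clear -q4 i1'; lra.
subst c1.
have eab : a2 = b1.
  case: (ltP a2 b1) => hcd; last by clear -hcd hp1 hp2; lra.
  by exfalso; apply: (thin a2 y0 b1 y2) => //; clear -hcd r1 r1' r2 r2' i3 i2; lra.
have ea2 : a2 = x1 by clear -eab hp1 hp2; lra.
subst a2 b1.
exfalso; apply: hE; apply: heq; [by []|exact: ltW|].
by move=> p; rewrite /in_box /=; clear -hx01 hx12; lra.
Qed.

(* The hexagon whose top right corner is missing. *)
Lemma cut_hexagon E V1 V2 x0 x1 x2 y0 y1 y2 : x0 < x1 -> x1 < x2 -> y0 < y1 -> y1 < y2 ->
  cuts_into E (fun p => in_box ((x0, y0), (x1, y2)) p \/ in_box ((x1, y0), (x2, y1)) p)
    V1 V2 ->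
  E <> ((x1, y0), (x1, y1)) ->
  (V1 = ((x0, y1), (x1, y2)) /\ V2 = ((x0, y0), (x2, y1))) \/
  (V2 = ((x0, y1), (x1, y2)) /\ V1 = ((x0, y0), (x2, y1))).
Proof.
move=> hx01 hx12 hy0 hy2; wlog : V1 V2 / in_box V1 (x1, y2) => [hw|h1] hcut hE.
  have [_ _ _ h _] := hcut.
  have /(h (x1, y2)).1[hV|hV] : in_box ((x0, y0), (x1, y2)) (x1, y2) \/
      in_box ((x1, y0), (x2, y1)) (x1, y2) by left; rewrite /in_box /=; lra.
    exact: hw.
  by case: (hw _ _ hV (cuts_into_sym hcut) hE); [right|left].
left; have thin := cut_is_thin hcut; have heq := cut_eq hcut.
have [hs r1 r2 h hi] := hcut.
have in1 p : in_box V1 p -> [/\ x0 <= p.1 <= x2, y0 <= p.2 <= y2 & x1 < p.1 -> p.2 <= y1].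
  by move=> hV; have [] := (h p).2 (or_introl hV); rewrite /in_box /=; split; lra.
have in2 p : in_box V2 p -> [/\ x0 <= p.1 <= x2, y0 <= p.2 <= y2 & x1 < p.1 -> p.2 <= y1].
  by move=> hV; have [] := (h p).2 (or_intror hV); rewrite /in_box /=; split; lra.
have q1 : in_box V1 (x0, y2) \/ in_box V2 (x0, y2).
  by apply/h; left; rewrite /in_box /=; lra.
have q3 : in_box V1 (x2, y1) \/ in_box V2 (x2, y1).
  by apply/h; right; rewrite /in_box /=; lra.
have q4 : in_box V1 (x2, y0) \/ in_box V2 (x2, y0).
  by apply/h; right; rewrite /in_box /=; lra.
have q5 : in_box V1 (x0, y0) \/ in_box V2 (x0, y0).
  by apply/h; left; rewrite /in_box /=; lra.
case: V1 V2 => [[a1 c1] [b1 d1]] [[a2 c2] [b2 d2]] in hcut thin heq h1 r1 r2 h hi in1 in2 q1 q3 q4 q5 *.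
move: r1 r2; rewrite /is_rect /= => r1 r2.
have [/andP[i1 _] /andP[i1' _] _] := in1 (a1, c1) ltac:(clear -r1; rewrite /in_box /=; lra).
have [/andP[_ i2] /andP[_ i2'] i2''] := in1 (b1, d1) ltac:(clear -r1; rewrite /in_box /=; lra).
have [/andP[i3 _] /andP[i3' _] _] := in2 (a2, c2) ltac:(clear -r2; rewrite /in_box /=; lra).
have [/andP[_ i4] /andP[_ i4'] i4''] := in2 (b2, d2) ltac:(clear -r2; rewrite /in_box /=; lra).
rewrite /= in i1 i2 i3 i4 i1' i2' i3' i4' i2'' i4''.
rewrite /in_box /= in h1 q1 q3 q4 q5 thin.
have ed1 : d1 = y2 by clear -h1 i2'; lra.
subst d1.
(* V1 reaches the height y2, so it cannot extend to the right of x1, where the hexagon ends at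
   y1. *)
have eb1 : b1 = x1.
  have : b1 <= x1 by case: (leP b1 x1) => // /i2''; clear -hy2; lra.
  by clear -h1; lra.
subst b1.
have [eb2 hd2] : b2 = x2 /\ y1 <= d2.
  by case: q3 => q3; [exfalso; clear -q3 hx12|clear -q3 i4; split]; lra.
subst b2.
have ed2 : d2 = y1 by have := i4'' hx12; clear -hd2; lra.
subst d2.
have ea1 : a1 = x0 by case: q1 => q1; [clear -q1 i1|exfalso; clear -q1 hy2]; lra.
have ec2 : c2 = y0 by case: q4 => q4; [exfalso; clear -q4 hx12|clear -q4 i3']; lra.
subst a1 c2.
(* The bottom left corner decides between the two cuts of the hexagon: in V1 it yields the vertical
   one, excluded by [hE], and in V2 the horizontal one. *)
case: q5 => q5.
  have ec1 : c1 = y0 by clear -q5 i1'; lra.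
  subst c1.
  have ha2 : a2 <= x1.
    rewrite leNgt; apply/negP => hlt.
    have /h : in_box ((x0, y0), (x1, y2)) ((x1 + a2) / 2, y0) \/
        in_box ((x1, y0), (x2, y1)) ((x1 + a2) / 2, y0).
      by right; rewrite /in_box /=; clear -hlt hy0 r2; lra.
    by rewrite /in_box /= => -[]; clear -hlt; lra.
  have ha2' : a2 = x1.
    case: (ltP a2 x1) => hlt; last by clear -ha2 hlt; lra.
    by exfalso; apply: (thin a2 y0 x1 y1) => //; clear -hlt i3 hx01 hx12 hy0 hy2; lra.
  subst a2; exfalso; apply: hE; apply: heq; [by []|exact: ltW|].
  by move=> p; rewrite /in_box /=; clear -hx01 hx12 hy0 hy2; lra.
have ea2 : a2 = x0 by clear -q5 i3; lra.
subst a2.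
have hc1 : c1 <= y1.
  rewrite leNgt; apply/negP => hlt.
  have /h : in_box ((x0, y0), (x1, y2)) (x0, (y1 + c1) / 2) \/
      in_box ((x1, y0), (x2, y1)) (x0, (y1 + c1) / 2).
    by left; rewrite /in_box /=; clear -hlt hx01 hy0 r1; lra.
  by rewrite /in_box /= => -[]; clear -hlt; lra.
have -> : c1 = y1; last by split.
case: (ltP c1 y1) => hlt; last by clear -hc1 hlt; lra.
by exfalso; apply: (thin x0 c1 x1 y1) => //; clear -hlt i1' hx01 hx12 hy0 hy2; lra.
Qed.

(** The half-turn about the origin exchanges the two kinds of hexagons. *)
Definition opp_box U : box F := ((- U.2.1, - U.2.2), (- U.1.1, - U.1.2)).

Lemma in_opp_box U x y : in_box (opp_box U) (x, y) = in_box U (- x, - y).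
Proof. by rewrite /in_box /=; lra. Qed.

Lemma opp_boxK : involutive opp_box.
Proof. by move=> U; apply: box_eqP; rewrite /= opprK. Qed.

(* The hexagon whose bottom left corner is missing. *)
Lemma cut_hexagon_opp E V1 V2 x0 x1 x2 y0 y1 y2 :
  x0 < x1 -> x1 < x2 -> y0 < y1 -> y1 < y2 ->
  cuts_into E (fun p => in_box ((x0, y1), (x1, y2)) p \/ in_box ((x1, y0), (x2, y2)) p)
    V1 V2 ->
  E <> ((x1, y1), (x1, y2)) ->
  (V1 = ((x0, y1), (x2, y2)) /\ V2 = ((x1, y0), (x2, y1))) \/
  (V2 = ((x0, y1), (x2, y2)) /\ V1 = ((x1, y0), (x2, y1))).
Proof.
move=> hx01 hx12 hy0 hy2 [h1 h2 h3 h4 h5] hE.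
have hcut : cuts_into (opp_box E) (fun p =>
    in_box ((- x2, - y2), (- x1, - y0)) p \/ in_box ((- x1, - y2), (- x0, - y1)) p)
    (opp_box V1) (opp_box V2).
  split.
  - by move: h1; rewrite /is_seg /vertical /horizontal /=; lra.
  - by move: h2; rewrite /is_rect /=; lra.
  - by move: h3; rewrite /is_rect /=; lra.
  - case=> x y; rewrite !in_opp_box -h4 -!in_opp_box /opp_box /=; tauto.
  - by case=> x y; rewrite !in_opp_box.
have [||||||] := cut_hexagon _ _ _ _ hcut; rewrite ?ltrN2 //.
- move=> e; apply: hE; rewrite -(opp_boxK E) e.
  by apply: box_eqP; rewrite /= opprK.
- case=> e1 e2; right; split.
    by rewrite -(opp_boxK V2) e2; apply: box_eqP; rewrite /= opprK.
  by rewrite -(opp_boxK V1) e1; apply: box_eqP; rewrite /= opprK.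
- case=> e1 e2; left; split.
    by rewrite -(opp_boxK V1) e2; apply: box_eqP; rewrite /= opprK.
  by rewrite -(opp_boxK V2) e1; apply: box_eqP; rewrite /= opprK.
Qed.

End Cuts.

(** * From swaps to pivots *)

Section Pivots.
Variables (F : realFieldType) (n : nat).
Hypothesis hn : (0 < n)%N.
Local Notation rects := (rects F n).
Local Notation rbox := (rbox F n).
Implicit Types (f g : nat -> int) (a b : nat).

(** The new segment is horizontal, at height b for a diagonal pivot or one below the diagonal, and
    at height [a.+1] for one above it. *)
Lemma pivot_cut f g a b : inj_below n f -> pivotable n f a b -> pivoted n f g a b ->
  exists E', [/\ E' <> shared_edge F n f a b,
    cuts_into E' (fun p => in_box (rbox f a) p \/ in_box (rbox f b) p)
      (rbox g a) (rbox g b)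
    & b = a.+1 -> in_box E' (diag_pt F n b)].
Proof.
move=> hf [hab erl hcase] [ela eta erb ebb [g1 g2 g3]].
have ha : (a < n)%N by nlia. have hb : (b < n)%N by nlia.
have [la _ _] := lftP hf ha; have [ra _ _] := rgtP hf ha.
have [ta _ _] := topP hf ha; have [ba _ _] := botP hf ha.
have [lb _ _] := lftP hf hb; have [rb _ _] := rgtP hf hb.
have [tb _ _] := topP hf hb; have [bb _ _] := botP hf hb.
have cuts E A V1 V2 : is_seg E -> is_rect V1 -> is_rect V2 ->
    (forall p, A p <-> in_box V1 p || in_box V2 p) ->
    (forall p, in_box E p = in_box V1 p && in_box V2 p) -> cuts_into E A V1 V2.
  by move=> q1 q2 q3 q4 q5; split=> // p; [rewrite q4; split=> /orP|rewrite q5; split=> /andP].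
have lt_nat (i j : nat) : (i < j)%N -> i%:R < j%:R :> F by rewrite ltr_nat.
have l1 := lt_nat (lft f a) (lft f b) ltac:(nlia).
have l2 := lt_nat (lft f b) (rgt n f b) ltac:(nlia).
case: hcase => -[h1 h2 h3 h4].
- have [e1 e2 e3 e4] := g1 h1; rewrite h2 in l1 l2 erl.
  have l3 := lt_nat (top f a) b ltac:(nlia).
  have l4 := lt_nat b (bot n f b) ltac:(nlia).
  have -> : rbox f a = nbox F n (lft f a) (top f a) b (bot n f b).
    by rewrite /rbox erl h4.
  have -> : rbox f b = nbox F n b (top f a) (rgt n f b) (bot n f b).
    by rewrite /rbox h2 h3.
  have -> : rbox g a = nbox F n (lft f a) (top f a) (rgt n f b) b.
    by rewrite /rbox ela eta e1 e2.
  have -> : rbox g b = nbox F n (lft f a) b (rgt n f b) (bot n f b).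
    by rewrite /rbox e3 e4 erb ebb.
  exists (((lft f a)%:R, n%:R - b%:R), ((rgt n f b)%:R, n%:R - b%:R)); split.
  + by move/(congr1 (fun z : box F => z.1.1)); rewrite /= h2; clear -l1 l2; lra.
  + apply: cuts; rewrite ?/is_seg ?/is_rect ?/vertical ?/horizontal /=;
      try (clear -l1 l2 l3 l4; lra).
      by move=> p; rewrite !in_nbox; split=> [[]|]; clear -l1 l2 l3 l4; lra.
    by move=> p; rewrite !in_nbox /in_box /=; clear -l1 l2 l3 l4; lra.
  + by move=> _; rewrite /in_box /=; clear -l1 l2; lra.
- have [e1 e2 e3 e4] := g2 h1 h2; rewrite h2 in l1 l2 erl.
  have l3 := lt_nat (top f a) b ltac:(nlia).
  have l4 := lt_nat b (bot n f b) ltac:(nlia).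
  have -> : rbox f a = nbox F n (lft f a) (top f a) a.+1 (bot n f b).
    by rewrite /rbox erl h4.
  have -> : rbox f b = nbox F n a.+1 b (rgt n f b) (bot n f b).
    by rewrite /rbox h2 h3.
  have -> : rbox g a = nbox F n (lft f a) (top f a) a.+1 b.
    by rewrite /rbox ela eta e1 e2.
  have -> : rbox g b = nbox F n (lft f a) b (rgt n f b) (bot n f b).
    by rewrite /rbox e3 e4 erb ebb.
  exists (((lft f a)%:R, n%:R - b%:R), (a.+1%:R, n%:R - b%:R)).
  split; last by move=> e; exfalso; nlia.
  + by move/(congr1 (fun z : box F => z.1.1)); rewrite /= h2; clear -l1 l2; lra.
  + apply: cuts; rewrite ?/is_seg ?/is_rect ?/vertical ?/horizontal /=;
      try (clear -l1 l2 l3 l4; lra).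
      by move=> p; rewrite !in_nbox; split=> [[]|]; clear -l1 l2 l3 l4; lra.
    by move=> p; rewrite !in_nbox /in_box /=; clear -l1 l2 l3 l4; lra.
- have [e1 e2 e3 e4] := g3 h1 h2; rewrite h2 in l1 l2 erl.
  have l3 := lt_nat (top f a) a.+1 ltac:(nlia).
  have l4 := lt_nat a.+1 (bot n f b) ltac:(nlia).
  have -> : rbox f a = nbox F n (lft f a) (top f a) b a.+1.
    by rewrite /rbox erl h4.
  have -> : rbox f b = nbox F n b (top f a) (rgt n f b) (bot n f b).
    by rewrite /rbox h2 h3.
  have -> : rbox g a = nbox F n (lft f a) (top f a) (rgt n f b) a.+1.
    by rewrite /rbox ela eta e1 e2.
  have -> : rbox g b = nbox F n b a.+1 (rgt n f b) (bot n f b).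
    by rewrite /rbox e3 e4 erb ebb.
  exists ((b%:R, n%:R - a.+1%:R), ((rgt n f b)%:R, n%:R - a.+1%:R)).
  split; last by move=> e; exfalso; nlia.
  + by move/(congr1 (fun z : box F => z.2.1)); rewrite /= h2; clear -l1 l2; lra.
  + apply: cuts; rewrite ?/is_seg ?/is_rect ?/vertical ?/horizontal /=;
      try (clear -l1 l2 l3 l4; lra).
      by move=> p; rewrite !in_nbox; split=> [[]|]; clear -l1 l2 l3 l4; lra.
    by move=> p; rewrite !in_nbox /in_box /=; clear -l1 l2 l3 l4; lra.
Qed.

Lemma rects_swap f g a b : inj_below n f -> inj_below n g -> swap_adj n f g a b ->
  rects g = ((rects f `\` [fset rbox f a; rbox f b]) `|` [fset rbox g a; rbox g b])%fset.
Proof.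
move=> hf hg hs; have [hab _ _ _ _] := hs.
have other k : (k < n)%N -> k <> a -> k <> b -> rbox f k = rbox g k.
  move=> hk ka kb; have [e1 e2 e3 e4] := swap_boxes_other hf hg hs hk ka kb.
  by rewrite /rbox e1 e2 e3 e4.
have inj k j : (k < n)%N -> (j < n)%N -> rbox f k = rbox f j -> k = j.
  by move=> hk hj /(rbox_rects_inj hf hf hk hj)[].
apply/fsetP => x; rewrite in_fsetU in_fsetD !in_fset2; apply/idP/idP.
  case/rectsP=> k hk ->.
  case: (eqVneq k a) => [->|/eqP ka]; first by rewrite eqxx ?orbT.
  case: (eqVneq k b) => [->|/eqP kb]; first by rewrite eqxx ?orbT.
  rewrite -other // mem_rects // andbT; apply/orP; left; apply/norP.
  by split; apply/eqP => /inj e; [apply: ka|apply: kb]; apply: e; nlia.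
case/orP => [/andP[/norP[/eqP na /eqP nb] /rectsP[k hk e]]|/orP[/eqP ->|/eqP ->]].
- rewrite e in na nb *; rewrite other ?mem_rects //.
    by move=> ek; apply: na; rewrite ek.
  by move=> ek; apply: nb; rewrite ek.
- by rewrite mem_rects //; nlia.
- by rewrite mem_rects //; nlia.
Qed.

Lemma in_shared_edge f a b p : inj_below n f -> (a < n)%N -> (b < n)%N ->
  rgt n f a = lft f b -> in_box (shared_edge F n f a b) p ->
  rect_boundary (rbox f a) p /\ rect_boundary (rbox f b) p.
Proof.
move=> hf ha hb erl; rewrite in_vseg => /andP[/eqP e1 /andP[h1 h2]].
have [la _ _] := lftP hf ha; have [ra _ _] := rgtP hf ha.
have [lb _ _] := lftP hf hb; have [rb _ _] := rgtP hf hb.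
have le_nat (i j : nat) : (i <= j)%N -> i%:R <= j%:R :> F by rewrite ler_nat.
have l1 := le_nat (lft f a) (lft f b) ltac:(nlia).
have l2 := le_nat (lft f b) (rgt n f b) ltac:(nlia).
have l3 := le_nat _ _ (leq_maxl (top f a) (top f b)).
have l4 := le_nat _ _ (leq_maxr (top f a) (top f b)).
have l5 := le_nat _ _ (geq_minl (bot n f a) (bot n f b)).
have l6 := le_nat _ _ (geq_minr (bot n f a) (bot n f b)).
rewrite /rect_boundary !in_nbox !nbox_interior e1 erl.
by clear -l1 l2 l3 l4 l5 l6 h1 h2; split; lra.
Qed.

Lemma pivoted_neq f g a b : inj_below n f -> inj_below n g ->
  pivotable n f a b -> pivoted n f g a b -> rects f <> rects g.
Proof.
move=> hf hg [hab erl hcase] [_ _ _ _ [g1 g2 g3]] e.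
have ha : (a < n)%N by nlia. have hb : (b < n)%N by nlia.
have [_ er _ eb] := rects_inj hf hg e ha.
have [bb _ _] := botP hf hb; have [rb _ _] := rgtP hf hb.
case: hcase => -[h1 h2 h3 h4].
- by have [_ e2 _ _] := g1 h1; nlia.
- by have [_ e2 _ _] := g2 h1 h2; nlia.
- by have [e1 _ _ _] := g3 h1 h2; nlia.
Qed.

Lemma swap_pivots f g a b : inj_below n f -> inj_below n g -> swap_adj n f g a b ->
  rects f <> rects g ->
  vertical (shared_edge F n f a b) /\
  pivots_to n (rects f) (shared_edge F n f a b) (rects g).
Proof.
move=> hf hg hs hne.
have [hp hpd] := swap_boxes hf hg hs
  (swap_not_mixed hf hg hs (fun h => hne (eq_rects F h))).
have [hE hl hm] := pivotable_edge F hn hf hp.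
have [E' [hE' hcut hX]] := pivot_cut hf hp hpd.
have [hab erl hcase] := hp.
have ha : (a < n)%N by nlia. have hb : (b < n)%N by nlia.
have [ta _ _] := topP hf ha; have [ba _ _] := botP hf ha.
have [tb _ _] := topP hf hb; have [bb _ _] := botP hf hb.
split; first by rewrite vertical_vseg; case: hcase => -[]; nlia.
split=> //; exists (rbox f a), (rbox f b), E', (rbox g a), (rbox g b); split.
- split; [exact: mem_rects|exact: mem_rects|].
  by case/(rbox_rects_inj hf hf ha hb); nlia.
- by move=> p; exact: in_shared_edge.
- by split.
- case: (b =P a.+1) hm => [e [u1 u2]|_ hv]; [left|by right].
  split=> //; exists (diag_pt F n b); split; last exact: hX.
    by exists b; split=> //; nlia.
  rewrite in_vseg /= opprB addrC subrK !ler_nat eqr_nat.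
  by case: hcase => -[]; nlia.
- exact: rects_swap.
Qed.

End Pivots.

(* The entries strictly between a and b are moved out: those above b before a,
   those below a after b. *)
Definition make_adjacent (f : nat -> int) a b : nat -> int := fun d =>
  if d == a then f b else if d == b then f b + 1
  else if (f d < f a) || ((f d < f b) && (b < d)%N) then f d
  else f d + (f b - f a) + 2.

(** The pairs that change their order are a with a moved q > b, a moved p < a with b, and two moved
    labels p < a and q > b. [boxes_invariant] needs witnesses for each: the early one is the label
    from [hbig], or a, and the late one is the label from [hsmall], or b. *)
Lemma make_adjacent_boxes n f a b : inj_below n f -> (a < b < n)%N -> f a < f b ->
  (forall d, (a < d < b)%N -> ~ (f a < f d < f b)) ->
  (forall g, (b < g < n)%N -> f a < f g < f b ->
     exists2 c, (a < c < g)%N & f c < f a) ->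
  (forall s, (s < a)%N -> f a < f s < f b ->
     exists2 c, (s < c < b)%N & f b < f c) ->
  let g := make_adjacent f a b in
  [/\ inj_below n g, g a < g b, forall c, (c < n)%N -> ~ (g a < g c < g b) &
    forall k, (k < n)%N -> [/\ lft f k = lft g k, rgt n f k = rgt n g k,
      top f k = top g k & bot n f k = bot n g k]].
Proof.
move=> hf hab fab hmid hbig hsmall g.
(* Since a and b receive the keys [f b] and [f b + 1], the shift [f b - f a + 2] puts every key
   larger than [f a] beyond both, and keeps the order among shifted labels. *)
have ga : g a = f b by rewrite /g /make_adjacent eqxx.
have gb : g b = f b + 1 by rewrite /g /make_adjacent eqxx; case: eqP => //; lia.
have ne i j : (i < n)%N -> (j < n)%N -> i <> j -> f i <> f j by move=> hi hj h /hf; lia.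
have gd d : (d < n)%N -> d <> a -> d <> b ->
    [\/ f d < f a /\ g d = f d, [/\ f a < f d < f b, (b < d)%N & g d = f d],
        [/\ f a < f d < f b, (d < a)%N & g d = f d + (f b - f a) + 2]
      | f b < f d /\ g d = f d + (f b - f a) + 2].
  move=> hd da db; have na := ne d a; have nb := ne d b; have hm := hmid d.
  rewrite /g /make_adjacent; do 2 (case: eqP => // _).
  case: (ltP (f d) (f a)) => h1 /=; first by apply: Or41; split.
  case: (ltP (f d) (f b)) => h2 /=; last by apply: Or44; split=> //; lia.
  case: (ltnP b d) => h3; first by apply: Or42; split=> //; lia.
  by apply: Or43; split=> //; lia.
clearbody g.
have ha : (a < n)%N by lia. have hb : (b < n)%N by lia.
have hg : inj_below n g.
  move=> i j hi hj.
  case: (eqVneq i a) => [->|/eqP ia]; case: (eqVneq j a) => [->|/eqP ja] //.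
  - case: (eqVneq j b) => [->|/eqP jb]; first by lia.
    by case: (gd j hj ja jb) => -[]; lia.
  - case: (eqVneq i b) => [->|/eqP ib]; first by lia.
    by case: (gd i hi ia ib) => -[]; lia.
  case: (eqVneq i b) => [->|/eqP ib]; case: (eqVneq j b) => [->|/eqP jb] //.
  - by case: (gd j hj ja jb) => -[]; lia.
  - by case: (gd i hi ia ib) => -[]; lia.
  move=> e; apply: hf => //; move: e.
  by case: (gd i hi ia ib) => -[]; case: (gd j hj ja jb) => -[]; lia.
split=> //; first by lia.
  move=> c hc; case: (eqVneq c a) => [->|/eqP ca]; first by lia.
  by case: (eqVneq c b) => [->|/eqP cb]; lia.
have prefix c : (c < n)%N -> f c < f a -> g c = f c.
  move=> hc h; have ca : c <> a by move=> e; rewrite e in h; lia.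
  have cb : c <> b by move=> e; rewrite e in h; lia.
  by case: (gd c hc ca cb) => -[]; lia.
have suffix c : (c < n)%N -> f b < f c -> g c = f c + (f b - f a) + 2.
  move=> hc h; have ca : c <> a by move=> e; rewrite e in h; lia.
  have cb : c <> b by move=> e; rewrite e in h; lia.
  by case: (gd c hc ca cb) => -[]; lia.
apply: boxes_invariant => // p q hpq hne.
have hp : (p < n)%N by lia. have hq : (q < n)%N by lia.
have : [\/ p = a /\ (b < q)%N /\ f a < f q < f b,
           q = b /\ (p < a)%N /\ f a < f p < f b
         | ((p < a)%N /\ f a < f p < f b) /\ ((b < q)%N /\ f a < f q < f b)].
  move: hne; case: (eqVneq p a) => [ep|/eqP pa].
    case: (eqVneq q b) => [eq|/eqP qb]; first by rewrite ep eq; lia.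
    by rewrite ep; case: (gd q hq ltac:(lia) qb) => -[h1 h2 *]; try lia; apply: Or31; lia.
  case: (eqVneq q b) => [eq|/eqP qb].
    by rewrite eq; case: (gd p hp pa ltac:(lia)) => -[h1 h2 *]; try lia; apply: Or32; lia.
  case: (eqVneq p b) => [ep|/eqP pb].
    by rewrite ep; case: (gd q hq ltac:(lia) qb) => -[]; lia.
  case: (eqVneq q a) => [eq|/eqP qa].
    by rewrite eq; case: (gd p hp pa pb) => -[]; lia.
  case: (gd p hp pa pb) => -[h1 h2 *]; case: (gd q hq qa qb) => -[h3 h4 *]; try lia.
  by apply: Or33; split.
case=> [[ep [h1 h2]]|[eq [h1 h2]]|[[h1 h2] [h3 h4]]].
- have [|c hc hca] := hbig q _ h2; first by lia.
  have gc := prefix c ltac:(lia) hca.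
  have gq : g q = f q by case: (gd q hq ltac:(lia) ltac:(lia)) => -[]; lia.
  by rewrite ep; exists c, b; split; [lia|lia|split; lia|split; lia].
- have [c hc hca] := hsmall p h1 h2.
  have gc := suffix c ltac:(lia) hca.
  have gp : g p = f p + (f b - f a) + 2 by case: (gd p hp ltac:(lia) ltac:(lia)) => -[]; lia.
  by rewrite eq; exists a, c; split; [lia|lia|split; lia|split; lia].
- have [|c hc hca] := hbig q _ h4; first by lia.
  have gc := prefix c ltac:(lia) hca.
  have [c' hc' hca'] := hsmall p h1 h2.
  have gc' := suffix c' ltac:(lia) hca'.
  have gq : g q = f q by case: (gd q hq ltac:(lia) ltac:(lia)) => -[]; lia.
  have gp : g p = f p + (f b - f a) + 2 by case: (gd p hp ltac:(lia) ltac:(lia)) => -[]; lia.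
  by exists c, c'; split; [lia|lia|split; lia|split; lia].
Qed.

Lemma pivotable_order n f a b : inj_below n f -> pivotable n f a b -> f a < f b /\
  ((forall c, (a < c < b)%N -> f b < f c) \/ (forall c, (a < c < b)%N -> f c < f a)).
Proof.
move=> hf [hab erl hcase].
have ha : (a < n)%N by lia. have hb : (b < n)%N by lia.
have [l1 l2 l3] := lftP hf hb; have [r1 r2 r3] := rgtP hf ha.
case: hcase => -[h1 h2 h3 h4].
- rewrite h2 in erl l3; split; last by left=> c; lia.
  by rewrite erl in r3; apply: r3.
- rewrite h2 in erl l2 l3; split; first exact: l3.
  by left=> c hc; apply: l2; lia.
- rewrite h2 in erl; rewrite erl in r2 r3; split; first exact: r3.
  by right=> c hc; apply: r2; lia.
Qed.

Lemma pivotable_adjacent n f a b : inj_below n f -> pivotable n f a b ->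
  exists x y : 'S_n, [/\ weak_cover x y, swap_adj n (key x) (key y) a b &
    forall k, (k < n)%N -> [/\ lft f k = lft (key x) k,
      rgt n f k = rgt n (key x) k, top f k = top (key x) k
      & bot n f k = bot n (key x) k]].
Proof.
move=> hf hp; have [fab hmid] := pivotable_order hf hp.
have [hab erl hcase] := hp.
have ha : (a < n)%N by lia. have hb : (b < n)%N by lia.
have [la1 la2 la3] := lftP hf ha; have [ra1 ra2 ra3] := rgtP hf ha.
have [ta1 ta2 ta3] := topP hf ha; have [ba1 ba2 ba3] := botP hf ha.
have [lb1 lb2 lb3] := lftP hf hb; have [rb1 rb2 rb3] := rgtP hf hb.
have [tb1 tb2 tb3] := topP hf hb; have [bb1 bb2 bb3] := botP hf hb.
(* With equal bottoms one label stops the downward scans of both boxes, so it comes before a; a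
   label g > b that comes before b lies beyond it. [above_a] is the counterpart with equal tops. *)
have below_b : bot n f a = bot n f b -> forall g, (b < g < n)%N -> f a < f g < f b ->
    exists2 c, (a < c < g)%N & f c < f a.
  move=> e g hg hfg; rewrite e in ba3; exists (bot n f b); last by have := bb2 g; lia.
  have : bot n f b <> g by move=> eg; rewrite eg in ba3; lia.
  by have := bb2 g; lia.
have above_a : top f a = top f b -> forall s, (s < a)%N -> f a < f s < f b ->
    exists2 c, (s < c < b)%N & f b < f c.
  move=> e s hs hfs; rewrite -e in tb3; exists (top f a).-1; last by have := ta2 s; lia.
  have : (top f a).-1 <> s by move=> es; rewrite es in tb3; have := ta2 s; lia.
  by have := ta2 s; lia.
have [||| hg gab gno hbox] := make_adjacent_boxes hf hab fab.
- by move=> d hd; case: hmid => /(_ d hd); lia.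
- case: hcase => -[h1 h2 h3 h4]; [exact: below_b|exact: below_b|].
  move=> g hg hfg; exists a.+1; first by lia.
  by apply: ra2; lia.
- case: hcase => -[h1 h2 h3 h4]; [exact: above_a| |exact: above_a].
  move=> s hs hfs; exists a.+1; first by lia.
  by apply: lb2; lia.
have [x hx] := perm_of_key hg.
have xab : key x a < key x b by rewrite hx.
have [|y hxy hsw] := swap_adj_up hab xab.
  move=> c hc /andP[h1 h2]; apply: (gno c hc).
  by move: h1 h2; rewrite !hx // => -> ->.
exists x, y; split=> // k hk; have [-> -> -> ->] := hbox k hk.
by apply: boxes_invariant => // [|p q hpq]; [exact: inj_key|rewrite hx ?eqxx //; lia].
Qed.

(** * From pivots to swaps *)

Section PivotSwap.
Variables (F : realFieldType) (n : nat).
Hypothesis hn : (0 < n)%N.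
Local Notation rects := (rects F n).
Local Notation rbox := (rbox F n).
Implicit Types (f g : nat -> int) (a b : nat).

(** At a height inside a row, E lies on a left or right side of each box. Two left sides or two
    right sides would give the boxes a common cell, so one box is to the left of E and the other to
    the right. *)
Lemma vertical_in_boundaries f k1 k2 (E : box F) : inj_below n f ->
  (k1 < n)%N -> (k2 < n)%N -> k1 <> k2 -> vertical E ->
  (forall p, in_box E p -> rect_boundary (rbox f k1) p /\ rect_boundary (rbox f k2) p) ->
  exists a b, [/\ (a = k1 /\ b = k2) \/ (a = k2 /\ b = k1), rgt n f a = lft f b,
    E.1.1 = (lft f b)%:R &
    (maxn (top f a) (top f b))%:R <= n%:R - E.2.2 /\
    n%:R - E.1.2 <= (minn (bot n f a) (bot n f b))%:R].
Proof.
case: E => [[c y1] [c' y2]] hf hk1 hk2 hk; rewrite /vertical /= => /andP[/eqP <- hy] hE.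
have rows k y : (k = k1 \/ k = k2) -> y1 <= y <= y2 ->
    (top f k)%:R <= n%:R - y <= (bot n f k)%:R.
  move=> ek hyy; have [] := hE (c, y); first by rewrite /in_box /=; lra.
  by rewrite /rect_boundary !in_nbox /=; case: ek => ->; lra.
have bounds k : (k < n)%N -> 0 <= (top f k)%:R :> F /\ (bot n f k)%:R <= n%:R :> F.
  by move=> h; have [? _ _] := botP hf h; rewrite ler0n ler_nat; split=> //; nlia.
have [b1 b2] := bounds _ hk1.
have r1 := rows k1 y1 (or_introl erefl) ltac:(lra).
have r2 := rows k1 y2 (or_introl erefl) ltac:(lra).
have [m [v [hm hv hvm]]] := @exists_in_cell F n (n%:R - y2) (n%:R - y1)
  ltac:(lra) ltac:(lra) ltac:(lra).
have side k : (k = k1 \/ k = k2) -> (top f k <= m < bot n f k)%N /\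
    (c = (lft f k)%:R \/ c = (rgt n f k)%:R).
  move=> ek; have hr := rows k (n%:R - v) ek ltac:(lra).
  have hm1 : (top f k <= m < bot n f k)%N.
    by rewrite -ltnS -(ltr_nat F) -(ltr_nat F m (bot n f k)); lra.
  split=> //.
  have ht1 : (top f k)%:R <= m%:R :> F by rewrite ler_nat; nlia.
  have ht2 : m.+1%:R <= (bot n f k)%:R :> F by rewrite ler_nat; nlia.
  have hb : rect_boundary (rbox f k) (c, n%:R - v).
    by have [] := hE (c, n%:R - v); [rewrite /in_box /=; lra|case: ek => ->].
  move: hb; rewrite /rect_boundary in_nbox nbox_interior /= => hb.
  case: (eqVneq c (lft f k)%:R) => [|h1]; first by left.
  case: (eqVneq c (rgt n f k)%:R) => [|h2]; first by right.
  by exfalso; clear -hb h1 h2 ht1 ht2 hvm; lra.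
have [m1 s1] := side k1 (or_introl erefl); have [m2 s2] := side k2 (or_intror erefl).
have [l1 _ _] := lftP hf hk1; have [q1 _ _] := rgtP hf hk1.
have [l2 _ _] := lftP hf hk2; have [q2 _ _] := rgtP hf hk2.
have fin a b : (a = k1 \/ a = k2) -> (b = k1 \/ b = k2) ->
    (maxn (top f a) (top f b))%:R <= n%:R - y2 /\
    n%:R - y1 <= (minn (bot n f a) (bot n f b))%:R.
  move=> ea eb; have := rows a y1 ea ltac:(lra); have := rows a y2 ea ltac:(lra).
  have := rows b y1 eb ltac:(lra); have := rows b y2 eb ltac:(lra).
  by rewrite /maxn /minn; split; [case: ifP|case: ifP]; lra.
have nat_eq (i j : nat) : c = i%:R -> c = j%:R -> i = j.
  by move=> -> /eqP; rewrite eqr_nat => /eqP.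
case: s1 => s1; case: s2 => s2.
- have e := nat_eq _ _ s1 s2; exfalso; apply: hk.
  by apply: (@in_cell_uniq n f k1 k2 (lft f k1) m) => //; rewrite /in_cell; nlia.
- exists k2, k1; split; [by right|exact: nat_eq|by []|].
  by apply: fin; [right|left].
- exists k1, k2; split; [by left|exact: nat_eq|by []|].
  by apply: fin; [left|right].
- have e := nat_eq _ _ s1 s2; exfalso; apply: hk.
  by apply: (@in_cell_uniq n f k1 k2 (rgt n f k1).-1 m) => //; rewrite /in_cell; nlia.
Qed.

(** The endpoints of E are vertices in the closed overlap of the two sides, and there are no
    vertices strictly inside it. *)
Lemma shared_edge_uniq f a b (E : box F) : inj_below n f -> (a < n)%N -> (b < n)%N ->
  rgt n f a = lft f b -> vertical E -> edge (rects f) E -> E.1.1 = (lft f b)%:R ->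
  (maxn (top f a) (top f b))%:R <= n%:R - E.2.2 ->
  n%:R - E.1.2 <= (minn (bot n f a) (bot n f b))%:R ->
  E = shared_edge F n f a b /\ (maxn (top f a) (top f b) < minn (bot n f a) (bot n f b))%N.
Proof.
move=> hf ha hb erl hv [_ _ hv1 hv2 _] ec h1 h2.
have [c2 [v2 [e1 w2]]] := vertexP hv1; have [c1 [v1 [e2 w1]]] := vertexP hv2.
case: E => [p1 p2] in hv hv1 hv2 ec h1 h2 e1 e2 *; rewrite /= in e1 e2 ec h1 h2.
rewrite e1 e2 /= in hv ec h1 h2 *.
have ec1 : c1 = c2 by move: hv; rewrite /vertical /= eqr_nat => /andP[/eqP].
have v12 : (v1 < v2)%N by rewrite ec1 vertical_vseg in hv.
have ec2 : c2 = lft f b by apply/eqP; rewrite -(eqr_nat F) ec.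
move: h1 h2; rewrite !opprB ![_%:R + (_ - _)]addrC !subrK !ler_nat => h1 h2.
rewrite ec1 ec2 in w1 w2 *.
have no v := @overlap_no_vertex n f hn hf a b v ha hb erl.
have ev1 : v1 = maxn (top f a) (top f b).
  by have := no v1; rewrite w1 => h; nlia.
have ev2 : v2 = minn (bot n f a) (bot n f b).
  by have := no v2; rewrite w2 => h; nlia.
by rewrite ev1 ev2; split=> //; nlia.
Qed.

(** If the tops differ at an upper end above the diagonal, or the bottoms at a lower end below it,
    the longer side continues past this end and makes it matched, so that it locks the edge. *)
Lemma unlocked_pivotable f a b : inj_below n f -> (a < n)%N -> (b < n)%N ->
  rgt n f a = lft f b -> (maxn (top f a) (top f b) < minn (bot n f a) (bot n f b))%N ->
  ~ locked n (rects f) (shared_edge F n f a b) -> pivotable n f a b.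
Proof.
move=> hf ha hb erl hov hl; have hE := shared_edge_edge F hn hf ha hb erl hov.
have [la _ _] := lftP hf ha; have [ra _ _] := rgtP hf ha.
have [ta _ _] := topP hf ha; have [ba _ _] := botP hf ha.
have [lb _ _] := lftP hf hb; have [rb _ _] := rgtP hf hb.
have [tb _ _] := topP hf hb; have [bb _ _] := botP hf hb.
have mna := min_rgt_bot hf ha; have mxb := max_lft_top hf hb.
have hc : (0 < lft f b < n)%N by nlia.
have vt := vertex_shared_top ha hb erl; have vb := vertex_shared_bot ha hb erl.
have no_up : (maxn (top f a) (top f b) < lft f b)%N -> top f a = top f b.
  move=> h; case: (ltngtP (top f a) (top f b)) => // hlt;
    case: (not_locked_top hn hov hE hc h hl).
    apply: (@edge_up F n f hn a _ (top f a)) => //; rewrite ?erl ?eqxx ?orbT //; try nlia.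
    by apply: (@vertex_corner n f a); rewrite ?erl ?eqxx ?orbT.
  apply: (@edge_up F n f hn b _ (top f b)) => //; rewrite ?eqxx ?orbT //; try nlia.
  by apply: (@vertex_corner n f b); rewrite ?eqxx ?orbT.
have no_down : (lft f b < minn (bot n f a) (bot n f b))%N -> bot n f a = bot n f b.
  move=> h; case: (ltngtP (bot n f a) (bot n f b)) => // hlt;
    case: (not_locked_bot hn hov hE hc h hl).
    apply: (@edge_down F n f hn b _ _ (bot n f b)) => //; rewrite ?eqxx ?orbT //; try nlia.
    by apply: (@vertex_corner n f b); rewrite ?eqxx ?orbT.
  apply: (@edge_down F n f hn a _ _ (bot n f a)) => //; rewrite ?erl ?eqxx ?orbT //; try nlia.
  by apply: (@vertex_corner n f a); rewrite ?erl ?eqxx ?orbT.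
have tb' : lft f b = b -> (top f b < b)%N.
  move=> e; rewrite ltn_neqAle tb andbT; apply/eqP => e'.
  have [_ _ l3] := lftP hf hb; have [_ _ t3] := topP hf hb.
  by rewrite e in l3; rewrite e' in t3; nlia.
have ba' : rgt n f a = a.+1 -> (a.+1 < bot n f a)%N.
  move=> e; rewrite ltn_neqAle; apply/andP; split; last by nlia.
  apply/eqP => e'; have [_ _ r3] := rgtP hf ha; have [_ _ b3] := botP hf ha.
  by rewrite e in r3; rewrite -e' in b3; nlia.
split=> //; first by nlia.
(* If the edge lies neither at b nor at [a.+1], then [bot n f a = a.+1] and [top f b = b], and the
   two boxes share no height. *)
case: (eqVneq (lft f b) b) => eb; case: (eqVneq (lft f b) a.+1) => ea.
- by apply: Or31; split; [nlia|by []|apply: no_up; nlia|apply: no_down; nlia].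
- by apply: Or33; split; [nlia|by []|apply: no_up; nlia|nlia].
- by apply: Or32; split; [nlia|by []|nlia|apply: no_down; nlia].
- by exfalso; nlia.
Qed.

Lemma pivot_cut_uniq f g a b E' V1 V2 : inj_below n f ->
  pivotable n f a b -> pivoted n f g a b ->
  cuts_into E' (fun p => in_box (rbox f a) p \/ in_box (rbox f b) p) V1 V2 ->
  E' <> shared_edge F n f a b -> (b = a.+1 -> in_box E' (diag_pt F n b)) ->
  (V1 = rbox g a /\ V2 = rbox g b) \/ (V2 = rbox g a /\ V1 = rbox g b).
Proof.
move=> hf [hab erl hcase] [ela eta erb ebb [g1 g2 g3]] hcut hE hX.
have ha : (a < n)%N by nlia. have hb : (b < n)%N by nlia.
have [la _ _] := lftP hf ha; have [ra _ _] := rgtP hf ha.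
have [ta _ _] := topP hf ha; have [ba _ _] := botP hf ha.
have [lb _ _] := lftP hf hb; have [rb _ _] := rgtP hf hb.
have [tb _ _] := topP hf hb; have [bb _ _] := botP hf hb.
have lt_nat (i j : nat) : (i < j)%N -> i%:R < j%:R :> F by rewrite ltr_nat.
have gt_nat (i j : nat) : (i < j)%N -> n%:R - j%:R < n%:R - i%:R :> F.
  by rewrite ltrD2l ltrN2 ltr_nat.
have l1 := lt_nat (lft f a) (lft f b) ltac:(nlia).
have l2 := lt_nat (lft f b) (rgt n f b) ltac:(nlia).
case: hcase => -[h1 h2 h3 h4].
- have [e1 e2 e3 e4] := g1 h1; rewrite h2 in l1 l2 erl.
  have l3 := gt_nat (top f a) b ltac:(nlia).
  have l4 := gt_nat b (bot n f b) ltac:(nlia).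
  have ea : rbox f a = nbox F n (lft f a) (top f a) b (bot n f b).
    by rewrite /rbox erl h4.
  have eb : rbox f b = nbox F n b (top f a) (rgt n f b) (bot n f b).
    by rewrite /rbox h2 h3.
  have -> : rbox g a = nbox F n (lft f a) (top f a) (rgt n f b) b.
    by rewrite /rbox ela eta e1 e2.
  have -> : rbox g b = nbox F n (lft f a) b (rgt n f b) (bot n f b).
    by rewrite /rbox e3 e4 erb ebb.
  rewrite ea eb in hcut; apply: (cut_rectangle l1 l2 l4 l3 hcut (hX h1)).
  by move=> e; apply: hE; rewrite e /shared_edge h2 h4 -h3 maxnn minnn.
- have [e1 e2 e3 e4] := g2 h1 h2; rewrite h2 in l1 l2 erl.
  have l3 := gt_nat (top f a) b ltac:(nlia).
  have l4 := gt_nat b (bot n f b) ltac:(nlia).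
  have ea : rbox f a = nbox F n (lft f a) (top f a) a.+1 (bot n f b).
    by rewrite /rbox erl h4.
  have eb : rbox f b = nbox F n a.+1 b (rgt n f b) (bot n f b).
    by rewrite /rbox h2 h3.
  have -> : rbox g a = nbox F n (lft f a) (top f a) a.+1 b.
    by rewrite /rbox ela eta e1 e2.
  have -> : rbox g b = nbox F n (lft f a) b (rgt n f b) (bot n f b).
    by rewrite /rbox e3 e4 erb ebb.
  rewrite ea eb in hcut; apply: (cut_hexagon l1 l2 l4 l3 hcut).
  move=> e; apply: hE; rewrite e /shared_edge h2 h3 h4 minnn.
  by have -> : maxn (top f a) b = b by nlia.
- have [e1 e2 e3 e4] := g3 h1 h2; rewrite h2 in l1 l2 erl.
  have l3 := gt_nat (top f a) a.+1 ltac:(nlia).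
  have l4 := gt_nat a.+1 (bot n f b) ltac:(nlia).
  have ea : rbox f a = nbox F n (lft f a) (top f a) b a.+1.
    by rewrite /rbox erl h4.
  have eb : rbox f b = nbox F n b (top f a) (rgt n f b) (bot n f b).
    by rewrite /rbox h2 h3.
  have -> : rbox g a = nbox F n (lft f a) (top f a) (rgt n f b) a.+1.
    by rewrite /rbox ela eta e1 e2.
  have -> : rbox g b = nbox F n b a.+1 (rgt n f b) (bot n f b).
    by rewrite /rbox e3 e4 erb ebb.
  rewrite ea eb in hcut; apply: (cut_hexagon_opp l1 l2 l4 l3 hcut).
  move=> e; apply: hE; rewrite e /shared_edge h2 -h3 h4 maxnn.
  by have -> : minn a.+1 (bot n f b) = a.+1 by nlia.
Qed.

(** For b = a + 1 both ends of the edge are unmatched, which rules out a vertex pivot. The diagonal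
    pivot supplies a point of X on both segments, and the only one on the line x = b is p_b. *)
Lemma pivotable_pivot_point f a b E' : inj_below n f -> pivotable n f a b ->
  let E := shared_edge F n f a b in
  diagonal_pivot_at n (rects f) E E' \/ vertex_pivot_at (rects f) E ->
  b = a.+1 -> in_box E' (diag_pt F n b).
Proof.
move=> hf hp E hkind eb; have [hE _] := pivotable_edge F hn hf hp.
have [hab erl hcase] := hp.
have ha : (a < n)%N by nlia. have hb : (b < n)%N by nlia.
have [ta _ _] := topP hf ha; have [ba _ _] := botP hf ha.
have [tb _ _] := topP hf hb; have [bb _ _] := botP hf hb.
have htb : (maxn (top f a) (top f b) < minn (bot n f a) (bot n f b))%N.
  by case: hcase => -[]; nlia.
rewrite {1}eb eqxx => -[u1 u2]; case: hkind => [[_ _ [p [[i [hi ->]] hpE hpE']]]|[[m _]|[m _]]].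
- have lb : lft f b = b by case: hcase => -[]; nlia.
  move: hpE; rewrite in_vseg lb /= eqr_nat => /andP[/eqP ei _].
  by rewrite -ei.
- by case: ((unmatched_bot hn htb hE).1 u1); apply/(matched_bot hn htb hE).
- by case: ((unmatched_top hn htb hE).1 u2); apply/(matched_top hn htb hE).
Qed.

(** The labels on the two sides of E need not be adjacent in f, so f is first replaced by a
    permutation x with the same boxes in which they are; uniqueness of the cut then identifies the
    result of the pivot with that of the swap. *)
Lemma swap_of_pivot f (E : box F) R' : inj_below n f -> vertical E ->
  pivots_to n (rects f) E R' ->
  exists (x y : 'S_n) a b, [/\ rects f = rects (key x), R' = rects (key y),
    rects (key x) <> rects (key y) & swap_adj n (key x) (key y) a b].
Proof.
move=> hf hv [hE hl [U1 [U2 [E' [V1 [V2 [[hU1 hU2 hU] hbd [hE' hcut] hkind eR']]]]]]].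
have [k1 hk1 e1] := (rectsP n f U1).1 hU1; have [k2 hk2 e2] := (rectsP n f U2).1 hU2.
rewrite {}e1 {}e2 {U1 U2 hU1 hU2} in hU hbd hcut eR'.
have hk : k1 <> k2 by move=> e; apply: hU; rewrite e.
have [a [b [hk12 erl ec [h1 h2]]]] := vertical_in_boundaries hf hk1 hk2 hk hv hbd.
have [ha hb] : (a < n)%N /\ (b < n)%N by case: hk12 => -[-> ->].
have [eE hov] := shared_edge_uniq hf ha hb erl hv hE ec h1 h2.
have {}hcut : cuts_into E' (fun p => in_box (rbox f a) p \/ in_box (rbox f b) p) V1 V2.
  have [c1 c2 c3 c4 c5] := hcut; split=> // p; rewrite -c4.
  by case: hk12 => -[-> ->]; tauto.
have {}eR' : R' = ((rects f `\` [fset rbox f a; rbox f b]) `|` [fset V1; V2])%fset.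
  rewrite eR'; apply/fsetP => p; rewrite !in_fsetU !in_fsetD !in_fset2.
  by case: hk12 => -[-> ->] //; rewrite [_ || (p == rbox f k1)]orbC.
clear h1 h2 hbd hk12 hU ec; subst E.
have hp := unlocked_pivotable hf ha hb erl hov hl.
have [x [y [_ hs hbox]]] := pivotable_adjacent hf hp.
have erf : rects f = rects (key x) by apply: eq_rects.
have hgx := @inj_key n x; have hgy := @inj_key n y.
have [a1 a2 a3 a4] := hbox a ha; have [b1 b2 b3 b4] := hbox b hb.
have hpx : pivotable n (key x) a b.
  by move: hp; rewrite /pivotable a2 a3 a4 b1 b3 b4.
have hmid : (forall c, (a < c < b)%N -> key x a < key x c) \/
    (forall c, (a < c < b)%N -> key x c < key x a).
  have [xab [h|h]] := pivotable_order hgx hpx; [left=> c /h|by right].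
  by move: xab; clear; lia.
have [_ hpd] := swap_boxes hgx hgy hs hmid.
have era : rbox f a = rbox (key x) a by rewrite /rbox a1 a2 a3 a4.
have erb : rbox f b = rbox (key x) b by rewrite /rbox b1 b2 b3 b4.
have ese : shared_edge F n f a b = shared_edge F n (key x) a b.
  by rewrite /shared_edge a3 a4 b1 b3 b4.
rewrite era erb in hcut eR'; rewrite erf in eR' hkind; rewrite ese in hE' hkind.
have hX := pivotable_pivot_point hgx hpx hkind.
exists x, y, a, b; split=> //; last exact: (pivoted_neq hn hgx hgy hpx hpd).
rewrite eR' (rects_swap F hn hgx hgy hs).
have [[-> ->]|[-> ->]] := pivot_cut_uniq hgx hpx hpd hcut hE' hX; first by [].
by apply/fsetP => p; rewrite !in_fsetU !in_fsetD !in_fset2; congr (_ || _); rewrite orbC.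
Qed.

End PivotSwap.

Theorem theorem7p1 (F : realFieldType) (n : nat) (hn : (1 <= n)%N)
    (R R' : {fset box F}) (hR : is_drec n R) (hR' : is_drec n R') :
  drec_covers n R R' <->
  (exists E : box F, vertical E /\ pivots_to n R E R').
Proof.
split=> [hcov|[E [hv hE]]].
  have [|x [y [a [b [eR eR' hs]]]]] := swap_of_covers _ hcov.
    by move=> x; apply: rects_is_drec => //; exact: inj_key.
  have [[_ hne] _] := hcov; rewrite eR eR' in hne *.
  exists (shared_edge F n (key x) a b).
  exact: (swap_pivots hn (@inj_key n x) (@inj_key n y) hs hne).
have [f hf eR] := drec_key hn hR; rewrite eR in hE *.
have [x [y [a [b [-> -> hne hs]]]]] := swap_of_pivot hn hf hv hE.
exact: covers_of_swap hs hne.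
Qed.
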